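(* For every integer $n\ge3$ there exists a sequence $(M_k^n)_{k\ge1}$ of compact (smooth) embedded hypersurfaces of $\mathbb{R}^{n+1}$, each diffeomorphic to $\mathbb{S}^n$, whose extrinsic diameters (diameters as subsets of $\mathbb{R}^{n+1}$) are bounded uniformly in $k$, such that $$\frac{\operatorname{vol}(M_k^n)}{T(M_k^n)}\longrightarrow\infty\quad\text{as }k\to\infty.$$
   Context: For a hypersurface $M\subset\mathbb{R}^{n+1}$, $T(M)=\int_M|\mathcal{K}|\,dV$ is the total curvature, where $\mathcal{K}=k_1k_2\cdots k_n$ is the Gauss–Kronecker curvature, the product of the principal curvatures of $M$; $\operatorname{vol}$ is the $n$-dimensional volume. *)

(* Defs.v *)
From HB Require Import structures.
From mathcomp Require Import all_boot all_order all_algebra.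
From mathcomp Require Import all_classical all_reals all_analysis.

Set Implicit Arguments.
Unset Strict Implicit.
Unset Printing Implicit Defensive.

Import Order.TTheory GRing.Theory Num.Theory.
Import numFieldNormedType.Exports.

Local Open Scope classical_set_scope.
Local Open Scope ring_scope.

(** * Lebesgue measure on R^n *)

Section lebesgue_measure_Rn.
Context {R : realType}.

Notation Rm := (measurableTypeR R).
Notation lambda := (@lebesgue_measure R : {sigma_finite_measure set Rm -> \bar R}).

Definition cons_pair n (p : Rm * n.-tuple Rm) : n.+1.-tuple Rm :=
  [tuple of p.1 :: p.2].

Definition uncons_pair n (t : n.+1.-tuple Rm) : Rm * n.-tuple Rm :=
  (thead t, [tuple of behead t]).

Lemma cons_pairK n : cancel (@cons_pair n) (@uncons_pair n).
Proof.
move=> [x t]; rewrite /uncons_pair /cons_pair /= theadE; congr pair.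
exact: val_inj.
Qed.

Lemma measurable_cons_pair n : measurable_fun setT (@cons_pair n).
Proof. exact: measurable_cons. Qed.

Lemma measurable_uncons_pair n : measurable_fun setT (@uncons_pair n).
Proof.
apply: measurable_fun_pair => /=; first exact: (measurable_tnth ord0).
exact: measurable_behead.
Qed.

Section lebesgue_step.
Local Open Scope ereal_scope.
Variables (n : nat) (mu : {sigma_finite_measure set n.-tuple Rm -> \bar R}).

Definition lebesgue_step : set (n.+1.-tuple Rm) -> \bar R :=
  pushforward (lambda \x mu) (@cons_pair n).

Let measurable_preimage_cons A :
  measurable A -> measurable (@cons_pair n @^-1` A).
Proof.
by move=> mA; rewrite -[X in measurable X]setTI; exact: measurable_cons_pair.
Qed.

Let lebesgue_step0 : lebesgue_step set0 = 0.
Proof. by rewrite /lebesgue_step /pushforward preimage_set0 measure0. Qed.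

Let lebesgue_step_ge0 A : 0 <= lebesgue_step A.
Proof. by rewrite /lebesgue_step /pushforward; exact: measure_ge0. Qed.

Let lebesgue_step_sigma_additive : semi_sigma_additive lebesgue_step.
Proof.
move=> F mF tF mUF; rewrite /lebesgue_step /pushforward preimage_bigcup.
apply: measure_semi_sigma_additive.
- by move=> k; exact: measurable_preimage_cons.
- apply/trivIsetP => /= i j _ _ ij; rewrite -preimage_setI.
  by move/trivIsetP : tF => /(_ _ _ _ _ ij) ->//; rewrite preimage_set0.
- by rewrite -preimage_bigcup; exact: measurable_preimage_cons.
Qed.

HB.instance Definition _ := isMeasure.Build _ _ _ lebesgue_step
  lebesgue_step0 lebesgue_step_ge0 lebesgue_step_sigma_additive.

Let lebesgue_step_sigma_finite : sigma_finite setT lebesgue_step.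
Proof.
have /sigma_finiteP[F [TF ndF Foo]] := sigma_finiteT lambda.
have /sigma_finiteP[G [TG ndG Goo]] := sigma_finiteT mu.
exists (fun k => @uncons_pair n @^-1` (F k `*` G k)).
  apply/seteqP; split=> // t _.
  have [i _ Fi] : (\bigcup_k F k) (uncons_pair t).1 by rewrite -TF.
  have [j _ Gj] : (\bigcup_k G k) (uncons_pair t).2 by rewrite -TG.
  exists (maxn i j) => //; split.
    by move: Fi; exact/subsetPset/ndF/leq_maxl.
  by move: Gj; exact/subsetPset/ndG/leq_maxr.
move=> k; have [mF Fk] := Foo k; have [mG Gk] := Goo k; split.
  rewrite -[X in measurable X]setTI.
  by apply: measurable_uncons_pair => //; exact: measurableX.
rewrite /lebesgue_step /pushforward -comp_preimage.
rewrite (_ : uncons_pair (n:=n) \o cons_pair (n:=n) = id); last first.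
  by apply/funext => x; exact: cons_pairK.
rewrite preimage_id product_measure1E//.
by rewrite lte_mul_pinfty// ge0_fin_numE.
Qed.

HB.instance Definition _ := Measure_isSigmaFinite.Build _ _ _ lebesgue_step
  lebesgue_step_sigma_finite.

End lebesgue_step.

Fixpoint lebesgue_Rn n : {sigma_finite_measure set n.-tuple Rm -> \bar R} :=
  match n with
  | 0 => dirac [tuple]
  | n'.+1 => lebesgue_step (lebesgue_Rn n')
  end.

Lemma lebesgue_Rn_box n (B : nat -> set Rm) :
  (forall i, measurable (B i)) ->
  lebesgue_Rn n [set t | forall i : 'I_n, B i (tnth t i)] =
  (\prod_(i < n) lambda (B i))%E.
Proof.
elim: n B => [|n IH] B mB /=.
  by rewrite big_ord0 diracE mem_set//=; case.
rewrite /lebesgue_step /pushforward big_ord_recl -(IH (fun i => B i.+1))//.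
rewrite -product_measure1E//.
  congr (product_measure1 _ _ _); apply/seteqP; split=> -[x t] /= H.
    split; first exact: (H ord0).
    by move=> i /=; have := H (lift ord0 i); rewrite tnthS.
  by case: H => H0 H i; case: (unliftP ord0 i) => [j|] -> //; rewrite tnthS; exact: H.
rewrite [X in measurable X](_ : _ = \bigcap_(i in [set: 'I_n])
    ((@tnth n Rm)^~ i @^-1` B i.+1)).
  apply: fin_bigcap_measurable => // i _; rewrite -[X in measurable X]setTI.
  exact: measurable_tnth.
by apply/seteqP; split=> t /= H i; [move=> _|]; apply: H.
Qed.

Definition row_of_tuple n (t : n.-tuple Rm) : 'rV[R]_n := \row_i tnth t i.

End lebesgue_measure_Rn.
Arguments row_of_tuple {R n} t.

Section geometry.
Context {R : realType}.

(** * Euclidean structure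

    The norm of ['rV[R]_n] in the library is the sup norm; it gives the usual
    topology and derivatives, but lengths need the Euclidean norm. *)

Definition dotp n (u v : 'rV[R]_n) : R := \sum_(i < n) u 0 i * v 0 i.

Definition enorm n (u : 'rV[R]_n) : R := Num.sqrt (dotp u u).

Definition ediameter n (X : set 'rV[R]_n) : \bar R :=
  ereal_sup [set r | exists x y, [/\ X x, X y & r = (enorm (x - y))%:E]].

(** The unit sphere S^n of R^(n+1). *)
Definition sphere n : set 'rV[R]_n.+1 := [set x | enorm x = 1].

(** * Smooth maps and submanifolds of Euclidean space *)

(** [f] is of class C^k on [V], which is meant to be open. *)
Fixpoint class_C (k : nat) m l (V : set 'rV[R]_m) (f : 'rV[R]_m -> 'rV[R]_l)
    : Prop :=
  match k with
  | 0 => forall x, V x -> {for x, continuous f}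
  | k'.+1 => (forall x, V x -> differentiable f x) /\
             (forall v, class_C k' V ('D_v f))
  end.

(** Smoothness on an arbitrary subset [X]: locally, [f] is the restriction of a
    C^oo map defined on an open set of the ambient space. *)
Definition smooth_on m l (X : set 'rV[R]_m) (f : 'rV[R]_m -> 'rV[R]_l) :=
  forall x, X x -> exists (V : set 'rV[R]_m) (g : 'rV[R]_m -> 'rV[R]_l),
    [/\ open V, V x, forall k, class_C k V g
      & forall y, X y -> V y -> f y = g y].

Definition diffeomorphism m l (X : set 'rV[R]_m) (Y : set 'rV[R]_l)
    (f : 'rV[R]_m -> 'rV[R]_l) :=
  [/\ smooth_on X f, set_bij X Y f
    & exists g, smooth_on Y g /\ forall x, X x -> g (f x) = x].

Definition diffeomorphic m l (X : set 'rV[R]_m) (Y : set 'rV[R]_l) :=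
  exists f, diffeomorphism X Y f.

(** [phi] is a local parametrization of [M] with domain [U]: a diffeomorphism of
    the open set [U] of R^n onto a relatively open subset of [M]. *)
Definition local_parametrization n (M : set 'rV[R]_n.+1) (U : set 'rV[R]_n)
    (phi : 'rV[R]_n -> 'rV[R]_n.+1) :=
  open U /\ exists V, open V /\ diffeomorphism U (M `&` V) phi.

(** The charts are onto relatively open subsets of [M], so that [M] is an
    embedded, and not merely immersed, hypersurface. *)
Definition embedded_hypersurface n (M : set 'rV[R]_n.+1) :=
  forall p, M p -> exists U phi, local_parametrization M U phi /\ (phi @` U) p.

(** * Curvature *)

Section parametrized.
Variables (n : nat) (phi : 'rV[R]_n -> 'rV[R]_n.+1) (u : 'rV[R]_n).

Definition partial (i : 'I_n) : 'rV[R]_n -> 'rV[R]_n.+1 :=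
  'D_(delta_mx 0 i) phi.

Definition partial2 (i j : 'I_n) : 'rV[R]_n -> 'rV[R]_n.+1 :=
  'D_(delta_mx 0 j) (partial i).

Definition first_form : 'M[R]_n :=
  \matrix_(i, j) dotp (partial i u) (partial j u).

Definition unit_normal (nu : 'rV[R]_n.+1) :=
  enorm nu = 1 /\ forall i, dotp (partial i u) nu = 0.

Definition second_form (nu : 'rV[R]_n.+1) : 'M[R]_n :=
  \matrix_(i, j) dotp (partial2 i j u) nu.

(** The matrix of the shape operator [- d nu] (acting on row vectors) in the
    basis of the [partial i], by the Weingarten equations. *)
Definition shape_operator (nu : 'rV[R]_n.+1) : 'M[R]_n :=
  second_form nu *m invmx first_form.

(** The density of the volume measure of the hypersurface in the chart. *)
Definition volume_density : R := Num.sqrt (\det first_form).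

End parametrized.

(** [k] lists the principal curvatures of [M] at [p], i.e. the eigenvalues of the
    shape operator with multiplicity.  The list is unique up to order and up to
    a global sign, which depends on the choice of the unit normal. *)
Definition principal_curvatures n (M : set 'rV[R]_n.+1) (p : 'rV[R]_n.+1)
    (k : 'I_n -> R) :=
  exists U phi u nu,
    [/\ local_parametrization M U phi, U u, phi u = p, unit_normal phi u nu
      & char_poly (shape_operator phi u nu) = \prod_(i < n) ('X - (k i)%:P)].

(** [K] is a Gauss-Kronecker curvature function of [M].  No continuous choice
    of the unit normal is required, so only [`|K|] is determined by [M]. *)
Definition Gauss_Kronecker n (M : set 'rV[R]_n.+1) (K : 'rV[R]_n.+1 -> R) :=
  forall p, M p ->
    exists k, principal_curvatures M p k /\ K p = \prod_(i < n) k i.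

(** * Integration on a hypersurface *)

(** [A i], in the domain [U i] of the chart [phi i], are Borel sets whose images
    partition [M]. *)
Definition chart_partition n (M : set 'rV[R]_n.+1) (U : nat -> set 'rV[R]_n)
    (phi : nat -> 'rV[R]_n -> 'rV[R]_n.+1) (A : nat -> set 'rV[R]_n) :=
  [/\ forall i, local_parametrization M (U i) (phi i),
      forall i, A i `<=` U i,
      forall i, measurable (row_of_tuple @^-1` A i),
      trivIset setT (fun i => phi i @` A i)
    & \bigcup_i (phi i @` A i) = M].

(** [v] is the integral over [M] of the nonnegative function [f] with respect to
    the n-dimensional volume.  By the change of variables formula, for Borel [f]
    the value [v] does not depend on the partition. *)
Definition is_surface_integral n (M : set 'rV[R]_n.+1) (f : 'rV[R]_n.+1 -> R)
    (v : \bar R) :=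
  exists U phi A, chart_partition M U phi A /\
    v = (\sum_(0 <= i <oo)
      \int[lebesgue_Rn n]_(t in row_of_tuple @^-1` A i)
        (f (phi i (row_of_tuple t)) *
         volume_density (phi i) (row_of_tuple t))%:E)%E.

Definition is_volume n (M : set 'rV[R]_n.+1) (v : \bar R) :=
  is_surface_integral M (cst 1) v.

(** The integrand [`|K|] is a continuous function on [M]. *)
Definition is_total_curvature n (M : set 'rV[R]_n.+1) (T : \bar R) :=
  exists K, Gauss_Kronecker M K /\ is_surface_integral M (fun p => `|K p|) T.

End geometry.
Arguments sphere : clear implicits.

(* Main.v *)
Require Import Defs.
From mathcomp Require Import all_boot all_order all_algebra.
From mathcomp Require Import all_classical all_reals all_analysis.
From mathcomp Require Import ring lra.
From mathcomp Require Import complex measurable_realfun.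
Import Order.TTheory GRing.Theory Num.Theory.
Import numFieldNormedType.Exports.
Set Implicit Arguments.
Unset Strict Implicit.
Unset Printing Implicit Defensive.
Local Open Scope classical_set_scope.
Local Open Scope ring_scope.

(** Let S be the unit sphere of R x R^n with coordinates (Y, X), and let M be its
    image under the diffeomorphism
      (y, x) |-> (20 a y + a (1 - |x|^2)^9 sin (N x_0 + th), x)
    of R^(n+1): two close sheets of a rapidly oscillating graph.  Its volume is of
    order a N.  On S one has (1 - |x|^2)^9 = Y^18, and in stereographic charts both
    fundamental forms are a multiple of the identity plus a form of rank two in
    the differentials of Y and X_0, so that all determinants are explicit.  The
    large terms of the second form have rank two and the others are O(a); hence
    |K| dV is at most of order c^-4 (1 + m |sin| / (1 + m^2 cos^2)), m = a N Y^18,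
    when a = c^4, N = c^-9 and n >= 3: the equator |Y| <= c, where the oscillation
    is damped, contributes 1 / a, and elsewhere the normal is at least |Y| >= c
    long.  The average of m |sin| / (1 + m^2 cos^2) over the phase th is bounded
    uniformly in m.  So for a suitable phase T / vol is O(c^-4 / (a N)) = O(c), and
    c tends to 0. *)

(** * Smooth functions *)

(** Why [n >= 3]: the terms in N live on the plane spanned by dY and dX_0, so the determinant
    carries N only to the second power while each of the n directions brings a factor a. For |Y| >=
    c the N^2 term is controlled once c^4 a^(n-1) N <= c^n; with a = c^4 and N = c^-9 this reads 4n
    - 9 >= n. Why 18 and 20: for |Y| <= c one has N^2 |Y|^19 <= c, so the waves are invisible there;
    and since 20 > 18 the height stays increasing in Y, which keeps the normal at least a / 2 long
    at the equator. Why a phase: at the crests, where the cosine vanishes, m |sin| / (1 + m^2 cos^2)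
    is as large as m, so no pointwise bound can work. Over half a wave, however, the normal turns by
    at most pi, whatever m is. Averaging over th exploits this with no integration by parts on the
    sphere, and one phase must then serve volume and curvature simultaneously. Two further
    obligations: T must be shown positive, a quotient by 0 being 0, and the principal curvatures
    must be shown to be real. *)

Section differentiable_near.
Context {R : realType} {V W : normedModType R}.
Implicit Types f g h : V -> W.

(** Serves [near_eq_differentiable]: a difference that vanishes near [x] can be added without harm,
    so differentiability depends only on the germ. *)
Lemma differentiable_near0 h x : (\near x, h x = 0) -> differentiable h x.
Proof.
move=> h0.
have E : h \o shift x = cst (h x) + (\0 : V -> W) +o_ 0 id.
  have hx0 : h x = 0 by exact: (nbhs_singleton h0).
  apply/eqaddoP => e e0 /=.
  move: h0; rewrite (near_shift 0 x) => h0.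
  near=> y; rewrite /= !fctE hx0 /= addr0 subr0.
  have : (h \o shift (x - 0)) y = 0 by near: y; exact: h0.
  by rewrite /= subr0 => ->; rewrite normr0 mulr_ge0// ltW.
have c0 : continuous (\0 : V -> W) by exact: cst_continuous.
have D := diff_unique c0 E.
by apply/diff_locallyP; rewrite D.
Unshelve. all: by end_near. Qed.

Lemma near_eq_differentiable f g x : (\near x, f x = g x) ->
  differentiable f x -> differentiable g x.
Proof.
move=> fg Df; rewrite (_ : g = f \+ (g \- f)); last first.
  by apply/funext => y /=; rewrite addrC subrK.
apply: differentiableD => //; apply: differentiable_near0.
by near=> y; apply/eqP; rewrite subr_eq0; apply/eqP/esym; near: y.
Unshelve. all: by end_near. Qed.

End differentiable_near.

(** * Calculus of directional derivatives *)

Section directional_calculus.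
Context {R : realType} {m : nat}.
Implicit Types (f g : 'rV[R]_m -> R) (x v : 'rV[R]_m).

(** The derivative of a product or composite has its expected value only under differentiability.
    Carrying both facts together lets the rules chain as terms, with [diff_at_eq] reshaping the
    value at the end. *)
Definition diff_at x v f (df : R) := differentiable f x /\ 'D_v f x = df.

Lemma diff_at_eq x v f df dg : diff_at x v f df -> df = dg -> diff_at x v f dg.
Proof. by move=> ? <-. Qed.

Lemma diff_at_cst x v c : diff_at x v (fun=> c) 0.
Proof.
split; first exact: differentiable_cst.
exact: (derive_cst c x v).
Qed.

Lemma diff_at_coord x v j : diff_at x v (fun y => y 0 j) (v 0 j).
Proof.
split; first exact: differentiable_coord.
have d1 : derivable (@id 'rV[R]_m) x v by exact: derivable_id.
have /(congr1 (fun M : 'rV[R]_m => M 0 j)) := derive_mx d1.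
by rewrite derive_id [in RHS]mxE.
Qed.

Lemma diff_atD x v f g df dg : diff_at x v f df -> diff_at x v g dg ->
  diff_at x v (fun y => f y + g y) (df + dg).
Proof.
move=> [Df <-] [Dg <-]; split; first exact: differentiableD.
by rewrite -deriveD//; exact: diff_derivable.
Qed.

Lemma diff_atM x v f g df dg : diff_at x v f df -> diff_at x v g dg ->
  diff_at x v (fun y => f y * g y) (f x * dg + g x * df).
Proof.
move=> [Df <-] [Dg <-]; split; first exact: differentiableM.
exact: (deriveM (diff_derivable (v := v) Df) (diff_derivable (v := v) Dg)).
Qed.

Lemma diff_atV x v f df : f x != 0 -> diff_at x v f df ->
  diff_at x v (fun y => (f y)^-1) (- (f x) ^- 2 * df).
Proof.
move=> f0 [Df <-]; split; first exact: differentiableV.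
exact: (deriveV f0 (diff_derivable (v := v) Df)).
Qed.

Lemma diff_at_comp x v (h : R -> R) dh f df : is_derive (f x) 1 h dh ->
  diff_at x v f df -> diff_at x v (fun y => h (f y)) (dh * df).
Proof.
move=> [hd hE] [Df <-].
have Dh : differentiable h (f x) by apply/derivable1_diffP.
split; first exact: differentiable_comp.
have -> : (fun y => h (f y)) = h \o f by [].
rewrite deriveE; last exact: differentiable_comp.
rewrite diff_comp//= deriveE// deriv1E//.
by rewrite /= derive1E hE mulrC.
Qed.

Lemma diff_atX x v f df n : diff_at x v f df ->
  diff_at x v (fun y => f y ^+ n) (n%:R * f x ^+ n.-1 * df).
Proof.
elim: n => [|n IH] H.
  by rewrite mul0r mul0r; exact: diff_at_cst.
under eq_fun do rewrite exprS.
apply: diff_at_eq (diff_atM H (IH H)) _.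
case: n {IH} => [|n /=]; first by rewrite !expr0 /=; ring.
by rewrite exprS -[n.+2]addn1 natrD; ring.
Qed.

Lemma diff_atN x v f df : diff_at x v f df -> diff_at x v (fun y => - f y) (- df).
Proof.
move=> H; have := diff_atM (diff_at_cst x v (-1)) H.
rewrite mulr0 addr0 mulN1r; congr diff_at.
by apply/funext => y; rewrite mulN1r.
Qed.

Lemma diff_at_sum (I : Type) (r : seq I) x v (f : I -> 'rV[R]_m -> R) df :
  (forall i, diff_at x v (f i) (df i)) ->
  diff_at x v (fun y => \sum_(i <- r) f i y) (\sum_(i <- r) df i).
Proof.
move=> H; elim: r => [|i r IH].
  rewrite big_nil; under eq_fun do rewrite big_nil.
  exact: diff_at_cst.
rewrite big_cons; under eq_fun do rewrite big_cons.
exact: diff_atD.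
Qed.

Lemma diff_at_near x v f g df : (\near x, f x = g x) -> diff_at x v f df ->
  diff_at x v g df.
Proof.
move=> fg [Df <-]; split; last by rewrite (near_eq_derive _ fg).
exact: near_eq_differentiable Df.
Qed.

End directional_calculus.

(* Closed under directional derivatives, hence smooth: an elementary function is
   built from coordinates by ring operations, sine, cosine and nonvanishing
   inverses. *)
Inductive elementary {R : realType} m (V : set 'rV[R]_m) : ('rV[R]_m -> R) -> Prop :=
| elem_cst c : elementary V (fun=> c)
| elem_coord j : elementary V (fun x => x 0 j)
| elem_add f g : elementary V f -> elementary V g -> elementary V (fun x => f x + g x)
| elem_mul f g : elementary V f -> elementary V g -> elementary V (fun x => f x * g x)
| elem_sin f : elementary V f -> elementary V (fun x => sin (f x))
| elem_cos f : elementary V f -> elementary V (fun x => cos (f x))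
| elem_inv f : (forall x, V x -> f x != 0) -> elementary V f ->
    elementary V (fun x => (f x)^-1)
| elem_ext f g : (forall x, V x -> f x = g x) -> elementary V f -> elementary V g.

Section elementary_theory.
Context {R : realType} {m : nat} (V : set 'rV[R]_m).
Implicit Types (f g : 'rV[R]_m -> R) (x v : 'rV[R]_m).

Lemma elem_opp f : elementary V f -> elementary V (fun x => - f x).
Proof.
move=> Hf; apply: (@elem_ext _ _ _ (fun x => -1 * f x)).
  by move=> x _; rewrite mulN1r.
exact/elem_mul/Hf/elem_cst.
Qed.

Lemma elem_sub f g : elementary V f -> elementary V g ->
  elementary V (fun x => f x - g x).
Proof. by move=> Hf Hg; apply/elem_add/elem_opp. Qed.

Lemma elem_exp f n : elementary V f -> elementary V (fun x => f x ^+ n).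
Proof.
move=> Hf; elim: n => [|n IH].
  by under eq_fun do rewrite expr0; exact: elem_cst.
by under eq_fun do rewrite exprS; exact: elem_mul.
Qed.

Lemma elem_sum (I : Type) (r : seq I) (f : I -> 'rV[R]_m -> R) :
  (forall i, elementary V (f i)) -> elementary V (fun x => \sum_(i <- r) f i x).
Proof.
move=> H; elim: r => [|i r IH].
  by under eq_fun do rewrite big_nil; exact: elem_cst.
by under eq_fun do rewrite big_cons; exact: elem_add.
Qed.

(** Induction on [elementary]: each rule of differentiation stays inside the class. Openness of [V]
    serves the [elem_ext] case, where the two functions agree on [V] only. *)
Lemma elem_derive f : open V -> elementary V f ->
  forall v, exists2 g, elementary V g & forall x, V x -> diff_at x v f (g x).
Proof.
move=> oV Hf v; elim: Hf => {f}.
- by move=> c; exists (fun=> 0); [exact: elem_cst|move=> x _; exact: diff_at_cst].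
- move=> j; exists (fun=> v 0 j); first exact: elem_cst.
  by move=> x _; exact: diff_at_coord.
- move=> f g Hf [f' Hf' Df] Hg [g' Hg' Dg].
  exists (fun x => f' x + g' x); first exact: elem_add.
  by move=> x Vx; apply: diff_atD; [exact: Df|exact: Dg].
- move=> f g Hf [f' Hf' Df] Hg [g' Hg' Dg].
  exists (fun x => f x * g' x + g x * f' x); first by apply: elem_add; exact: elem_mul.
  by move=> x Vx; apply: diff_atM; [exact: Df|exact: Dg].
- move=> f Hf [f' Hf' Df]; exists (fun x => cos (f x) * f' x).
    by apply: elem_mul => //; exact: elem_cos.
  by move=> x Vx; apply: diff_at_comp (Df _ Vx).
- move=> f Hf [f' Hf' Df]; exists (fun x => - sin (f x) * f' x).
    by apply: elem_mul => //; exact/elem_opp/elem_sin.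
  by move=> x Vx; apply: diff_at_comp (Df _ Vx).
- move=> f f0 Hf [f' Hf' Df]; exists (fun x => - ((f x)^-1 ^+ 2) * f' x).
    by apply: elem_mul => //; apply/elem_opp/elem_exp/elem_inv.
  by move=> x Vx; rewrite exprVn; apply: diff_atV (Df _ Vx); exact: f0.
- move=> f g fg Hf [f' Hf' Df]; exists f' => // x Vx.
  apply: diff_at_near (Df _ Vx).
  by near=> y; apply: fg; near: y; exact: open_nbhs_nbhs.
Unshelve. all: by end_near. Qed.

Lemma differentiable_rV l (f : 'rV[R]_m -> 'rV[R]_l) x :
  (forall j, differentiable (fun y => f y 0 j) x) -> differentiable f x.
Proof.
move=> H; rewrite (_ : f = \sum_(j < l) (fun y => f y 0 j *: delta_mx 0 j)).
  by apply: differentiable_sum => j; exact: differentiableZl.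
by apply/funext => y; rewrite fct_sumE -row_sum_delta.
Qed.

Lemma derive_rV l (f : 'rV[R]_m -> 'rV[R]_l) (df : 'rV[R]_l) x v :
  (forall j, diff_at x v (fun y => f y 0 j) (df 0 j)) -> 'D_v f x = df.
Proof.
move=> H.
have D : derivable f x v.
  by apply: diff_derivable; apply: differentiable_rV => j; have [] := H j.
rewrite (derive_mx D); apply/rowP => j; rewrite mxE.
by have [_] := H j.
Qed.

Lemma elementary_class_C l (f : 'rV[R]_m -> 'rV[R]_l) : open V ->
  (forall j, elementary V (fun x => f x 0 j)) -> forall k, class_C k V f.
Proof.
move=> oV Hf k; elim: k f Hf => [|k IH] f Hf.
  move=> x Vx; apply: differentiable_continuous; apply: differentiable_rV => j.
  by have [g _ /(_ _ Vx)[]] := elem_derive oV (Hf j) 0.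
split=> [x Vx|v].
  apply: differentiable_rV => j.
  by have [g _ /(_ _ Vx)[]] := elem_derive oV (Hf j) 0.
apply: IH => j; have [g Hg Dg] := elem_derive oV (Hf j) v.
apply: elem_ext Hg => x Vx.
(* [derive_rV] wants the derivatives of all components at once, not only that of component [j]. *)
have /boolp.choice[G HG] : forall j, exists d, diff_at x v (fun y => f y 0 j) d.
  move=> i; have [h _ Dh] := elem_derive oV (Hf i) v.
  by exists (h x); exact: Dh.
rewrite (@derive_rV _ _ (\row_j G j)) => [|i]; last by rewrite mxE; exact: HG.
by rewrite mxE; have [_ <-] := Dg x Vx; have [_ <-] := HG j.
Qed.

Lemma elementary_smooth_on l (X : set 'rV[R]_m) (f : 'rV[R]_m -> 'rV[R]_l) :
  open V -> X `<=` V -> (forall j, elementary V (fun x => f x 0 j)) ->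
  smooth_on X f.
Proof.
move=> oV XV Hf x Xx; exists V, f; split=> //; first exact: XV.
exact: elementary_class_C.
Qed.

Lemma elementary_continuous f : open V -> elementary V f ->
  forall x, V x -> {for x, continuous f}.
Proof.
move=> oV Hf x Vx; apply: differentiable_continuous.
by have [g _ /(_ _ Vx)[]] := elem_derive oV Hf 0.
Qed.

End elementary_theory.

(** * Linear algebra *)

Section rank_two_determinant.
Context {R : comNzRingType}.

(** Sylvester's identity for a + UV and a + VU, in a form without division. The block matrix [B] is
    made block triangular in two ways by right multiplication, and both results compute its
    determinant. *)
Lemma det_scalarD_mul n k (a : R) (U : 'M[R]_(n, k)) (V : 'M[R]_(k, n)) :
  \det (a%:M + U *m V) * a ^+ k = a ^+ n * \det (a%:M + V *m U).
Proof.
pose B := block_mx a%:M (- U) V (1%:M : 'M[R]_k).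
have E1 : \det B = \det (a%:M + U *m V).
  have : B *m block_mx 1%:M 0 (- V) 1%:M = block_mx (a%:M + U *m V) (- U) 0 1%:M.
    rewrite /B mulmx_block !mulmx1 !mulmx0 mulmxN mulNmx opprK mul1mx addrN.
    by rewrite !add0r.
  move=> /(congr1 determinant); rewrite det_mulmx det_lblock !det1 !mulr1 => ->.
  by rewrite det_ublock det1 mulr1.
have : B *m block_mx 1%:M U 0 a%:M = block_mx a%:M 0 V (a%:M + V *m U).
  rewrite /B mulmx_block !mulmx1 !mulmx0 !addr0 mul1mx mulNmx.
  by rewrite mul_mx_scalar mul_scalar_mx addrN [V *m U + _]addrC.
move=> /(congr1 determinant); rewrite det_mulmx det_ublock det_lblock det1 mul1r.
by rewrite !det_scalar E1.
Qed.

Lemma det_mx2 (A : 'M[R]_2) :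
  \det A = A 0 0 * A 1 1 - A 0 1 * A 1 0.
Proof.
rewrite (expand_det_row A 0) !big_ord_recl big_ord0 addr0.
rewrite /cofactor !det_mx11 !mxE /=.
have -> : lift 0 0 = 1 :> 'I_2 by exact: val_inj.
have -> : lift 1 0 = 0 :> 'I_2 by exact: val_inj.
by rewrite expr0 expr1 mul1r mulN1r mulrN.
Qed.
End rank_two_determinant.

(** Sylvester's identity reduces this to a 2 x 2 determinant: [U] has the columns y and z, and [V]
    holds the coefficients. The last factor is the Gram determinant of y and z. *)
Lemma det_scalarD_rank2 (F : fieldType) n (a b c d yy yz zz : F)
    (y z : 'I_n.+2 -> F) : a != 0 ->
  \sum_i y i * y i = yy -> \sum_i y i * z i = yz -> \sum_i z i * z i = zz ->
  \det (\matrix_(i, j) (a * (i == j)%:R + b * (y i * y j)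
      + c * (y i * z j + z i * y j) + d * (z i * z j)))
  = a ^+ n * (a ^+ 2 + a * (b * yy + 2 * c * yz + d * zz)
              + (b * d - c ^+ 2) * (yy * zz - yz ^+ 2)).
Proof.
move=> a0 yyE yzE zzE.
pose U : 'M[F]_(n.+2, 2) := \matrix_(i, j) (if j == 0 then y i else z i).
pose V : 'M[F]_(2, n.+2) := \matrix_(j, i)
  (if j == 0 then b * y i + c * z i else c * y i + d * z i).
have := det_scalarD_mul a U V.
rewrite (_ : a%:M + U *m V = (\matrix_(i, j) (a * (i == j)%:R + b * (y i * y j)
      + c * (y i * z j + z i * y j) + d * (z i * z j)))); last first.
  apply/matrixP => i j; rewrite !mxE !big_ord_recl big_ord0 !mxE /= addr0.
  by rewrite mulr_natr; ring.
have sumE p q (f g h : 'I_n.+2 -> F) :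
    \sum_i (p * f i + q * g i) * h i = p * (\sum_i f i * h i) + q * (\sum_i g i * h i).
  by rewrite !mulr_sumr -big_split; apply: eq_bigr => i _ /=; ring.
have VU i j : (V *m U) i j = (if i == 0 then b else c) * (if j == 0 then yy else yz)
                          + (if i == 0 then c else d) * (if j == 0 then yz else zz).
  rewrite !mxE; under eq_bigr do rewrite !mxE.
  have zyE : \sum_i z i * y i = yz by rewrite -yzE; apply: eq_bigr => *; rewrite mulrC.
  by case: eqP => _; case: eqP => _; rewrite sumE ?yyE ?yzE ?zzE ?zyE.
rewrite det_mx2 ![(_ + V *m U) _ _]mxE !VU !mxE /= => E.
apply: (mulIf (expf_neq0 2 a0)); rewrite E !mulr1n !mulr0n -[n.+2]addn2 exprD; ring.
Qed.

(** * Reality of the eigenvalues of a symmetric definite pencil *)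

Section symmetric_definite_pencil.
Context {R : realType}.
Local Notation C := R[i].
Local Notation toC := (real_complex R).

Lemma map_conjc_real p q (A : 'M[R]_(p, q)) :
  map_mx (@conjc R) (map_mx toC A) = map_mx toC A.
Proof. by apply/matrixP => i j; rewrite !mxE conjc_real. Qed.

Lemma herm_form_real p (A : 'M[R]_p) (w : 'rV[C]_p) : A^T = A ->
  let s := (w *m map_mx toC A *m (map_mx (@conjc R) w)^T) 0 0 in
  (s^*)%C = s.
Proof.
move=> AT s.
have : map_mx (@conjc R) (w *m map_mx toC A *m (map_mx (@conjc R) w)^T)
   = (w *m map_mx toC A *m (map_mx (@conjc R) w)^T)^T.
  have WW : map_mx (@conjc R) (map_mx (@conjc R) w)^T = w^T.
    by apply/matrixP => i j; rewrite !mxE /= conjcK.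
  have ATC : (map_mx toC A)^T = map_mx toC A by rewrite -[in RHS]AT map_trmx.
  by rewrite !map_mxM map_conjc_real WW !trmx_mul trmxK ATC mulmxA.
by move=> /matrixP/(_ 0 0); rewrite [LHS]mxE [RHS]mxE.
Qed.

(** Pair the equation v A = z v B, B = J J^T, with the conjugate of v. Both Hermitian forms are
    real, and the one of B is |v J|^2, which is nonzero, so z is a quotient of reals. *)
Lemma pencil_eigenvalue_real n m (A : 'M[R]_n) (J : 'M[R]_(n, m)) (v : 'rV[C]_n) z :
  A^T = A -> J *m J^T \in unitmx -> v != 0 ->
  v *m map_mx toC A = z *: (v *m map_mx toC (J *m J^T)) -> (z^*)%C = z.
Proof.
move=> AT uB v0 vA.
have BT : (J *m J^T)^T = J *m J^T by rewrite trmx_mul trmxK.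
have := herm_form_real v BT; have := herm_form_real v AT.
rewrite /= vA -scalemxAl mxE rmorphM /=.
set W := map_mx (@conjc R) v => + qE; rewrite {}qE => E; apply: mulIf E.
apply: contra v0 => q0.
(* If the form of B vanished, every |(v J)_k|^2 would vanish, so v B = 0 and v = 0 by
   invertibility. *)
have u0 : v *m map_mx toC J = 0.
  apply/rowP => k; rewrite [RHS]mxE; move: q0; rewrite map_mxM mulmxA -mulmxA.
  have -> : map_mx toC J^T *m W^T = (map_mx (@conjc R) (v *m map_mx toC J))^T.
    rewrite (map_mxM (@conjc R)) map_conjc_real trmx_mul; congr (_ *m _).
    by rewrite map_trmx.
  rewrite mxE psumr_eq0 => [/allP/(_ k (mem_index_enum _))|i _]; last first.
    by rewrite [X in _ * X]mxE [X in _ * X]mxE mulcJ_ge0.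
  by rewrite [X in _ * X]mxE [X in _ * X]mxE mulf_eq0 conjc_eq0 orbb => /eqP.
have uBC : map_mx toC (J *m J^T) \in unitmx by rewrite map_unitmx.
by rewrite -(mulmxK uBC v) {1}map_mxM (mulmxA v) u0 !mul0mx.
Qed.

(** The shape operator II I^-1 need not be a symmetric matrix, so its characteristic polynomial is
    split over the complex numbers first and its roots are then shown to be real. *)
Lemma char_poly_pencil_split n m (A : 'M[R]_n) (J : 'M[R]_(n, m)) :
  A^T = A -> \det (J *m J^T) != 0 ->
  exists k : 'I_n -> R,
    char_poly (A *m invmx (J *m J^T)) = \prod_(i < n) ('X - (k i)%:P).
Proof.
move=> AT detB.
set B := J *m J^T in detB *.
have uB : B \in unitmx by rewrite unitmxE unitfE.
set M := A *m invmx B.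
have [r rE] := closed_field_poly_normal (char_poly (map_mx toC M)).
have {rE} rE : char_poly (map_mx toC M) = \prod_(z <- r) ('X - z%:P).
  by rewrite [LHS]rE (monicP (char_poly_monic _)) scale1r.
have real_root z : z \in r -> (complex.Re z)%:C%C = z.
  move=> zr.
  have : root (char_poly (map_mx toC M)) z by rewrite rE root_prod_XsubC.
  rewrite -eigenvalue_root_char => /eigenvalueP[v vM v0].
  have uBC : map_mx toC B \in unitmx by rewrite map_unitmx.
  have vA : v *m map_mx toC A = z *: (v *m map_mx toC B).
    by rewrite scalemxAl -vM map_mxM map_invmx -!(mulmxA v) -mulmxA mulVmx ?mulmx1.
  have := pencil_eigenvalue_real AT uB v0 vA.
  by case: z {zr vM vA} => x y [/eqP]; rewrite eqNr => /eqP ->.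
have {}rE : char_poly M = \prod_(x <- map (@complex.Re R) r) ('X - x%:P).
  apply: (map_poly_inj toC); rewrite map_char_poly rE rmorph_prod /= big_map.
  rewrite !big_seq; apply: eq_bigr => z zr.
  by rewrite rmorphB /= map_polyX map_polyC /= real_root.
have sz : size (map (@complex.Re R) r) = n.
  by have := size_char_poly M; rewrite rE size_prod_XsubC => -[].
exists (fun i => nth 0 (map (@complex.Re R) r) i).
by rewrite rE (big_nth 0) sz big_mkord.
Qed.

Lemma prod_roots_char_poly n (M : 'M[R]_n) (k : 'I_n -> R) :
  char_poly M = \prod_(i < n) ('X - (k i)%:P) -> \prod_(i < n) k i = \det M.
Proof.
move=> E; have := char_poly_det M; rewrite E -horner_coef0 horner_prod.
under eq_bigr do rewrite hornerXsubC sub0r -mulN1r.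
rewrite big_split /= prodr_const card_ord => /(mulfI _); apply.
by rewrite expf_neq0// oppr_eq0 oner_eq0.
Qed.
End symmetric_definite_pencil.

(** * Geometry of the stereographic charts *)

Lemma sum_delta (R : pzRingType) n (f : 'I_n -> R) i :
  \sum_j f j * (j == i)%:R = f i.
Proof.
rewrite (bigD1 i)//= eqxx mulr1 big1 ?addr0// => j /negPf ->.
by rewrite mulr0.
Qed.

Section ambient.
Context {R : realType} {n : nat}.

Definition vec (y : R) (x : 'I_n -> R) : 'rV[R]_n.+1 :=
  \row_i oapp x y (unlift ord0 i).

Lemma vec0 y x : vec y x 0 ord0 = y.
Proof. by rewrite mxE unlift_none. Qed.

Lemma vecS y x j : vec y x 0 (lift ord0 j) = x j.
Proof. by rewrite mxE liftK. Qed.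

Lemma vec_eta (p : 'rV[R]_n.+1) : vec (p 0 ord0) (fun j => p 0 (lift ord0 j)) = p.
Proof.
by apply/rowP => i; case: (unliftP ord0 i) => [j|] ->; rewrite ?vec0 ?vecS.
Qed.

Lemma eq_vec y y' x x' : y = y' -> x =1 x' -> vec y x = vec y' x'.
Proof. by move=> -> /funext ->. Qed.

Lemma dotp_vec y x y' x' : dotp (vec y x) (vec y' x') = y * y' + \sum_j x j * x' j.
Proof.
rewrite /dotp big_ord_recl !vec0; congr (_ + _).
by apply: eq_bigr => j _; rewrite !vecS.
Qed.

Lemma dotpZl k (u v : 'rV[R]_k) c : dotp (c *: u) v = c * dotp u v.
Proof. by rewrite /dotp mulr_sumr; apply: eq_bigr => i _; rewrite mxE mulrA. Qed.

Lemma dotpZr k (u v : 'rV[R]_k) c : dotp u (c *: v) = c * dotp u v.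
Proof. by rewrite /dotp mulr_sumr; apply: eq_bigr => i _; rewrite mxE mulrCA. Qed.

Lemma dotp_ge0 k (u : 'rV[R]_k) : 0 <= dotp u u.
Proof. by apply: sumr_ge0 => i _; rewrite -expr2 sqr_ge0. Qed.

Lemma derive_vec m (f : 'rV[R]_m -> R) (g : 'I_n -> 'rV[R]_m -> R) x v df dg :
  diff_at x v f df -> (forall j, diff_at x v (g j) (dg j)) ->
  'D_v (fun u => vec (f u) (g ^~ u)) x = vec df dg.
Proof.
move=> Hf Hg; apply: derive_rV => i; case: (unliftP ord0 i) => [j|] ->.
  by under eq_fun do rewrite vecS; rewrite vecS; exact: Hg.
by under eq_fun do rewrite vec0; rewrite vec0.
Qed.

End ambient.

(** Used with [L] the conformal factor [lam] and [r] the length of [normal]: the left side is |det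
    II / det I| times the volume density. *)
Lemma normr_curvature_scaling (R : realFieldType) k (a r L D : R) :
  0 < a -> 0 < r -> 0 < L ->
  `|(a / r) ^+ k * D / (L ^+ (2 * k) * r ^+ 2)| * (L ^+ k * r)
  = a ^+ k * `|D| / (L ^+ k * r ^+ k.+1).
Proof.
move=> a0 r0 L0.
have rN0 := lt0r_neq0 r0.
have Lk0 : 0 < L ^+ k by rewrite exprn_gt0.
have rk0 : 0 < r ^+ k by rewrite exprn_gt0.
rewrite mulnC exprM expr_div_n (exprS r k) !normrM !normfV !normrM.
rewrite !normrX (gtr0_norm a0) (gtr0_norm r0) (gtr0_norm L0).
move: (L ^+ k) (r ^+ k) Lk0 rk0 => x y /lt0r_neq0 x0 /lt0r_neq0 y0.
by field; rewrite x0 y0 rN0.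
Qed.

Section chart.
Context {R : realType} {m : nat}.
Local Notation n := m.+2.
Variables (a N th sg : R).
Hypothesis (sg1 : sg ^+ 2 = 1).
Implicit Types (u : 'rV[R]_n) (p : 'rV[R]_n.+1) (i j l : 'I_n).

Definition twist p := vec
  (20 * a * p 0 ord0 + a * (1 - \sum_j p 0 (lift ord0 j) ^+ 2) ^+ 9
     * sin (N * p 0 (lift ord0 ord0) + th))
  (fun j => p 0 (lift ord0 j)).

Definition lam u := 2 * (1 + \sum_j u 0 j * u 0 j)^-1.
Definition stY u := sg * (lam u - 1).
Definition stX j u := lam u * u 0 j.
Definition stereo u := vec (stY u) (stX ^~ u).
Definition chart u := twist (stereo u).

Lemma chart_stereo u : chart u = twist (stereo u).
Proof. by []. Qed.

Lemma lam_gt0 u : 0 < lam u.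
Proof.
rewrite /lam mulr_gt0// invr_gt0 ltr_pwDl//.
by apply: sumr_ge0 => j _; rewrite -expr2 sqr_ge0.
Qed.

Lemma sumsq_lam u : \sum_j u 0 j * u 0 j = 2 / lam u - 1.
Proof.
have s0 : 0 < 1 + \sum_j u 0 j * u 0 j.
  by rewrite ltr_pwDl//; apply: sumr_ge0 => j _; rewrite -expr2 sqr_ge0.
by rewrite /lam invfM invrK mulVKf// addrC addKr.
Qed.

Let lam0 u : lam u != 0. Proof. by rewrite gt_eqF// lam_gt0. Qed.

Lemma stY_sq u : stY u ^+ 2 = (lam u - 1) ^+ 2.
Proof. by rewrite /stY [LHS]exprMn sg1 mul1r. Qed.

Lemma sum_stX u : \sum_j stX j u ^+ 2 = 1 - stY u ^+ 2.
Proof.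
under eq_bigr do rewrite /stX exprMn [X in _ * X]expr2.
by rewrite -mulr_sumr sumsq_lam stY_sq; field.
Qed.

Let Yd i u := - sg * lam u ^+ 2 * u 0 i.
Let Xd l i u := lam u * (l == i)%:R - lam u ^+ 2 * u 0 i * u 0 l.
Let Ydd i j u := sg * (2 * lam u ^+ 3 * u 0 i * u 0 j - lam u ^+ 2 * (i == j)%:R).
Let Xdd l i j u := 2 * lam u ^+ 3 * u 0 i * u 0 j * u 0 l
  - lam u ^+ 2 * (u 0 j * (l == i)%:R + u 0 l * (i == j)%:R + u 0 i * (l == j)%:R).

Let e_ i : 'rV[R]_n := delta_mx 0 i.

Let e_E i l : (e_ i) 0 l = (l == i)%:R.
Proof. by rewrite mxE eqxx. Qed.

Let diff_coord u i l : diff_at u (e_ i) (fun v => v 0 l) (l == i)%:R.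
Proof. by rewrite -e_E; exact: diff_at_coord. Qed.

Let diff_lam u i : diff_at u (e_ i) lam (- lam u ^+ 2 * u 0 i).
Proof.
have s0 : 1 + \sum_j u 0 j * u 0 j != 0.
  by rewrite gt_eqF// ltr_pwDl//; apply: sumr_ge0 => j _; rewrite -expr2 sqr_ge0.
have H := diff_at_sum (index_enum 'I_n) (fun l => diff_atM (diff_coord u i l) (diff_coord u i l)).
have H1 := diff_atD (diff_at_cst u (e_ i) 1) H.
have H2 := diff_atM (diff_at_cst u (e_ i) 2) (diff_atV s0 H1).
apply: diff_at_eq H2 _.
rewrite big_split /= sum_delta /lam; field.
exact: s0.
Qed.

Let diff_stY u i : diff_at u (e_ i) stY (Yd i u).
Proof.
have H := diff_atM (diff_at_cst u (e_ i) sg) (diff_atD (diff_lam u i) (diff_at_cst u (e_ i) (-1))).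
by apply: diff_at_eq H _; rewrite /Yd; ring.
Qed.

Let diff_stX u i l : diff_at u (e_ i) (stX l) (Xd l i u).
Proof.
by apply: diff_at_eq (diff_atM (diff_lam u i) (diff_coord u i l)) _; rewrite /Xd; ring.
Qed.

Let diff_Yd u i j : diff_at u (e_ j) (Yd i) (Ydd i j u).
Proof.
have H := diff_atM (diff_atM (diff_at_cst u (e_ j) (- sg)) (diff_atX 2 (diff_lam u j)))
  (diff_coord u j i).
by apply: diff_at_eq H _; rewrite /Ydd /=; ring.
Qed.

Let diff_Xd u l i j : diff_at u (e_ j) (Xd l i) (Xdd l i j u).
Proof.
have H := diff_atD (diff_atM (diff_lam u j) (diff_at_cst u (e_ j) (l == i)%:R))
  (diff_atN (diff_atM (diff_atM (diff_atX 2 (diff_lam u j)) (diff_coord u j i))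
     (diff_coord u j l))).
by apply: diff_at_eq H _; rewrite /Xdd /=; ring.
Qed.

Definition osc_sin u := sin (N * stX ord0 u + th).
Local Notation S := osc_sin.
Definition osc_cos u := cos (N * stX ord0 u + th).
Local Notation C := osc_cos.

Lemma chartE u : chart u = vec (20 * a * stY u + a * stY u ^+ 18 * S u) (stX ^~ u).
Proof.
rewrite /chart /twist /stereo; apply: eq_vec => [|j]; last by rewrite vecS.
rewrite vec0 vecS; under eq_bigr do rewrite vecS.
by rewrite sum_stX subKr -exprM.
Qed.

Let diff_S u i : diff_at u (e_ i) S (C u * (N * Xd ord0 i u)).
Proof.
have H := diff_atD (diff_atM (diff_at_cst u (e_ i) N) (diff_stX u i ord0)) (diff_at_cst u (e_ i) th).
apply: diff_at_eq (diff_at_comp (is_derive_sin _) H) _.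
by rewrite /osc_cos; ring.
Qed.

Let diff_C u i : diff_at u (e_ i) C (- S u * (N * Xd ord0 i u)).
Proof.
have H := diff_atD (diff_atM (diff_at_cst u (e_ i) N) (diff_stX u i ord0)) (diff_at_cst u (e_ i) th).
apply: diff_at_eq (diff_at_comp (is_derive_cos _) H) _.
by rewrite /osc_sin; ring.
Qed.

Let Fd i u := 20 * a * Yd i u
  + a * (18 * stY u ^+ 17 * Yd i u * S u + stY u ^+ 18 * N * C u * Xd ord0 i u).

Let Fdd i j u := 20 * a * Ydd i j u
  + a * (306 * stY u ^+ 16 * Yd i u * Yd j u * S u + 18 * stY u ^+ 17 * Ydd i j u * S u
         + 18 * stY u ^+ 17 * N * C u * (Yd i u * Xd ord0 j u + Yd j u * Xd ord0 i u)
         - stY u ^+ 18 * N ^+ 2 * S u * Xd ord0 i u * Xd ord0 j u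
         + stY u ^+ 18 * N * C u * Xdd ord0 i j u).

Let partialE i : partial chart i = fun u => vec (Fd i u) (Xd ^~ i ^~ u).
Proof.
apply/funext => u; rewrite /partial (_ : chart = fun u =>
  vec (20 * a * stY u + a * stY u ^+ 18 * S u) (stX ^~ u)); last exact/funext/chartE.
have H := diff_atD (diff_atM (diff_at_cst u (e_ i) (20 * a)) (diff_stY u i))
  (diff_atM (diff_atM (diff_at_cst u (e_ i) a) (diff_atX 18 (diff_stY u i))) (diff_S u i)).
apply: derive_vec; last by move=> j; exact: diff_stX.
by apply: diff_at_eq H _; rewrite /Fd /=; ring.
Qed.

Let partial2E i j u : partial2 chart i j u = vec (Fdd i j u) (Xdd ^~ i ^~ j ^~ u).
Proof.
rewrite /partial2 partialE.
apply: derive_vec; last by move=> l; exact: diff_Xd.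
have dY := diff_stY u j; have dYd := diff_Yd u i j.
have cst c := diff_at_cst u (e_ j) c.
have H := diff_atD (diff_atM (cst (20 * a)) dYd) (diff_atM (cst a)
  (diff_atD (diff_atM (diff_atM (diff_atM (cst 18) (diff_atX 17 dY)) dYd) (diff_S u j))
     (diff_atM (diff_atM (diff_atM (diff_atX 18 dY) (cst N)) (diff_C u j)) (diff_Xd u ord0 i j)))).
apply: diff_at_eq H _; rewrite /Fdd /=; ring.
Qed.

(** [coef_e] and [coef_q] are the partial derivatives of the height 20 a Y + a Y^18 sin (N X_0 + th)
    in Y and X_0 taken as independent variables, so the height has differential E dY + Q dX_0. *)
Definition coef_e u := 20 * a + 18 * a * stY u ^+ 17 * S u.
Local Notation E := coef_e.
Definition coef_q u := a * stY u ^+ 18 * N * C u.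
Local Notation Q := coef_q.

Let FdE i u : Fd i u = E u * Yd i u + Q u * Xd ord0 i u.
Proof. by rewrite /Fd /coef_e /coef_q; ring. Qed.

(* The inverse transpose of the differential of [twist] applied to the normal
   (Y, X) of the sphere, scaled by [20 * a]. *)
Definition normal u := vec (stY u) (fun j => E u * stX j u - Q u * stY u * (j == ord0)%:R).

Definition normal_sq u := stY u ^+ 2 + E u ^+ 2 * (1 - stY u ^+ 2)
  - 2 * E u * Q u * stY u * stX ord0 u + Q u ^+ 2 * stY u ^+ 2.

Lemma dotp_normal u : dotp (normal u) (normal u) = normal_sq u.
Proof.
rewrite dotp_vec /normal_sq -sum_stX.
have -> : \sum_j (E u * stX j u - Q u * stY u * (j == ord0)%:R) *
                  (E u * stX j u - Q u * stY u * (j == ord0)%:R)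
   = E u ^+ 2 * (\sum_j stX j u ^+ 2)
     - (2 * E u * Q u * stY u) * (\sum_j stX j u * (j == ord0)%:R)
     + (Q u ^+ 2 * stY u ^+ 2) * (\sum_(j < n) 1 * (j == ord0)%:R).
  rewrite !mulr_sumr -sumrB -big_split; apply: eq_bigr => j _ /=.
  by case: (j == ord0) => /=; ring.
by rewrite !sum_delta; ring.
Qed.

(** This is the relation Y^2 + |X|^2 = 1 differentiated once; [sum_X_Xdd] differentiates it
    twice. *)
Let sum_X_Xd i u : \sum_j stX j u * Xd j i u = - stY u * Yd i u.
Proof.
rewrite (eq_bigr (fun j => lam u ^+ 2 * (u 0 j * (j == i)%:R)
    - lam u ^+ 3 * u 0 i * (u 0 j * u 0 j))); last first.
  by move=> j _; rewrite /stX /Xd; ring.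
rewrite sumrB -!mulr_sumr sum_delta sumsq_lam /stY /Yd.
rewrite (_ : - (sg * _) * _ = sg ^+ 2 * ((lam u - 1) * lam u ^+ 2 * u 0 i)); last by ring.
by rewrite sg1; field.
Qed.

Lemma normal_partial i u : dotp (partial chart i u) (normal u) = 0.
Proof.
rewrite partialE dotp_vec FdE.
have -> : \sum_j Xd j i u * (E u * stX j u - Q u * stY u * (j == ord0)%:R)
    = E u * (\sum_j stX j u * Xd j i u) - Q u * stY u * (\sum_j Xd j i u * (j == ord0)%:R).
  by rewrite !mulr_sumr -sumrB; apply: eq_bigr => j _; ring.
by rewrite sum_X_Xd sum_delta; ring.
Qed.

(** Conformality: the round metric dY dY + sum of dX_l dX_l is lam^2 times the identity in the
    chart. *)
Let sum_Xd_Xd i j u : \sum_l Xd l i u * Xd l j u = lam u ^+ 2 * (i == j)%:R - Yd i u * Yd j u.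
Proof.
rewrite (eq_bigr (fun l => lam u ^+ 2 * ((l == i)%:R * (l == j)%:R)
    - lam u ^+ 3 * u 0 j * (u 0 l * (l == i)%:R) - lam u ^+ 3 * u 0 i * (u 0 l * (l == j)%:R)
    + lam u ^+ 4 * u 0 i * u 0 j * (u 0 l * u 0 l))); last first.
  by move=> l _; rewrite /Xd; ring.
rewrite big_split !sumrB -!mulr_sumr !sum_delta sumsq_lam /= (eq_sym j i).
rewrite /Yd (_ : - sg * _ * _ * _ = sg ^+ 2 * (lam u ^+ 4 * u 0 i * u 0 j)); last by ring.
by rewrite sg1; field.
Qed.

Let sum_Yd_Yd u : \sum_i Yd i u * Yd i u = lam u ^+ 2 * (1 - stY u ^+ 2).
Proof.
rewrite (eq_bigr (fun i => sg ^+ 2 * lam u ^+ 4 * (u 0 i * u 0 i))); last first.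
  by move=> i _; rewrite /Yd; ring.
by rewrite -mulr_sumr sumsq_lam stY_sq sg1; field.
Qed.

Let sum_Yd_Xd u : \sum_i Yd i u * Xd ord0 i u = - lam u ^+ 2 * stY u * stX ord0 u.
Proof.
rewrite (eq_bigr (fun i => - sg * lam u ^+ 3 * (u 0 i * (i == ord0)%:R)
   + sg * lam u ^+ 4 * u 0 ord0 * (u 0 i * u 0 i))); last first.
  by move=> i _; rewrite /Yd /Xd (eq_sym i); ring.
rewrite big_split -!mulr_sumr sum_delta sumsq_lam /= /stY /stX; field.
exact: lam0.
Qed.

Let sum_Xd0_Xd0 u : \sum_i Xd ord0 i u * Xd ord0 i u = lam u ^+ 2 * (1 - stX ord0 u ^+ 2).
Proof.
rewrite (eq_bigr (fun i => lam u ^+ 2 * ((i == ord0)%:R * (i == ord0)%:R)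
    - 2 * lam u ^+ 3 * u 0 ord0 * (u 0 i * (i == ord0)%:R)
    + lam u ^+ 4 * u 0 ord0 ^+ 2 * (u 0 i * u 0 i))); last first.
  by move=> i _; rewrite /Xd (eq_sym i); ring.
rewrite big_split !sumrB -!mulr_sumr !sum_delta sumsq_lam /= /stX; field.
exact: lam0.
Qed.

Let first_formE u : first_form chart u = \matrix_(i, j)
  (lam u ^+ 2 * (i == j)%:R + (E u ^+ 2 - 1) * (Yd i u * Yd j u)
   + E u * Q u * (Yd i u * Xd ord0 j u + Xd ord0 i u * Yd j u)
   + Q u ^+ 2 * (Xd ord0 i u * Xd ord0 j u)).
Proof.
apply/matrixP => i j; rewrite !mxE !partialE dotp_vec sum_Xd_Xd !FdE; ring.
Qed.

Lemma det_first_form u : \det (first_form chart u) = lam u ^+ (2 * n) * normal_sq u.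
Proof.
rewrite first_formE (det_scalarD_rank2 _ _ _ _ (sum_Yd_Yd u) (sum_Yd_Xd u) (sum_Xd0_Xd0 u)).
  have -> : lam u ^+ (2 * n) = (lam u ^+ 2) ^+ m * lam u ^+ 4.
    by rewrite -exprM -exprD -[n]addn2 mulnDr.
  by rewrite -(mulrA _ (lam u ^+ 4)); congr (_ * _); rewrite /normal_sq; ring.
by rewrite expf_neq0.
Qed.

Let sum_X_Xdd i j u : \sum_l stX l u * Xdd l i j u
  = - lam u ^+ 2 * (i == j)%:R - stY u * Ydd i j u.
Proof.
rewrite (eq_bigr (fun l => (2 * lam u ^+ 4 * u 0 i * u 0 j - lam u ^+ 3 * (i == j)%:R) * (u 0 l * u 0 l)
   - lam u ^+ 3 * u 0 j * (u 0 l * (l == i)%:R) - lam u ^+ 3 * u 0 i * (u 0 l * (l == j)%:R))); last first.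
  by move=> l _; rewrite /stX /Xdd; ring.
rewrite !sumrB -!mulr_sumr !sum_delta sumsq_lam /stY /Ydd.
rewrite (_ : sg * _ * (sg * _) = sg ^+ 2 * ((lam u - 1) *
  (2 * lam u ^+ 3 * u 0 i * u 0 j - lam u ^+ 2 * (i == j)%:R))); last by ring.
by rewrite sg1; field.
Qed.

(* Up to the factor [a], the second form with respect to [normal] is
   al Id + be dY dY + ga (dY dX_0 + dX_0 dY) + de dX_0 dX_0, by [second_form_normal]. *)
Definition coef_al u := - lam u ^+ 2 * (20 + 18 * stY u ^+ 17 * S u).
Local Notation al := coef_al.
Definition coef_be u := 306 * stY u ^+ 17 * S u.
Local Notation be := coef_be.
Definition coef_ga u := 18 * stY u ^+ 18 * N * C u.
Local Notation ga := coef_ga.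
Definition coef_de u := - stY u ^+ 19 * N ^+ 2 * S u.
Local Notation de := coef_de.

(** The second derivative of the height is E Ydd + Q Xdd_0 plus its Hessian in (Y, X_0). Against
    [normal] the Ydd and Xdd_0 terms cancel by [sum_X_Xdd]; there remain - E lam^2 Id and Y times
    the Hessian, whose entries give [be], [ga] and [de]. *)
Let second_form_normal i j u : dotp (partial2 chart i j u) (normal u) =
  a * (al u * (i == j)%:R + be u * (Yd i u * Yd j u)
    + ga u * (Yd i u * Xd ord0 j u + Xd ord0 i u * Yd j u)
    + de u * (Xd ord0 i u * Xd ord0 j u)).
Proof.
rewrite partial2E dotp_vec.
have -> : \sum_l Xdd l i j u * (E u * stX l u - Q u * stY u * (l == ord0)%:R)
    = E u * (\sum_l stX l u * Xdd l i j u) - Q u * stY u * (\sum_l Xdd l i j u * (l == ord0)%:R).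
  by rewrite !mulr_sumr -sumrB; apply: eq_bigr => l _; ring.
rewrite sum_X_Xdd sum_delta /Fdd /coef_e /coef_q /coef_al /coef_be /coef_ga /coef_de; ring.
Qed.

(* The Gram matrix of dY and dX_0 in the chart has the entries lam^2 (1 - Y^2),
   - lam^2 Y X_0 and lam^2 (1 - X_0^2). *)
Definition second_det u := al u ^+ m *
  (al u ^+ 2 + al u * (be u * (lam u ^+ 2 * (1 - stY u ^+ 2))
                       + 2 * ga u * (- lam u ^+ 2 * stY u * stX ord0 u)
                       + de u * (lam u ^+ 2 * (1 - stX ord0 u ^+ 2)))
   + (be u * de u - ga u ^+ 2) * (lam u ^+ 2 * (1 - stY u ^+ 2) * (lam u ^+ 2 * (1 - stX ord0 u ^+ 2))
                       - (- lam u ^+ 2 * stY u * stX ord0 u) ^+ 2)).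

Lemma lam_le2 u : lam u <= 2.
Proof.
rewrite /lam ler_piMr// invf_le1 ?lerDl ?ltr_pwDl//;
  by apply: sumr_ge0 => j _; rewrite -expr2 sqr_ge0.
Qed.

Lemma normr_stY_le1 u : `|stY u| <= 1.
Proof.
rewrite -[leRHS]normr1 -ler_sqr ?nnegrE// !real_normK ?num_real// stY_sq expr1n.
by have := lam_gt0 u; have := lam_le2 u => *; nra.
Qed.

Lemma normr_osc_sin_le1 u : `|S u| <= 1.
Proof. by rewrite ler_norml sin_geN1 sin_le1. Qed.

Lemma normr_osc_cos_le1 u : `|C u| <= 1.
Proof. by rewrite ler_norml cos_geN1 cos_le1. Qed.

Let YS_le1 u : `|stY u ^+ 17 * S u| <= 1.
Proof.
by rewrite normrM normrX mulr_ile1// ?exprn_ge0 ?exprn_ile1// ?normr_stY_le1 ?normr_osc_sin_le1.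
Qed.

Hypothesis a0 : 0 < a.

(** The slope 20 beats the factor 18 produced by differentiating Y^18, whatever the phase. *)
Lemma coef_e_ge u : 2 * a <= E u.
Proof.
have := YS_le1 u; rewrite ler_norml => /andP[h _].
have -> : E u = 2 * a + 18 * (a * (stY u ^+ 17 * S u + 1)) by rewrite /coef_e; ring.
by rewrite lerDl mulr_ge0// mulr_ge0 ?(ltW a0)//; lra.
Qed.

Lemma coef_e_le u : E u <= 38 * a.
Proof.
have := YS_le1 u; rewrite ler_norml => /andP[_ h].
have -> : E u = 38 * a - 18 * (a * (1 - stY u ^+ 17 * S u)) by rewrite /coef_e; ring.
by rewrite gerBl mulr_ge0// mulr_ge0 ?(ltW a0)//; lra.
Qed.

Let al_neq0 u : al u != 0.
Proof.
rewrite /coef_al mulf_neq0 ?oppr_eq0 ?expf_neq0//.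
have := YS_le1 u; rewrite ler_norml => /andP[h _].
by rewrite gt_eqF// -mulrA; lra.
Qed.

Lemma normal_sq_ge u : stY u ^+ 2 <= normal_sq u.
Proof.
rewrite -dotp_normal dotp_vec -expr2 lerDl; apply: sumr_ge0 => j _.
by rewrite -expr2 sqr_ge0.
Qed.

Lemma normal_sq_gt0 u : 0 < normal_sq u.
Proof.
have [Y0|Y0] := eqVneq (stY u) 0.
  have E0 : 0 < E u by apply: lt_le_trans (coef_e_ge u); rewrite mulr_gt0.
  rewrite /normal_sq Y0 (_ : _ + _ = E u ^+ 2); first exact: exprn_gt0.
  by ring.
by apply: lt_le_trans (normal_sq_ge u); rewrite exprn_even_gt0.
Qed.

Lemma chart_volume_density u :
  volume_density chart u = lam u ^+ n * Num.sqrt (normal_sq u).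
Proof.
rewrite /volume_density det_first_form mulnC exprM.
by rewrite sqrtrM ?sqr_ge0// sqrtr_sqr ger0_norm// exprn_ge0// ltW// lam_gt0.
Qed.

Definition unormal u := (Num.sqrt (normal_sq u))^-1 *: normal u.

Let r_gt0 u : 0 < Num.sqrt (normal_sq u).
Proof. by rewrite sqrtr_gt0 normal_sq_gt0. Qed.

Lemma unit_normal_unormal u : unit_normal chart u (unormal u).
Proof.
split=> [|i]; last by rewrite dotpZr normal_partial mulr0.
rewrite /enorm dotpZl dotpZr dotp_normal.
rewrite -[X in _ * (_ * X)](sqr_sqrtr (ltW (normal_sq_gt0 u))).
set r := Num.sqrt (normal_sq u); have r0 : r != 0 := lt0r_neq0 (r_gt0 u).
by rewrite (_ : r^-1 * (r^-1 * r ^+ 2) = 1) ?sqrtr1//; field.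
Qed.

Let second_formE u : second_form chart u (unormal u) = (a / Num.sqrt (normal_sq u)) *:
    \matrix_(i, j) (al u * (i == j)%:R + be u * (Yd i u * Yd j u)
    + ga u * (Yd i u * Xd ord0 j u + Xd ord0 i u * Yd j u)
    + de u * (Xd ord0 i u * Xd ord0 j u)).
Proof.
apply/matrixP => i j; rewrite !mxE dotpZr second_form_normal mulrA.
by rewrite [_^-1 * a]mulrC.
Qed.

Lemma det_second_form u : \det (second_form chart u (unormal u))
  = (a / Num.sqrt (normal_sq u)) ^+ n * second_det u.
Proof.
rewrite second_formE detZ.
by rewrite (det_scalarD_rank2 _ _ _ (al_neq0 u) (sum_Yd_Yd u) (sum_Yd_Xd u) (sum_Xd0_Xd0 u)).
Qed.

Definition chart_curvature u := (a / Num.sqrt (normal_sq u)) ^+ n * second_det u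
  / (lam u ^+ (2 * n) * normal_sq u).

(** With J the matrix of the partial derivatives, the first form is J J^T, so the pencil lemma
    supplies real principal curvatures; their product is det II / det I. *)
Lemma chart_principal_curvatures u : exists k : 'I_n -> R,
  char_poly (shape_operator chart u (unormal u)) = \prod_(i < n) ('X - (k i)%:P) /\
  chart_curvature u = \prod_(i < n) k i.
Proof.
pose J := \matrix_(i < n) partial chart i u.
have JE : first_form chart u = J *m J^T.
  by apply/matrixP => i j; rewrite !mxE; apply: eq_bigr => l _; rewrite !mxE.
have detJ : \det (J *m J^T) != 0.
  by rewrite -JE det_first_form mulf_neq0 ?expf_neq0// gt_eqF// normal_sq_gt0.
have sym : (second_form chart u (unormal u))^T = second_form chart u (unormal u).
  rewrite second_formE; apply/matrixP => i j; rewrite !mxE (eq_sym j i).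
  by congr (_ * _); rewrite [Yd j u * Yd i u]mulrC [Xd _ _ _ * Xd _ _ _]mulrC [X in ga u * X]addrC
    [Yd j u * _]mulrC [_ * Yd i u]mulrC.
have [k kE] := char_poly_pencil_split sym detJ.
exists k; rewrite /shape_operator JE; split=> //.
rewrite (prod_roots_char_poly kE) -JE det_mulmx det_inv det_second_form.
by rewrite det_first_form.
Qed.

Lemma chart_curvature_density u :
  `|chart_curvature u| * volume_density chart u
  = a ^+ n * `|second_det u| / (lam u ^+ n * Num.sqrt (normal_sq u) ^+ n.+1).
Proof.
rewrite chart_volume_density /chart_curvature.
rewrite -[X in _ / (_ * X)](sqr_sqrtr (ltW (normal_sq_gt0 u))).
exact: normr_curvature_scaling a0 (r_gt0 u) (lam_gt0 u).
Qed.

End chart.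

(** * The twisted sphere *)

Section twisted_sphere.
Context {R : realType} {m : nat}.
Local Notation n := m.+2.
Variables (a N th : R).
Hypothesis a0 : 0 < a.
Implicit Types (u : 'rV[R]_n) (p s : 'rV[R]_n.+1) (j : 'I_n).
Local Notation twist := (@twist R m a N th).
Local Notation chart := (@chart R m a N th).

(** The oscillating term depends on x alone, so [twist] is a scaled shear along the first axis and
    has this explicit inverse on the whole space; embeddedness rests on that. *)
Definition untwist p : 'rV[R]_n.+1 := vec
  ((p 0 ord0 - a * (1 - \sum_j p 0 (lift ord0 j) ^+ 2) ^+ 9
     * sin (N * p 0 (lift ord0 ord0) + th)) / (20 * a))
  (fun j => p 0 (lift ord0 j)).

Let a20 : 20 * a != 0. Proof. by rewrite mulf_neq0// gt_eqF. Qed.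

Let sumsq_vec y (x : 'I_n -> R) : \sum_j vec y x 0 (lift ord0 j) ^+ 2 = \sum_j x j ^+ 2.
Proof. by apply: eq_bigr => j _; rewrite vecS. Qed.

Lemma twistK : cancel twist untwist.
Proof.
move=> p; rewrite -[RHS]vec_eta; apply: eq_vec => [|j]; last by rewrite vecS.
by rewrite sumsq_vec vec0 vecS addrK mulrC mulKf.
Qed.

Lemma elem_vec k l (V : set 'rV[R]_k) f (g : 'I_l -> _) : elementary V f ->
  (forall j : 'I_l, elementary V (g j)) ->
  forall i, elementary V (fun x => vec (f x) (g ^~ x) 0 i).
Proof.
move=> Hf Hg i; case: (unliftP ord0 i) => [j|] ->.
  by under eq_fun do rewrite vecS.
by under eq_fun do rewrite vec0.
Qed.

Let elem_height V : elementary V (fun p => a * (1 - \sum_j p 0 (lift ord0 j) ^+ 2) ^+ 9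
     * sin (N * p 0 (lift ord0 ord0) + th)).
Proof.
apply: elem_mul.
  apply: elem_mul; first exact: elem_cst.
  apply/elem_exp/elem_sub; first exact: elem_cst.
  by apply: elem_sum => j; apply: elem_exp; exact: elem_coord.
apply/elem_sin/elem_add; last exact: elem_cst.
by apply: elem_mul; [exact: elem_cst|exact: elem_coord].
Qed.

Lemma elem_twist V i : elementary V (fun p => twist p 0 i).
Proof.
apply: elem_vec => [|j]; last exact: elem_coord.
apply: elem_add; last exact: elem_height.
by apply: elem_mul; [exact: elem_cst|exact: elem_coord].
Qed.

Lemma elem_untwist V i : elementary V (fun p => untwist p 0 i).
Proof.
apply: elem_vec => [|j]; last exact: elem_coord.
apply: elem_mul; last exact: elem_cst.
by apply: elem_sub; [exact: elem_coord|exact: elem_height].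
Qed.

Definition twisted_sphere := twist @` sphere R n.

Lemma diffeomorphic_twisted_sphere : diffeomorphic (sphere R n) twisted_sphere.
Proof.
exists twist; split.
- by apply: (elementary_smooth_on openT) => // j; exact: elem_twist.
- split; [by move=> p Sp; exists p| |by []].
  by move=> p q _ _; exact: (can_inj twistK).
- exists untwist; split; last by move=> p _; exact: twistK.
  by apply: (elementary_smooth_on openT) => // j; exact: elem_untwist.
Qed.

Lemma sphereE s : sphere R n s <->
  s 0 ord0 ^+ 2 + \sum_j s 0 (lift ord0 j) ^+ 2 = 1.
Proof.
have -> : s 0 ord0 ^+ 2 + \sum_j s 0 (lift ord0 j) ^+ 2 = dotp s s.
  by rewrite -[s in dotp s s]vec_eta dotp_vec expr2; under eq_bigr do rewrite expr2.
rewrite /sphere /enorm /=; split=> [h|->]; last by rewrite sqrtr1.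
by rewrite -(sqr_sqrtr (dotp_ge0 s)) h expr1n.
Qed.

Lemma sphere_coord_le1 s i : sphere R n s -> `|s 0 i| <= 1.
Proof.
move=> Ss; rewrite -[leRHS]normr1 -ler_sqr ?nnegrE// !real_normK ?num_real// expr1n.
have -> : 1 = dotp s s.
  by rewrite -(sqr_sqrtr (dotp_ge0 s)) -/(enorm s) Ss expr1n.
rewrite /dotp (bigD1 i)//= expr2 lerDl; apply: sumr_ge0 => j _.
by rewrite -expr2 sqr_ge0.
Qed.

Lemma compact_sphere : compact (sphere R n).
Proof.
apply: bounded_closed_compact.
  exists 1; split; first exact: num_real.
  move=> x x1 s Ss; apply: le_trans (ltW x1).
  rewrite [leLHS]/Num.Def.normr/= mx_normrE; apply: bigmax_le => // -[i j] _ /=.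
  by rewrite (ord1 i); exact: sphere_coord_le1.
have -> : sphere R n = (fun s => dotp s s) @^-1` [set x | x = 1].
  apply/seteqP; split=> s; rewrite /sphere /=.
    by move=> h; rewrite -(sqr_sqrtr (dotp_ge0 s)) -/(enorm s) h expr1n.
  by rewrite /enorm => ->; rewrite sqrtr1.
apply: preimage_closed; last exact: closed_eq.
move=> s _; apply: (elementary_continuous (V := setT)) => //; first exact: openT.
by apply: elem_sum => i; apply: elem_mul; exact: elem_coord.
Qed.

Lemma compact_twisted_sphere : compact twisted_sphere.
Proof.
apply: continuous_compact compact_sphere; apply: continuous_subspaceT => p.
have := elementary_class_C openT (elem_twist setT) 0; exact.
Qed.

(** Stereographic projection from the pole of height [- sg]. *)
Definition pole_proj (sg : R) s : 'rV[R]_n := \row_j (s 0 (lift ord0 j) / (1 + sg * s 0 ord0)).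

Lemma stereo_sphere sg u : sg ^+ 2 = 1 -> sphere R n (stereo sg u).
Proof.
move=> sg1; apply/sphereE; rewrite vec0; under eq_bigr do rewrite vecS.
by rewrite (sum_stX sg1) addrC subrK.
Qed.

Lemma pole_projK sg u : sg ^+ 2 = 1 -> pole_proj sg (stereo sg u) = u.
Proof.
move=> sg1; apply/rowP => j; rewrite mxE vec0 vecS /stY mulrA -expr2 sg1 mul1r.
by rewrite addrC subrK mulrC mulKf// gt_eqF// lam_gt0.
Qed.

Lemma stereoK sg s : sg ^+ 2 = 1 -> sphere R n s -> 1 + sg * s 0 ord0 != 0 ->
  stereo sg (pole_proj sg s) = s.
Proof.
move=> sg1 /sphereE Ss s0; rewrite -[RHS]vec_eta.
set y := s 0 ord0 in Ss s0 *.
have L : lam (pole_proj sg s) = 1 + sg * y.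
  rewrite /lam; under eq_bigr do rewrite mxE -expr2 exprMn.
  rewrite -mulr_suml (_ : \sum_j _ = 1 - y ^+ 2); last by rewrite -Ss addrC addKr.
  rewrite -/y exprVn (_ : 1 + _ = 2 / (1 + sg * y)) ?invfM ?invrK ?mulVKf//.
  have -> : 1 - y ^+ 2 = 1 - sg ^+ 2 * y ^+ 2 by rewrite sg1 mul1r.
  by field.
apply: eq_vec => [|j]; first by rewrite /stY L addrC addKr mulrA -expr2 sg1 mul1r.
by rewrite /stX L mxE mulrC divfK.
Qed.

Lemma sg_stereo sg u : sg ^+ 2 = 1 -> 1 + sg * stereo sg u 0 ord0 = lam u.
Proof. by move=> sg1; rewrite vec0 /stY mulrA -expr2 sg1 mul1r addrC subrK. Qed.

(** The chart covers everything except the image of the pole of height [- sg]. The ambient open set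
    where [f] is nonzero removes exactly that point, and [f] is the denominator of the inverse. *)
Lemma local_parametrization_chart sg : sg ^+ 2 = 1 ->
  local_parametrization twisted_sphere setT (chart sg).
Proof.
move=> sg1; split; first exact: openT.
pose f p := 1 + sg * untwist p 0 ord0.
have ef V : elementary V f.
  apply: elem_add; first exact: elem_cst.
  by apply: elem_mul; [exact: elem_cst|exact: elem_untwist].
have oV : open (f @^-1` [set x | x != 0]).
  apply: open_comp; last exact: open_neq.
  by move=> p _; apply: (elementary_continuous openT (ef setT)).
exists (f @^-1` [set x | x != 0]); split=> //; split.
- have elem_lam V : elementary V (@lam R m).
    apply: elem_mul; first exact: elem_cst.
    apply: elem_inv.
      move=> u _; rewrite gt_eqF// ltr_pwDl//; apply: sumr_ge0 => j _.
      by rewrite -expr2 sqr_ge0.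
    apply: elem_add; first exact: elem_cst.
    by apply: elem_sum => j; apply: elem_mul; exact: elem_coord.
  have elem_stX V j : elementary V (@stX R m j).
    by apply: elem_mul => //; exact: elem_coord.
  apply: (elementary_smooth_on openT) => // i.
  rewrite (_ : (fun u => _) = fun u =>
     vec (20 * a * stY sg u + a * stY sg u ^+ 18 * osc_sin N th u) ((@stX R m) ^~ u) 0 i); last first.
    by apply/funext => u; rewrite chartE.
  have elem_stY V : elementary V (@stY R m sg).
    by apply: elem_mul; [exact: elem_cst|apply: elem_sub => //; exact: elem_cst].
  apply: elem_vec => //; apply: elem_add.
    by apply: elem_mul => //; exact: elem_cst.
  apply: elem_mul.
    by apply: elem_mul; [exact: elem_cst|exact: elem_exp].
  apply/elem_sin/elem_add; last exact: elem_cst.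
  by apply: elem_mul => //; exact: elem_cst.
- split.
  + move=> u _; split; first by exists (stereo sg u) => //; exact: stereo_sphere.
    by rewrite /f /= chart_stereo twistK sg_stereo// gt_eqF// lam_gt0.
  + move=> u v _ _ /(can_inj twistK) uv.
    by rewrite -(pole_projK u sg1) uv pole_projK.
  + move=> _ [[s Ss <-]]; rewrite /f /= twistK => s0.
    by exists (pole_proj sg s) => //; rewrite chart_stereo stereoK.
- exists (fun p => pole_proj sg (untwist p)); split; last first.
    by move=> u _; rewrite chart_stereo twistK pole_projK.
  apply: (elementary_smooth_on oV); first by move=> p [].
  move=> j; rewrite (_ : (fun _ => _) = fun x => untwist x 0 (lift ord0 j) / f x); last first.
    by apply/funext => x; rewrite mxE.
  apply: elem_mul; first exact: elem_untwist.
  by apply: elem_inv => //; exact: ef.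
Qed.

Let sqr1 : 1 ^+ 2 = 1 :> R. Proof. by rewrite expr1n. Qed.
Let sqrN1 : (-1) ^+ 2 = 1 :> R. Proof. by rewrite sqrrN expr1n. Qed.

Lemma embedded_twisted_sphere : embedded_hypersurface twisted_sphere.
Proof.
move=> _ [s Ss <-].
have [sg [sg1 s0]] : exists sg, sg ^+ 2 = 1 /\ 1 + sg * s 0 ord0 != 0.
  have [y0|y0] := leP 0 (s 0 ord0).
    by exists 1; rewrite mul1r gt_eqF// ltr_pwDl.
  by exists (-1); rewrite mulN1r gt_eqF// addr_gt0// oppr_gt0.
exists setT, (chart sg); split; first exact: local_parametrization_chart.
by exists (pole_proj sg s) => //; rewrite chart_stereo stereoK.
Qed.

(** Heights are at most 21 a in absolute value and the other coordinates at most 1, so each of the n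
    + 1 coordinate differences is at most 42 a + 2. *)
Lemma ediameter_twisted_sphere :
  (ediameter twisted_sphere <= (Num.sqrt ((42 * a + 2) ^+ 2 *+ n.+1))%:E)%E.
Proof.
apply: ge_ereal_sup => _ [_ [_ [[s Ss <-] [t St <-] ->]]].
rewrite lee_fin /enorm ler_wsqrtr// /dotp -[X in _ *+ X]card_ord -sumr_const.
apply: ler_sum => i _; rewrite -expr2 -real_normK ?num_real//.
rewrite (_ : (twist s - twist t) 0 i = twist s 0 i - twist t 0 i); last first.
  by rewrite [LHS]mxE [X in _ + X]mxE.
rewrite ler_sqr ?nnegrE//; last by rewrite addr_ge0// mulr_ge0// ltW.
case: (unliftP ord0 i) => [j|] ->.
  rewrite !vecS; apply: le_trans (ler_normB _ _) _.
  have := sphere_coord_le1 (lift ord0 j) Ss; have := sphere_coord_le1 (lift ord0 j) St.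
  by have := ltW a0; lra.
have bound p : sphere R n p -> `|twist p 0 ord0| <= 21 * a.
  move=> Sp; rewrite vec0; apply: le_trans (ler_normD _ _) _.
  have -> : 21 * a = 20 * a * 1 + a * 1 * 1 by ring.
  have /sphereE E := Sp.
  rewrite (_ : 1 - \sum_j _ = p 0 ord0 ^+ 2); last by rewrite -E addrK.
  rewrite -exprM (normrM (20 * a)) (normrM (a * _)) (normrM a) normrX (gtr0_norm a0).
  rewrite gtr0_norm ?mulr_gt0//; apply: lerD.
    by rewrite ler_pM2l ?mulr_gt0//; exact: sphere_coord_le1.
  apply: ler_pM => //; first by rewrite mulr_ge0 ?exprn_ge0// ltW.
    by rewrite ler_pM2l// exprn_ile1//; exact: sphere_coord_le1.
  by rewrite ler_norml sin_geN1 sin_le1.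
apply: le_trans (ler_normB _ _) _.
by have := bound _ Ss; have := bound _ St; lra.
Qed.
End twisted_sphere.

(** * Partition into hemispheres and the surface integrals *)

Section twisted_sphere_integrals.
Context {R : realType} {m : nat}.
Local Notation n := m.+2.
Variables (a N th : R).
Hypothesis a0 : 0 < a.
Implicit Types (u : 'rV[R]_n) (p s : 'rV[R]_n.+1) (j : 'I_n) (i : nat).
Local Notation twist := (@twist R m a N th).
Local Notation chart := (@chart R m a N th).
Local Notation twisted_sphere := (@twisted_sphere R m a N th).
Local Notation untwist := (@untwist R m a N th).

(* The hemispheres Y >= 0 and Y < 0 in the two stereographic charts. *)
Definition hemi_sign i : R := if i is 0%N then 1 else -1.
Definition hemi i : set 'rV[R]_n := match i with
  | 0 => [set u | \sum_j u 0 j * u 0 j <= 1]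
  | 1 => [set u | \sum_j u 0 j * u 0 j < 1]
  | _ => set0
  end.

Lemma sqr_hemi_sign i : hemi_sign i ^+ 2 = 1.
Proof. by case: i => [|i]; rewrite /= ?sqrrN expr1n. Qed.

Let s_ge0 u : 0 <= \sum_j u 0 j * u 0 j.
Proof. by apply: sumr_ge0 => j _; rewrite -expr2 sqr_ge0. Qed.

Lemma lam_ge1 u : (1 <= lam u) = (\sum_j u 0 j * u 0 j <= 1).
Proof.
rewrite /lam; have := s_ge0 u; set s := (\sum_j _) => s0.
have s1 : 0 < 1 + s by rewrite ltr_pwDl.
by rewrite ler_pdivlMr// mul1r -[2]/(1 + 1 : R) lerD2l.
Qed.

Lemma lam_gt1 u : (1 < lam u) = (\sum_j u 0 j * u 0 j < 1).
Proof.
rewrite /lam; have := s_ge0 u; set s := (\sum_j _) => s0.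
have s1 : 0 < 1 + s by rewrite ltr_pwDl.
by rewrite ltr_pdivlMr// mul1r -[2]/(1 + 1 : R) ltrD2l.
Qed.

Definition side s : R := if 0 <= s 0 ord0 then 1 else -1.

Lemma side_stereo i u : hemi i u -> side (stereo (hemi_sign i) u) = hemi_sign i.
Proof.
rewrite /side vec0 /stY; case: i => [|[|//]] /=.
  by rewrite -lam_ge1 mul1r subr_ge0 => ->.
by rewrite -lam_gt1 mulN1r oppr_ge0 subr_le0 leNgt => ->.
Qed.

Lemma hemi_cover s : sphere R n s -> exists i, [/\ (i < 2)%N, hemi i (pole_proj (hemi_sign i) s),
  stereo (hemi_sign i) (pole_proj (hemi_sign i) s) = s & side s = hemi_sign i].
Proof.
move=> Ss.
have lamE sg : sg ^+ 2 = 1 -> 1 + sg * s 0 ord0 != 0 ->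
    lam (pole_proj sg s) = 1 + sg * s 0 ord0.
  by move=> sg1 s0; rewrite -(sg_stereo _ sg1) stereoK.
rewrite /side; have [y0|y0] := leP 0 (s 0 ord0).
  have d0 : 1 + 1 * s 0 ord0 != 0 by rewrite mul1r gt_eqF// ltr_pwDl.
  exists 0%N; split=> //; last by rewrite stereoK// expr1n.
  by rewrite /hemi /= -lam_ge1 lamE ?expr1n// mul1r lerDl.
have d0 : 1 + (-1) * s 0 ord0 != 0 by rewrite mulN1r gt_eqF// addr_gt0// oppr_gt0.
exists 1%N; split=> //; last by rewrite stereoK// sqrrN expr1n.
by rewrite /hemi /= -lam_gt1 lamE ?sqrrN ?expr1n// mulN1r ltrDl oppr_gt0.
Qed.

(** A Gauss-Kronecker function lives on the ambient space, so the chart formula is read back through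
    the chart of the hemisphere that contains the point. *)
Definition curvature p :=
  let s := untwist p in chart_curvature a N th (side s) (pole_proj (side s) s).

Lemma curvature_chart i u : hemi i u ->
  curvature (chart (hemi_sign i) u) = chart_curvature a N th (hemi_sign i) u.
Proof.
move=> h; rewrite /curvature chart_stereo twistK// side_stereo//.
by rewrite pole_projK// sqr_hemi_sign.
Qed.

Lemma Gauss_Kronecker_curvature : Gauss_Kronecker twisted_sphere curvature.
Proof.
move=> _ [s Ss <-]; have [i [_ hi sE sideE]] := hemi_cover Ss.
have sg1 := sqr_hemi_sign i; set u := pole_proj (hemi_sign i) s in hi sE.
have [k [kE cE]] := chart_principal_curvatures N th sg1 a0 u.
exists k; split; last by rewrite -sE (curvature_chart hi).
exists setT, (chart (hemi_sign i)), u, (unormal a N th (hemi_sign i) u); split=> //.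
- exact: local_parametrization_chart.
- by rewrite chart_stereo sE.
- exact: unit_normal_unormal.
Qed.

Lemma measurable_row_coord j : measurable_fun setT
  (fun t : n.-tuple (measurableTypeR R) => row_of_tuple t 0 j : measurableTypeR R).
Proof.
under eq_fun do rewrite mxE.
exact: measurable_tnth.
Qed.

Lemma measurable_sumsq : measurable_fun setT
  (fun t : n.-tuple (measurableTypeR R) =>
     \sum_j row_of_tuple t 0 j * row_of_tuple t 0 j : measurableTypeR R).
Proof.
by apply: measurable_sum => j; apply: measurable_funM; exact: measurable_row_coord.
Qed.

Lemma measurable_hemi i : measurable (row_of_tuple @^-1` hemi i).
Proof.
case: i => [|[|i]]; last by rewrite preimage_set0.
- rewrite (_ : _ @^-1` _ = setT `&` (fun t => \sum_j row_of_tuple t 0 j * row_of_tuple t 0 j) @^-1` `]-oo, 1]%classic).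
    exact: (measurable_sumsq measurableT).
  by apply/seteqP; split=> t /=; rewrite in_itv/=; [|case].
- rewrite (_ : _ @^-1` _ = setT `&` (fun t => \sum_j row_of_tuple t 0 j * row_of_tuple t 0 j) @^-1` `]-oo, 1[%classic).
    exact: (measurable_sumsq measurableT).
  by apply/seteqP; split=> t /=; rewrite in_itv/=; [|case].
Qed.

Lemma chart_partition_twisted_sphere :
  chart_partition twisted_sphere (fun=> setT) (fun i => chart (hemi_sign i)) hemi.
Proof.
split.
- by move=> i; apply: local_parametrization_chart => //; exact: sqr_hemi_sign.
- by [].
- exact: measurable_hemi.
- apply/trivIsetP => i j _ _ ij; apply/seteqP; split=> // _ [[u hu <-] [v hv]].
  move=> /(can_inj (twistK N th a0)) uv.
  have := side_stereo hu; rewrite -uv side_stereo// => E.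
  have N11 : (-1 : R) != 1 by rewrite eqNr oner_eq0.
  move: i j E ij hu hv {uv} => [|[|i]] [|[|j]] //= /eqP.
    by rewrite (negPf N11).
  by rewrite eq_sym (negPf N11).
- apply/seteqP; split=> [p [i _ [u hu <-]]|_ [s Ss <-]].
    by exists (stereo (hemi_sign i) u) => //; apply: stereo_sphere; exact: sqr_hemi_sign.
  have [i [_ hi sE _]] := hemi_cover Ss.
  by exists i => //; exists (pole_proj (hemi_sign i) s) => //; rewrite chart_stereo sE.
Qed.

(** Turns the series over the partition into the two hemispheres with an explicit density [g]; the
    later pieces are empty. *)
Lemma is_surface_integral_charts (f : 'rV[R]_n.+1 -> R) (g : nat -> 'rV[R]_n -> R) :
  (forall i u, hemi i u ->
     0 <= g i u /\ f (chart (hemi_sign i) u) * volume_density (chart (hemi_sign i)) u = g i u) ->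
  is_surface_integral twisted_sphere f
   (\sum_(i < 2) \int[lebesgue_Rn n]_(t in row_of_tuple @^-1` hemi i) (g i (row_of_tuple t))%:E)%E.
Proof.
move=> fg; exists (fun=> setT), (fun i => chart (hemi_sign i)), hemi.
split; first exact: chart_partition_twisted_sphere.
have E i : (\int[lebesgue_Rn n]_(t in row_of_tuple @^-1` hemi i)
    (f (chart (hemi_sign i) (row_of_tuple t)) *
         volume_density (chart (hemi_sign i)) (row_of_tuple t))%:E =
    \int[lebesgue_Rn n]_(t in row_of_tuple @^-1` hemi i) (g i (row_of_tuple t))%:E)%E.
  apply: eq_integral => t; rewrite inE => /= ht.
  by have [_ ->] := fg _ _ ht.
under eq_eseriesr do rewrite E.
rewrite (nneseries_split 0 2)%E; last first.
  by move=> k _; apply: integral_ge0 => t ht; rewrite lee_fin; have [] := fg _ _ ht.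
rewrite [X in (_ + X)%E]eseries0 ?adde0 ?big_mkord// => -[|[|i]] // _ _.
by rewrite preimage_set0 integral_set0.
Qed.
End twisted_sphere_integrals.

(** * Estimates of the densities *)

Section pointwise_estimates.
Context {R : realType}.
Implicit Types (al be ga de L Y X S C a N c r e q f : R).

(** The entries of the Gram matrix of dY and dX_0; 4 is the maximum of L^2, and 32 = 4 * 4 + 4 *
    4. *)
Let gram_le L Y X : 0 <= L <= 2 -> X ^+ 2 <= 1 - Y ^+ 2 ->
  [/\ `|L ^+ 2 * (1 - Y ^+ 2)| <= 4, `|- L ^+ 2 * Y * X| <= 4,
    `|L ^+ 2 * (1 - X ^+ 2)| <= 4
    & `|L ^+ 2 * (1 - Y ^+ 2) * (L ^+ 2 * (1 - X ^+ 2)) - (- L ^+ 2 * Y * X) ^+ 2| <= 32].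
Proof.
move=> /andP[L0 L2] XY.
have [Y0 X0] := (sqr_ge0 Y, sqr_ge0 X).
have L4 : L ^+ 2 <= 4 by nra.
have LL0 := sqr_ge0 L.
have G1 : `|L ^+ 2 * (1 - Y ^+ 2)| <= 4.
  by rewrite ger0_norm; [nra|rewrite mulr_ge0//; lra].
have G3 : `|L ^+ 2 * (1 - X ^+ 2)| <= 4.
  by rewrite ger0_norm; [nra|rewrite mulr_ge0//; lra].
have G2 : `|- L ^+ 2 * Y * X| <= 4.
  have h : `|Y * X| <= 1.
    have := sqr_ge0 (Y + X); have := sqr_ge0 (Y - X); rewrite sqrrB [(Y + X) ^+ 2]sqrrD => *.
    by rewrite ler_norml; apply/andP; split; lra.
  rewrite !mulNr normrN -mulrA normrM ger0_norm// -[4]mulr1.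
  by rewrite ler_pM.
split=> //.
move: (L ^+ 2 * (1 - Y ^+ 2)) (- L ^+ 2 * Y * X) (L ^+ 2 * (1 - X ^+ 2)) G1 G2 G3 => g1 g2 g3 G1 G2 G3.
apply: le_trans (ler_normB _ _) _; rewrite normrM normrX.
have : `|g1| * `|g3| <= 4 * 4 by rewrite ler_pM.
have : `|g2| * `|g2| <= 4 * 4 by rewrite ler_pM.
  by rewrite expr2; lra.
Qed.

(** Only [ga] (of order N) and [de] (of order N^2) may be large. The point is that [de] enters
    linearly: its square does not occur in a 2 x 2 determinant. *)
Lemma second_det_factor_le A al be ga de L Y X : 1 <= A -> `|al| <= A -> `|be| <= A ->
  0 <= L <= 2 -> X ^+ 2 <= 1 - Y ^+ 2 ->
  `|al ^+ 2 + al * (be * (L ^+ 2 * (1 - Y ^+ 2)) + 2 * ga * (- L ^+ 2 * Y * X)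
                    + de * (L ^+ 2 * (1 - X ^+ 2)))
    + (be * de - ga ^+ 2) * (L ^+ 2 * (1 - Y ^+ 2) * (L ^+ 2 * (1 - X ^+ 2))
                             - (- L ^+ 2 * Y * X) ^+ 2)|
  <= 40 * A ^+ 2 * (1 + ga ^+ 2 + `|de|).
Proof.
move=> A1 al1 be1 L02 XY.
have [G1 G2 G3 W] := gram_le L02 XY.
set g1 := L ^+ 2 * _ in G1 W *; set g2 := - L ^+ 2 * _ * _ in G2 W *.
set g3 := L ^+ 2 * _ in G3 W *.
clearbody g1 g2 g3; clear L02 XY Y X L.
have A0 : 0 <= A by lra.
have T1 : `|al ^+ 2| <= A ^+ 2 by rewrite normrX !expr2 ler_pM.
have T2 : `|al * (be * g1 + 2 * ga * g2 + de * g3)| <= A * (A * 4 + 2 * `|ga| * 4 + `|de| * 4).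
  rewrite normrM ler_pM//; apply: le_trans (ler_normD _ _) _; apply: lerD; last first.
    by rewrite normrM ler_wpM2l.
  apply: le_trans (ler_normD _ _) _; apply: lerD; first by rewrite normrM ler_pM.
  by rewrite !normrM (ger0_norm (_ : 0 <= 2 :> R))// ler_wpM2l ?mulr_ge0.
have T3 : `|(be * de - ga ^+ 2) * (g1 * g3 - g2 ^+ 2)| <= (A * `|de| + ga ^+ 2) * 32.
  rewrite normrM ler_pM//; apply: le_trans (ler_normB _ _) _.
  rewrite normrM [`|ga ^+ 2|]ger0_norm ?sqr_ge0// lerD2r.
  by rewrite ler_wpM2r.
(* Absorbs the term that is linear in [ga]. *)
have ga1 : `|ga| <= 1 + ga ^+ 2.
  rewrite -[ga ^+ 2]real_normK ?num_real//.
  have := sqr_ge0 (`|ga| - 1); rewrite sqrrB; have := normr_ge0 ga; clear.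
  by move: `|ga| => x *; lra.
apply: le_trans (ler_normD _ _) _.
apply: le_trans (lerD (ler_normD _ _) T3) _.
apply: le_trans (lerD (lerD T1 T2) (lexx _)) _.
have := normr_ge0 de; have := sqr_ge0 ga; have := normr_ge0 ga; move: ga1 A1; clear.
move: `|de| `|ga| (ga ^+ 2) => d x y xy A1 x0 y0 d0.
have AA : A <= A ^+ 2 by rewrite expr2; nra.
have h1 : A * x <= A ^+ 2 * (1 + y) by nra.
have h2 : A * d <= A ^+ 2 * d by nra.
have h3 : y <= A ^+ 2 * y by nra.
have -> : A ^+ 2 + A * (A * 4 + 2 * x * 4 + d * 4) + (A * d + y) * 32
  = 5 * A ^+ 2 + 8 * (A * x) + 36 * (A * d) + 32 * y by ring.
have -> : 40 * A ^+ 2 * (1 + y + d) = 40 * A ^+ 2 + 40 * (A ^+ 2 * y) + 40 * (A ^+ 2 * d) by ring.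
rewrite mulrDr mulr1 in h1.
have h4 : 0 <= A ^+ 2 * y by rewrite mulr_ge0// sqr_ge0.
have h5 : 0 <= A * d by rewrite mulr_ge0//; lra.
by move: (A ^+ 2 * y) (A ^+ 2 * d) (A * d) (A * x) (A ^+ 2) AA h1 h2 h3 h4 h5 => *; lra.
Qed.

(** When [be], [ga] and [de] are small, [al ^+ 2 >= 4] dominates. This is the source of the
    positivity of the total curvature. *)
Lemma second_det_factor_ge A d al be ga de L Y X : 0 <= d <= 1 -> 2 <= `|al| <= A ->
  `|be| <= d -> `|ga| <= d -> `|de| <= d ->
  0 <= L <= 2 -> X ^+ 2 <= 1 - Y ^+ 2 ->
  4 - (16 * A + 64) * d <=
  `|al ^+ 2 + al * (be * (L ^+ 2 * (1 - Y ^+ 2)) + 2 * ga * (- L ^+ 2 * Y * X)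
                    + de * (L ^+ 2 * (1 - X ^+ 2)))
    + (be * de - ga ^+ 2) * (L ^+ 2 * (1 - Y ^+ 2) * (L ^+ 2 * (1 - X ^+ 2))
                             - (- L ^+ 2 * Y * X) ^+ 2)|.
Proof.
move=> /andP[d0 d1] /andP[al2 alA] be1 ga1 de1 L02 XY.
have [G1 G2 G3 W] := gram_le L02 XY.
set g1 := L ^+ 2 * _ in G1 W *; set g2 := - L ^+ 2 * _ * _ in G2 W *.
set g3 := L ^+ 2 * _ in G3 W *.
clearbody g1 g2 g3; clear L02 XY Y X L.
have A0 : 0 <= A by lra.
have T1 : 4 <= `|al ^+ 2|.
  have -> : 4 = 2 * 2 :> R by ring.
  by rewrite normrX expr2 ler_pM.
have T2 : `|al * (be * g1 + 2 * ga * g2 + de * g3)| <= A * (d * 4 + 2 * d * 4 + d * 4).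
  rewrite normrM ler_pM//; apply: le_trans (ler_normD _ _) _; apply: lerD; last first.
    by rewrite normrM ler_pM.
  apply: le_trans (ler_normD _ _) _; apply: lerD; first by rewrite normrM ler_pM.
  by rewrite !normrM (ger0_norm (_ : 0 <= 2 :> R))// ler_pM// ler_wpM2l.
have T3 : `|(be * de - ga ^+ 2) * (g1 * g3 - g2 ^+ 2)| <= (d * 1 + d * 1) * 32.
  rewrite normrM ler_pM//; apply: le_trans (ler_normB _ _) _; apply: lerD.
    by rewrite normrM ler_pM// (le_trans de1).
  by rewrite expr2 normrM ler_pM// (le_trans ga1).
move: (al ^+ 2) (al * _) ((be * de - _) * _) T1 T2 T3 => u v w T1 T2 T3.
rewrite -(addrA u v w); apply: le_trans (lerB_normD _ _).
have := ler_normD v w; rewrite mulrDl.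
have -> : 16 * A * d = A * (d * 4 + 2 * d * 4 + d * 4) by ring.
by move: (A * _) `|u| `|v| `|w| `|v + w| T1 T2 T3 => *; lra.
Qed.

(* The part of the curvature density that is not bounded pointwise; it is the
   derivative in the phase of an arctangent, up to sign. *)
Definition peak a N Y S C := a * Y ^+ 18 * N * `|S| / (1 + (a * Y ^+ 18 * N * C) ^+ 2).

Lemma peak_ge0 a N Y S C : 0 <= a -> 0 <= N -> 0 <= peak a N Y S C.
Proof.
move=> a0 N0; rewrite /peak divr_ge0//; last by rewrite addr_ge0 ?sqr_ge0.
by rewrite mulr_ge0// mulr_ge0// mulr_ge0// exprn_even_ge0.
Qed.

(** * Bounds at one point; [e], [q], [r] stand for [coef_e], [coef_q] and the length of [normal] *)

Section one_point.
Variables (c N Y X S C e r : R) (k : nat).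
Hypotheses (c0 : 0 < c) (c4 : c <= 4^-1) (Nc : N * c ^+ 9 = 1).
Hypotheses (Y1 : `|Y| <= 1) (XY : X ^+ 2 <= 1 - Y ^+ 2).
Hypotheses (S1 : `|S| <= 1) (C1 : `|C| <= 1).
Local Notation a := (c ^+ 4).
Hypotheses (e2 : 2 * a <= e) (e38 : e <= 38 * a).
Local Notation q := (a * Y ^+ 18 * N * C).
Local Notation r2 := (Y ^+ 2 + e ^+ 2 * (1 - Y ^+ 2) - 2 * e * q * Y * X + q ^+ 2 * Y ^+ 2).

Let a0 : 0 < a. Proof. by rewrite exprn_gt0. Qed.
Let N0 : 0 < N.
Proof. by rewrite -(pmulr_lgt0 _ (exprn_gt0 9 c0)) Nc. Qed.
Let e0 : 0 < e. Proof. by apply: lt_le_trans e2; rewrite mulr_gt0. Qed.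

(** Young's inequality on the cross term, weighted to keep half of the e^2 term: useful near the
    equator, where q is small. [normal_sq_lower2] uses the opposite weights, for where e is small
    against Y. *)
Lemma normal_sq_lower1 : Y ^+ 2 + e ^+ 2 * (1 - Y ^+ 2) / 2 - q ^+ 2 * Y ^+ 2 <= r2.
Proof.
have := sqr_ge0 (e * X - 2 * (q * Y)).
have : 0 <= e ^+ 2 * (1 - Y ^+ 2 - X ^+ 2) by rewrite mulr_ge0 ?sqr_ge0// subr_ge0.
have -> : (e * X - 2 * (q * Y)) ^+ 2 = e ^+ 2 * X ^+ 2 - 4 * (e * q * Y * X) + 4 * (q ^+ 2 * Y ^+ 2) by ring.
have -> : e ^+ 2 * (1 - Y ^+ 2 - X ^+ 2) = e ^+ 2 * (1 - Y ^+ 2) - e ^+ 2 * X ^+ 2 by ring.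
have -> : 2 * e * q * Y * X = 2 * (e * q * Y * X) by ring.
by move: (e * q * Y * X) (q ^+ 2 * Y ^+ 2) (e ^+ 2 * (1 - Y ^+ 2)) (e ^+ 2 * X ^+ 2) => *; lra.
Qed.

Lemma normal_sq_lower2 : Y ^+ 2 + q ^+ 2 * Y ^+ 2 / 2 - e ^+ 2 <= r2.
Proof.
have := sqr_ge0 (q * Y - 2 * (e * X)).
have : 0 <= e ^+ 2 * (1 - Y ^+ 2 - X ^+ 2) by rewrite mulr_ge0 ?sqr_ge0// subr_ge0.
have : 0 <= e ^+ 2 * Y ^+ 2 by rewrite mulr_ge0 ?sqr_ge0.
have -> : (q * Y - 2 * (e * X)) ^+ 2 = q ^+ 2 * Y ^+ 2 - 4 * (e * q * Y * X) + 4 * (e ^+ 2 * X ^+ 2) by ring.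
have -> : e ^+ 2 * (1 - Y ^+ 2 - X ^+ 2) = e ^+ 2 - e ^+ 2 * Y ^+ 2 - e ^+ 2 * X ^+ 2 by ring.
have -> : 2 * e * q * Y * X = 2 * (e * q * Y * X) by ring.
have -> : e ^+ 2 * (1 - Y ^+ 2) = e ^+ 2 - e ^+ 2 * Y ^+ 2 by ring.
by move: (e * q * Y * X) (q ^+ 2 * Y ^+ 2) (e ^+ 2) (e ^+ 2 * Y ^+ 2) (e ^+ 2 * X ^+ 2) => *; lra.
Qed.

Hypotheses (r0 : 0 <= r) (rE : r ^+ 2 = r2).
Local Notation n := k.+3.
Local Notation ga := (18 * Y ^+ 18 * N * C).
Local Notation de := (- Y ^+ 19 * N ^+ 2 * S).

Let c1 : c <= 1.
Proof. by apply: le_trans c4 _; lra. Qed.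

Let powc i j : (j <= i)%N -> c ^+ i <= c ^+ j.
Proof. by move=> ij; rewrite ler_wiXn2l// ltW. Qed.

Let pow_norm i : `|Y| <= c -> `|Y| ^+ i <= c ^+ i.
Proof. by move=> ?; rewrite lerXn2r ?nnegrE// ltW. Qed.

Let c3 : c ^+ 3 <= 64^-1.
Proof.
have -> : 64^-1 = 4^-1 ^+ 3 :> R by rewrite exprVn; congr (_^-1); ring.
by rewrite lerXn2r ?nnegrE// ?invr_ge0// ltW.
Qed.

Let normN : `|N| = N. Proof. by rewrite gtr0_norm. Qed.

(** The damping makes q^2 Y^2 at most a^2 / 4, while e >= 2 a makes half of e^2 (1 - Y^2) at least
    a^2. *)
Lemma normal_lower_equator : `|Y| <= c -> a / 2 <= r.
Proof.
move=> Yc; rewrite -ler_sqr ?nnegrE ?divr_ge0// ?(ltW a0)// rE.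
apply: le_trans normal_sq_lower1.
have Y2 : Y ^+ 2 <= 4^-1.
  rewrite -real_normK ?num_real//; apply: le_trans (pow_norm 2 Yc) _.
  by apply: le_trans (powc (isT : (1 <= 2)%N)) _; rewrite expr1.
have NY : N * `|Y| ^+ 19 <= 2^-1.
  apply: (@le_trans _ _ (N * c ^+ 19)); first by rewrite ler_pM2l// pow_norm.
  rewrite (exprD c 9 10) mulrA Nc mul1r.
  by apply: le_trans (powc (isT : (1 <= 10)%N)) _; rewrite expr1; have := c4; lra.
have q2 : q ^+ 2 * Y ^+ 2 <= a ^+ 2 / 4.
  have -> : q ^+ 2 * Y ^+ 2 = a ^+ 2 * (N * `|Y| ^+ 19) ^+ 2 * C ^+ 2.
    have Y38 : (`|Y| ^+ 19) ^+ 2 = Y ^+ 38.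
      by rewrite -exprM -[(19 * 2)%N]/(2 * 19)%N exprM real_normK ?num_real// -exprM.
    by rewrite [(N * _) ^+ 2]exprMn Y38; ring.
  rewrite -mulrA; apply: ler_wpM2l; first exact: sqr_ge0.
  have C2 : C ^+ 2 <= 1 by rewrite -real_normK ?num_real// exprn_ile1.
  have N2 : (N * `|Y| ^+ 19) ^+ 2 <= 4^-1.
    have -> : 4^-1 = 2^-1 ^+ 2 :> R by rewrite exprVn; congr (_^-1); ring.
    by rewrite lerXn2r ?nnegrE ?invr_ge0// mulr_ge0 ?exprn_ge0// ltW.
  by rewrite -[4^-1]mulr1 ler_pM ?sqr_ge0.
have ee : 4 * a ^+ 2 <= e ^+ 2.
  have -> : 4 * a ^+ 2 = (2 * a) ^+ 2 by ring.
  by rewrite ler_sqr ?nnegrE// ?mulr_ge0// ltW.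
have e1 : 4 * a ^+ 2 * 2^-1 <= e ^+ 2 * (1 - Y ^+ 2).
  apply: ler_pM ee _ => //; first by rewrite mulr_ge0// sqr_ge0.
  by lra.
have := sqr_ge0 Y; have := sqr_ge0 a; rewrite [(a / 2) ^+ 2]expr_div_n.
have -> : 2 ^+ 2 = 4 :> R by ring.
move: q2 e1.
move: (q ^+ 2 * Y ^+ 2) (e ^+ 2 * (1 - Y ^+ 2)) (a ^+ 2) (Y ^+ 2) => *; lra.
Qed.

Lemma normal_lower_Y : `|Y| <= r.
Proof.
rewrite -ler_sqr ?nnegrE// rE real_normK ?num_real//.
have := sqr_ge0 (e * X - q * Y); have : 0 <= e ^+ 2 * (1 - Y ^+ 2 - X ^+ 2).
  by rewrite mulr_ge0 ?sqr_ge0// subr_ge0.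
have -> : (e * X - q * Y) ^+ 2 = e ^+ 2 * X ^+ 2 - 2 * (e * q * Y * X) + q ^+ 2 * Y ^+ 2 by ring.
have -> : e ^+ 2 * (1 - Y ^+ 2 - X ^+ 2) = e ^+ 2 * (1 - Y ^+ 2) - e ^+ 2 * X ^+ 2 by ring.
have -> : 2 * e * q * Y * X = 2 * (e * q * Y * X) by ring.
by move: (e * q * Y * X) (q ^+ 2 * Y ^+ 2) (e ^+ 2 * (1 - Y ^+ 2)) (e ^+ 2 * X ^+ 2) => *; lra.
Qed.

Lemma normal_lower_away : c <= `|Y| -> Y ^+ 2 * (1 + q ^+ 2) <= 4 * r ^+ 2.
Proof.
move=> cY.
(* [c <= 4^-1] gives 38 c^3 <= 38 / 64 < 5 / 8; thus e^2 is at most half of Y^2 and can be absorbed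
   in [normal_sq_lower2]. *)
have ec : e <= 2^-1 * c + 8^-1 * c.
  apply: le_trans e38 _; rewrite (exprS c 3).
  by have := ler_wpM2l (ltW c0) c3; have := c0; move: (c ^+ 3) => z; lra.
have e2Y : e ^+ 2 <= Y ^+ 2 / 2.
  rewrite -[Y ^+ 2]real_normK ?num_real//.
  have h : e <= 5 / 8 * `|Y| by lra.
  apply: (@le_trans _ _ ((5 / 8 * `|Y|) ^+ 2)).
    by rewrite lerXn2r ?nnegrE// ?(ltW e0) ?mulr_ge0.
  have := sqr_ge0 `|Y|; rewrite exprMn; move: (`|Y| ^+ 2) => z z0.
  by rewrite (_ : (5 / 8) ^+ 2 = 25 / 64 :> R); [lra|field].
have h1 : Y ^+ 2 + q ^+ 2 * Y ^+ 2 / 2 - e ^+ 2 <= r ^+ 2 by rewrite rE normal_sq_lower2.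
have r20 := sqr_ge0 r.
have -> : Y ^+ 2 * (1 + q ^+ 2) = Y ^+ 2 + q ^+ 2 * Y ^+ 2 by ring.
by move: (q ^+ 2 * Y ^+ 2) (r ^+ 2) (e ^+ 2) (Y ^+ 2) e2Y h1 r20 => *; lra.
Qed.

(** The pointwise heart of the bound on T. In the constant, 3 * 2^(n+1) comes from the zone |Y| <=
    c, where r >= a / 2; for |Y| >= c the summands 1, ga^2 and |de| cost 1, 18^2 * 4 and 4 times the
    peak. *)
Lemma curvature_density_le : c ^+ 4 * a ^+ n * (1 + ga ^+ 2 + `|de|)
  <= (3 * 2 ^+ n.+1 + 18 ^+ 2 * 4 + 5) * (1 + peak a N Y S C) * r ^+ n.+1.
Proof.
have p0 : 0 <= peak a N Y S C by apply: peak_ge0; exact: ltW.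
have rn0 : 0 <= r ^+ n.+1 by rewrite exprn_ge0.
have K1 : 0 <= 3 * 2 ^+ n.+1 :> R by rewrite mulr_ge0// exprn_ge0.
have K2 : 0 <= 18 ^+ 2 * 4 :> R by rewrite mulr_ge0// exprn_ge0.
have deE : `|de| = `|Y| ^+ 19 * N ^+ 2 * `|S|.
  by rewrite !mulNr normrN (normrM _ S) (normrM (Y ^+ 19)) !normrX normN.
have [Yc|/ltW Yc] := leP `|Y| c.
  apply: (@le_trans _ _ (3 * 2 ^+ n.+1 * r ^+ n.+1)); last first.
    apply: ler_wpM2r => //.
    by rewrite -[leLHS]mulr1 ler_pM// ?lerDl// -addrA lerDl addr_ge0.
  have -> : 3 * 2 ^+ n.+1 * r ^+ n.+1 = (2 * r) ^+ n.+1 * 3 by rewrite exprMn; ring.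
  rewrite -exprS; apply: ler_pM.
  - by rewrite exprn_ge0// ltW.
  - by rewrite addr_ge0// addr_ge0// sqr_ge0.
  - have := normal_lower_equator Yc; rewrite ler_pdivrMr// mulrC => h.
    by rewrite lerXn2r ?nnegrE ?mulr_ge0// ltW.
  (* The exponent 18 is used here: N |Y|^18 <= c^9 and N^2 |Y|^19 <= c. *)
  - have g1 : ga ^+ 2 <= 1.
      rewrite -real_normK ?num_real// exprn_ile1//.
      have -> : `|ga| = 18 * (N * `|Y| ^+ 18) * `|C|.
        by rewrite (normrM _ C) (normrM _ N) (normrM 18) normrX normN ger0_norm//; ring.
      have h : N * `|Y| ^+ 18 <= c ^+ 9.
        apply: (@le_trans _ _ (N * c ^+ 18)); first by rewrite ler_pM2l// pow_norm.
        by rewrite (exprD c 9 9) mulrA Nc mul1r.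
      apply: (@le_trans _ _ (18 * c ^+ 3 * 1)).
        rewrite ler_pM ?mulr_ge0 ?exprn_ge0// ?(ltW N0)//.
        by rewrite ler_pM2l//; apply: le_trans h (powc _).
      by have := c3; lra.
    have d1 : `|de| <= 1.
      rewrite deE; apply: (@le_trans _ _ (c * 1)); last by rewrite mulr1.
      apply: ler_pM => //.
        by rewrite mulr_ge0 ?exprn_ge0// ltW.
      apply: (@le_trans _ _ (c ^+ 19 * N ^+ 2)).
        by rewrite ler_wpM2r ?exprn_ge0 ?pow_norm// ltW.
      have -> : c ^+ 19 * N ^+ 2 = (N * c ^+ 9) ^+ 2 * c by ring.
      by rewrite Nc expr1n mul1r.
    by move: (ga ^+ 2) `|de| g1 d1 => *; lra.
have Y0 : 0 < `|Y| by apply: lt_le_trans c0 Yc.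
have rY := normal_lower_Y.
have cr : c <= r by apply: le_trans rY.
have r2c i j : (j <= i)%N -> c ^+ i <= r ^+ j.
  move=> ij; apply: le_trans (powc ij) _.
  by rewrite lerXn2r ?nnegrE// ltW.
have away := normal_lower_away Yc.
have t1 : c ^+ 4 * a ^+ n <= r ^+ n.+1.
  rewrite -exprS -exprM; apply: r2c.
  by rewrite leq_pmull.
have t2 : c ^+ 4 * a ^+ n * ga ^+ 2 <= 18 ^+ 2 * 4 * r ^+ n.+1.
  have -> : c ^+ 4 * a ^+ n * ga ^+ 2 = 18 ^+ 2 * (c ^+ 4 * (a ^+ k.+1 * q ^+ 2)).
    have -> : a ^+ n = a ^+ k.+1 * a ^+ 2 by rewrite -exprD addn2.
    by ring.
  rewrite -[leRHS]mulrA; apply: ler_wpM2l; first by rewrite exprn_ge0.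
  have q4 : c ^+ 2 * q ^+ 2 <= 4 * r ^+ 2.
    apply: le_trans away; rewrite -[Y ^+ 2]real_normK ?num_real// ler_pM ?sqr_ge0//.
      by rewrite lerXn2r ?nnegrE// ltW.
    by rewrite lerDr.
  have -> : r ^+ n.+1 = r ^+ k.+2 * r ^+ 2 by rewrite -exprD addn2.
  have -> : c ^+ 4 * (a ^+ k.+1 * q ^+ 2) = (c ^+ 2 * a ^+ k.+1) * (c ^+ 2 * q ^+ 2) by ring.
  have -> : 4 * (r ^+ k.+2 * r ^+ 2) = r ^+ k.+2 * (4 * r ^+ 2) by ring.
  apply: ler_pM => //; first by rewrite mulr_ge0// exprn_ge0 ?exprn_ge0// ltW.
    by rewrite mulr_ge0// sqr_ge0.
  rewrite -exprM -exprD; apply: r2c.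
  by rewrite mulnS addnA -[k.+2]add2n leq_add// leq_pmull.
(* One factor a, together with N |Y|^18 |S|, is the numerator of the peak, and its denominator 1 +
   q^2 is absorbed by [normal_lower_away]. After multiplication by |Y| there remains c^4 a^(k+2) N =
   c^(4k+3) <= |Y| r^(k+2), where |Y| and r are at least c; the exponents are equal when k = 0, that
   is n = 3. *)
have t3 : c ^+ 4 * a ^+ n * `|de| <= 4 * peak a N Y S C * r ^+ n.+1.
  have q1 : 0 < 1 + q ^+ 2 by rewrite ltr_pwDl// sqr_ge0.
  have pE : a * `|Y| ^+ 18 * N * `|S| = peak a N Y S C * (1 + q ^+ 2).
    rewrite /peak divfK ?gt_eqF//.
    by rewrite -normrX ger0_norm// exprn_even_ge0.
  have -> : c ^+ 4 * a ^+ n * `|de|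
     = c ^+ 4 * a ^+ k.+2 * N * `|Y| * (peak a N Y S C * (1 + q ^+ 2)).
    rewrite -pE deE (_ : a ^+ n = a ^+ k.+2 * a); last by rewrite exprSr.
    by ring.
  rewrite -(ler_pM2l Y0).
  have -> : `|Y| * (c ^+ 4 * a ^+ k.+2 * N * `|Y| * (peak a N Y S C * (1 + q ^+ 2)))
     = c ^+ 4 * a ^+ k.+2 * N * peak a N Y S C * (`|Y| ^+ 2 * (1 + q ^+ 2)) by ring.
  have -> : `|Y| * (4 * peak a N Y S C * r ^+ n.+1) = `|Y| * r ^+ k.+2 * peak a N Y S C * (4 * r ^+ 2).
    have -> : r ^+ n.+1 = r ^+ k.+2 * r ^+ 2 by rewrite -exprD addn2.
    by ring.
  rewrite real_normK ?num_real//; apply: ler_pM => //.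
  - rewrite mulr_ge0// mulr_ge0 ?(ltW N0)// mulr_ge0 ?(ltW a0)//.
    by rewrite exprn_ge0// ltW.
  - by rewrite mulr_ge0 ?sqr_ge0// ltW.
  apply: ler_wpM2r => //.
  have -> : c ^+ 4 * a ^+ k.+2 * N = c * c ^+ (4 * k + 2) * (N * c ^+ 9).
    have -> : a ^+ k.+2 = a ^+ k * a ^+ 2 by rewrite -exprD addn2.
    have -> : c ^+ (4 * k + 2) = a ^+ k * c ^+ 2 by rewrite exprD exprM.
    by move: (a ^+ k) => z; ring.
  rewrite Nc mulr1; apply: ler_pM => //; rewrite ?exprn_ge0 ?(ltW c0)//.
  by apply: r2c; rewrite -addn2 leq_add2r leq_pmull.
rewrite mulrDr mulrDr mulr1.
apply: le_trans (lerD (lerD t1 t2) t3) _.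
rewrite -[X in X + _ + _]mul1r -!mulrDl; apply: ler_wpM2r => //.
set p := peak _ _ _ _ _ in p0 *.
have : 0 <= (3 * 2 ^+ n.+1) * p by rewrite mulr_ge0.
have : 0 <= (18 ^+ 2 * 4) * p by rewrite mulr_ge0.
move: K1 K2 p0.
move: (3 * 2 ^+ n.+1) (18 ^+ 2 * 4) p => x y p *.
by rewrite mulrDr mulr1 !mulrDl; lra.
Qed.

(** For the volume: r is at least |q Y| / 2 - e. The bound |C| >= C^2 is taken because the phase
    average of the cosine squared is explicit. *)
Lemma normal_lower_pole : 2^-1 <= `|Y| -> 2 ^- 20 * (a * N) * C ^+ 2 - 38 * a <= r.
Proof.
move=> Y2.
have h : `|q * Y| / 2 <= r + e.
  rewrite -ler_sqr ?nnegrE ?divr_ge0 ?addr_ge0 ?(ltW e0)//.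
  rewrite expr_div_n real_normK ?num_real// [(q * Y) ^+ 2]exprMn.
  have : Y ^+ 2 + q ^+ 2 * Y ^+ 2 / 2 - e ^+ 2 <= r ^+ 2 by rewrite rE normal_sq_lower2.
  have := sqr_ge0 Y; have : 0 <= r * e by rewrite mulr_ge0// ltW.
  have : 0 <= q ^+ 2 * Y ^+ 2 by rewrite mulr_ge0 ?sqr_ge0.
  have -> : (r + e) ^+ 2 = r ^+ 2 + 2 * (r * e) + e ^+ 2 by ring.
  have -> : 2 ^+ 2 = 4 :> R by ring.
  by move: (q ^+ 2 * Y ^+ 2) (r ^+ 2) (e ^+ 2) (Y ^+ 2) (r * e) => *; lra.
have qY : `|q * Y| = a * N * (`|Y| ^+ 19 * `|C|).
  rewrite (_ : q * Y = a * N * (Y ^+ 19 * C)); last by ring.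
  by rewrite normrM (normrM _ N) (normrM _ C) (normrX 19) normN (gtr0_norm a0).
have : 2 ^- 19 * C ^+ 2 <= `|Y| ^+ 19 * `|C|.
  apply: ler_pM; rewrite ?sqr_ge0 ?invr_ge0 ?exprn_ge0//.
    by rewrite -exprVn lerXn2r ?nnegrE ?invr_ge0.
  by rewrite -[leLHS]real_normK ?num_real// expr2 -[leRHS]mulr1 ler_wpM2l.
move=> /(ler_wpM2l (ltW (mulr_gt0 a0 N0))); rewrite -qY => h2.
have -> : 2 ^- 20 * (a * N) * C ^+ 2 = (a * N * (2 ^- 19 * C ^+ 2)) / 2.
  rewrite (_ : 2 ^- 20 = 2 ^- 19 / 2 :> R); last by rewrite -invfM -exprSr.
  by move: (2 ^- 19) => z; ring.
by have := e38; move: (`|q * Y|) (a * N * _) h h2 => *; lra.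
Qed.

(** A crude bound, for the finiteness of the volume and for the positive lower bound [equator_const]
    on the curvature density. *)
Lemma normal_upper : r <= 1 + 2 * (38 * a) ^+ 2 + 2 * (a * N) ^+ 2.
Proof.
set B := (X in _ <= X).
have B1 : 1 <= B.
  rewrite /B; have := sqr_ge0 (38 * a); have := sqr_ge0 (a * N).
  by move: ((38 * a) ^+ 2) ((a * N) ^+ 2) => *; lra.
have qq : q ^+ 2 <= (a * N) ^+ 2.
  have -> : q ^+ 2 = (a * N) ^+ 2 * (`|Y| ^+ 18 * `|C|) ^+ 2.
    by rewrite -!normrX -normrM real_normK ?num_real//; ring.
  rewrite -[leRHS]mulr1; apply: ler_wpM2l; first exact: sqr_ge0.
  by rewrite exprn_ile1 ?mulr_ge0 ?exprn_ge0// mulr_ile1 ?exprn_ge0// exprn_ile1.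
have ee : e ^+ 2 <= (38 * a) ^+ 2 by rewrite lerXn2r ?nnegrE ?mulr_ge0// ltW.
have Y2 : Y ^+ 2 <= 1 by rewrite -real_normK ?num_real// exprn_ile1.
have rB : r ^+ 2 <= B.
  rewrite rE /B; have := sqr_ge0 (e * X + q * Y).
  have : 0 <= e ^+ 2 * (1 - Y ^+ 2 - X ^+ 2) by rewrite mulr_ge0 ?sqr_ge0// subr_ge0.
  have : 0 <= e ^+ 2 * Y ^+ 2 by rewrite mulr_ge0 ?sqr_ge0.
  have : q ^+ 2 * Y ^+ 2 <= q ^+ 2 by rewrite -[leRHS]mulr1 ler_wpM2l ?sqr_ge0.
  have -> : (e * X + q * Y) ^+ 2 = e ^+ 2 * X ^+ 2 + 2 * (e * q * Y * X) + q ^+ 2 * Y ^+ 2 by ring.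
  have -> : e ^+ 2 * (1 - Y ^+ 2 - X ^+ 2) = e ^+ 2 - e ^+ 2 * Y ^+ 2 - e ^+ 2 * X ^+ 2 by ring.
  have -> : 2 * e * q * Y * X = 2 * (e * q * Y * X) by ring.
  have -> : e ^+ 2 * (1 - Y ^+ 2) = e ^+ 2 - e ^+ 2 * Y ^+ 2 by ring.
  move: ((38 * a) ^+ 2) ((a * N) ^+ 2) ee qq Y2 => x y.
  by move: (e * q * Y * X) (q ^+ 2 * Y ^+ 2) (e ^+ 2 * Y ^+ 2) (e ^+ 2 * X ^+ 2) (q ^+ 2) (e ^+ 2) (Y ^+ 2) => *; lra.
have B0 : 0 <= B by apply: le_trans B1.
rewrite -ler_sqr ?nnegrE//; apply: le_trans rB _.
by rewrite expr2 ler_peMl.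
Qed.

Lemma peak_le : peak a N Y S C <= a * N.
Proof.
rewrite /peak ler_pdivrMr ?ltr_pwDl ?sqr_ge0//.
apply: (@le_trans _ _ (a * N)); last first.
  by apply: ler_peMr; [rewrite mulr_ge0// ltW|rewrite lerDl sqr_ge0].
have -> : a * Y ^+ 18 * N * `|S| = a * N * (`|Y| ^+ 18 * `|S|).
  have -> : `|Y| ^+ 18 = Y ^+ 18 by rewrite -normrX ger0_norm// exprn_even_ge0.
  by ring.
apply: ler_piMr; first by rewrite mulr_ge0// ltW.
by rewrite mulr_ile1 ?exprn_ge0// exprn_ile1.
Qed.

(** On this much thinner strip all powers of c that remain have exponent at least 18, and c^3 <= 1 /
    10 makes c^18 at most 10^-6, which beats coefficients up to 10^3. *)
Lemma coef_small_equator : `|Y| <= c ^+ 2 ->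
  [/\ `|306 * Y ^+ 17 * S| <= 10 ^- 3, `|ga| <= 10 ^- 3 & `|de| <= 10 ^- 3].
Proof.
move=> Yc.
have pw i : `|Y| ^+ i <= c ^+ (2 * i).
  by rewrite exprM lerXn2r ?nnegrE// exprn_ge0// ltW.
have c10 : c ^+ 3 <= 10^-1 by apply: le_trans c3 _; rewrite lef_pV2 ?posrE// ler_nat.
have pow_small K i : 0 <= K -> K <= 10 ^+ 3 -> (18 <= i)%N -> K * c ^+ i <= 10 ^- 3.
  move=> K0 K3 i18; apply: (@le_trans _ _ (10 ^+ 3 * (10^-1 ^+ 6))); last first.
    by rewrite exprVn (exprD _ 3 3) invfM mulVKf// expf_neq0// pnatr_eq0.
  apply: ler_pM => //; first by rewrite exprn_ge0// ltW.
  apply: le_trans (powc i18) _; rewrite (exprM c 3 6).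
  by rewrite lerXn2r ?nnegrE ?invr_ge0// exprn_ge0// ltW.
have small i : (18 <= i)%N -> 306 * c ^+ i <= 10 ^- 3.
  by apply: pow_small; rewrite ?ler0n// -natrX ler_nat.
split.
- apply: le_trans (small 34%N isT); rewrite normrM -[leRHS]mulr1; apply: ler_pM => //.
  rewrite normrM normrX (ger0_norm (ler0n _ 306)).
  by apply: ler_wpM2l (ler0n _ 306) _ _ _; exact: pw.
- apply: le_trans (small 27%N isT); rewrite (normrM _ C) -[leRHS]mulr1; apply: ler_pM => //.
  rewrite (normrM _ N) (normrM 18) normrX normN ger0_norm//.
  rewrite -mulrA; apply: ler_pM; rewrite ?mulr_ge0 ?exprn_ge0 ?(ltW N0)//.
    by rewrite ler_nat.
  apply: (@le_trans _ _ (c ^+ 36 * N)); first by rewrite ler_pM2r//; exact: pw.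
  by rewrite (exprD c 27 9) -mulrA [_ * N]mulrC Nc mulr1.
- apply: le_trans (small 20%N isT); rewrite (normrM _ S) -[leRHS]mulr1; apply: ler_pM => //.
  rewrite mulNr normrN normrM !normrX normN.
  apply: (@le_trans _ _ (c ^+ 38 * N ^+ 2)).
    by rewrite ler_wpM2r ?sqr_ge0//; exact: pw.
  rewrite (_ : _ * _ = 1 * c ^+ 20); last by rewrite -[1](expr1n _ 2) -Nc; ring.
  by rewrite ler_wpM2r ?exprn_ge0 ?ler1n// ltW.
Qed.

End one_point.
End pointwise_estimates.

(** * Averages over the phase *)

Section phase_integrals.
Context {R : realType}.
Local Notation mu := (@lebesgue_measure R).

Lemma continuous_FTC2_real (f F : R -> R) (x y : R) : x < y -> continuous f ->
  (forall t : R, is_derive t (1 : R) F (f t)) ->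
  (\int[mu]_(t in `[x, y]) (f t)%:E = (F y - F x)%:E)%E.
Proof.
move=> xy cf dF; rewrite EFinB; apply: continuous_FTC2 => //.
- exact: continuous_subspaceT.
- have cF : continuous F.
    move=> t; apply: differentiable_continuous; apply/derivable1_diffP.
    by have [] := dF t.
  split.
  + by move=> t _; have [] := dF t.
  + by apply: cvg_at_right_filter; exact: cF.
  + by apply: cvg_at_left_filter; exact: cF.
- by move=> t _; rewrite derive1E; have [] := dF t.
Qed.

Let pi2_gt0 : 0 < pi *+ 2 :> R. Proof. by rewrite pmulrn_lgt0// pi_gt0. Qed.

Let cont_phase (ph : R) : continuous (fun t : R => ph + t).
Proof. by move=> t; apply: cvgD; [exact: cvg_cst|exact: cvg_id]. Qed.

Let cont_sin (ph : R) : continuous (fun t : R => sin (ph + t)).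
Proof.
by move=> t; apply: (@continuous_comp _ _ _ (fun t => ph + t) sin); [exact: cont_phase|exact: continuous_sin].
Qed.

Let cont_cos (ph : R) : continuous (fun t : R => cos (ph + t)).
Proof.
by move=> t; apply: (@continuous_comp _ _ _ (fun t => ph + t) cos); [exact: cont_phase|exact: continuous_cos].
Qed.

Let der_phase (ph t : R) : is_derive t (1 : R) (fun t => ph + t) 1.
Proof.
apply: is_derive_eq (is_deriveD (is_derive_cst ph t 1) (is_derive_id t 1)) _.
by rewrite add0r.
Qed.

Let der_sin (ph t : R) : is_derive t (1 : R) (fun t => sin (ph + t)) (cos (ph + t)).
Proof.
apply: is_derive_eq (is_derive1_comp (is_derive_sin (ph + t)) (der_phase ph t)) _.
by rewrite mulr1.
Qed.

Let der_cos (ph t : R) : is_derive t (1 : R) (fun t => cos (ph + t)) (- sin (ph + t)).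
Proof.
apply: is_derive_eq (is_derive1_comp (is_derive_cos (ph + t)) (der_phase ph t)) _.
by rewrite mulr1.
Qed.

Lemma integral_cos_sqr (ph : R) :
  (\int[mu]_(t in `[0%R, (pi *+ 2)%R]) (cos (ph + t) ^+ 2)%:E = pi%:E)%E.
Proof.
pose F t : R := 2^-1 * (t + sin (ph + t) * cos (ph + t)).
have cf : continuous (fun t => cos (ph + t) ^+ 2).
  by move=> t; under eq_fun do rewrite expr2; apply: cvgM; exact: cont_cos.
have dF t : is_derive t (1 : R) F (cos (ph + t) ^+ 2).
  have H := is_deriveD (is_derive_id t (1 : R)) (is_deriveM (der_sin ph t) (der_cos ph t)).
  apply: is_derive_eq (is_deriveZ 2^-1 H) _.
  rewrite /GRing.scale /=; have := cos2Dsin2 (ph + t).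
  by move: (cos (ph + t)) (sin (ph + t)) => c s cs; rewrite -[X in X + _]cs; field.
rewrite (continuous_FTC2_real pi2_gt0 cf dF) /F addr0 sinD2pi cosD2pi.
by congr EFin; rewrite mulr2n; field.
Qed.

(** Where the sine keeps its sign, the integrand is the derivative of - s atan (m cos), and the
    arctangent varies by at most pi independently of m. *)
Lemma integral_peak_piece (al m x y s : R) : x < y -> 0 < m -> s ^+ 2 = 1 ->
  (forall t, x <= t <= y -> 0 <= s * sin (al + t)) ->
  (\int[mu]_(t in `[x, y]) (m * `|sin (al + t)| / (1 + (m * cos (al + t)) ^+ 2))%:E <= pi%:E)%E.
Proof.
move=> xy m0 s1 ss.
pose F t : R := - s * atan (m * cos (al + t)).
pose f t : R := m * (s * sin (al + t)) / (1 + (m * cos (al + t)) ^+ 2).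
have d0 t : 1 + (m * cos (al + t)) ^+ 2 != 0 by rewrite gt_eqF// ltr_pwDl// sqr_ge0.
have cmc : continuous (fun t => m * cos (al + t)).
  by move=> t; apply: cvgM; [exact: cvg_cst|exact: cont_cos].
have cf : continuous f.
  move=> t; apply: cvgM.
    apply: cvgM; first exact: cvg_cst.
    by apply: cvgM; [exact: cvg_cst|exact: cont_sin].
  apply: cvgV => //; apply: cvgD; first exact: cvg_cst.
  by under eq_fun do rewrite expr2; apply: cvgM; exact: cmc.
have dF t : is_derive t (1 : R) F (f t).
  have H := is_derive1_comp (is_derive1_atan _) (is_deriveZ m (der_cos al t)).
  apply: is_derive_eq (is_deriveZ (- s) H) _.
  rewrite [LHS](_ : _ = - s * ((1 + (m * cos (al + t)) ^+ 2)^-1 * (m * - sin (al + t))))//.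
  by rewrite /f; field; exact: d0.
rewrite (@eq_integral _ _ _ mu _ (fun t => (f t)%:E)); last first.
  move=> t; rewrite inE /= in_itv /= => txy; congr EFin; rewrite /f.
  have := ss _ txy; have {s1}/eqP := s1; rewrite sqrf_eq1 => /orP[] /eqP ->.
    by rewrite mul1r => /ger0_norm ->.
  by rewrite mulN1r oppr_ge0 => /ler0_norm ->.
rewrite (continuous_FTC2_real xy cf dF) lee_fin /F.
have A t : `|atan t| <= pi / 2 :> R.
  by rewrite ler_norml; apply/andP; split; [exact/ltW/atan_gtNpi2|exact/ltW/atan_ltpi2].
have s11 : `|s| = 1 by apply/eqP; rewrite -sqrp_eq1// real_normK ?num_real// s1.
apply: le_trans (ler_norm _) _; apply: le_trans (ler_normB _ _) _.
by rewrite !normrM !normrN s11 !mul1r (splitr pi) lerD.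
Qed.

(** Four intervals of length pi on which the sine keeps its sign cover the period. *)
Lemma integral_peak_le (ph m : R) : 0 < m ->
  (\int[mu]_(t in `[0%R, (pi *+ 2)%R])
     (m * `|sin (ph + t)| / (1 + (m * cos (ph + t)) ^+ 2))%:E <= (pi *+ 4)%:E)%E.
Proof.
move=> m0.
(* The phase may be replaced by one in [-pi, pi] without changing the integrand. *)
have [al [al1 al2 alE]] : exists al : R, [/\ - pi <= al, al <= pi
    & forall t, sin (ph + t) = sin (al + t) /\ cos (ph + t) = cos (al + t)].
  have cs : -1 <= cos ph <= 1 by rewrite cos_geN1 cos_le1.
  have aE : cos (acos (cos ph)) = cos ph by rewrite acosK// in_itv.
  have a0 := acos_ge0 cs; have api := acos_lepi cs.
  have [s0|s0] := leP 0 (sin ph).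
    exists (acos (cos ph)); split=> // [|t].
      by apply: le_trans a0; rewrite oppr_le0 pi_ge0.
    have sE : sin (acos (cos ph)) = sin ph.
      by rewrite sin_acos// -sin2cos2 sqrtr_sqr ger0_norm.
    by rewrite !sinD !cosD aE sE.
  exists (- acos (cos ph)); split=> // [||t].
  - by rewrite lerN2.
  - by apply: (@le_trans _ _ 0); rewrite ?pi_ge0// oppr_le0.
  have sE : sin (- acos (cos ph)) = sin ph.
    by rewrite sinN sin_acos// -sin2cos2 sqrtr_sqr ltr0_norm// opprK.
  by rewrite !sinD !cosD cosN aE sE.
pose g t : R := m * `|sin (al + t)| / (1 + (m * cos (al + t)) ^+ 2).
have g0 t : 0 <= g t.
  by rewrite /g divr_ge0 ?addr_ge0 ?sqr_ge0// mulr_ge0// ltW.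
have mg : measurable_fun setT (EFin \o g).
  apply/measurable_EFinP; apply: continuous_measurable_fun => t.
  apply: cvgM.
    apply: cvgM; first exact: cvg_cst.
    by apply: cvg_norm; exact: cont_sin.
  apply: cvgV; first by rewrite gt_eqF// ltr_pwDl// sqr_ge0.
  apply: cvgD; first exact: cvg_cst.
  have cmc : continuous (fun t => m * cos (al + t)).
    by move=> u; apply: cvgM; [exact: cvg_cst|exact: cont_cos].
  by under eq_fun do rewrite expr2; apply: cvgM; exact: cmc.
have gE t : (m * `|sin (ph + t)| / (1 + (m * cos (ph + t)) ^+ 2))%:E = (EFin \o g) t.
  by have [-> ->] := alE t.
under eq_integral do rewrite gE.
(* Consecutive intervals share an endpoint, so subadditivity is used instead of additivity. *)
have sub A B : measurable A -> measurable B ->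
    (\int[mu]_(t in A `|` B) (EFin \o g) t <=
     \int[mu]_(t in A) (EFin \o g) t + \int[mu]_(t in B) (EFin \o g) t)%E.
  move=> mA mB.
  rewrite (_ : A `|` B = A `|` (B `\` A)); last first.
    by apply/seteqP; split=> t [] //=; [left|have [|] := pselect (A t); [left|right]|left|case=> ? _; right].
  have mBA : measurable (B `\` A) by exact: measurableD.
  rewrite ge0_integral_setU//; last 3 first.
  - exact: measurable_funTS.
  - by move=> t _; rewrite lee_fin.
  - by apply/disj_setPS => t [] ? [].
  apply: leeD => //; apply: ge0_subset_integral => //; first exact: measurable_funTS.
  by move=> t _; rewrite lee_fin.
(* These run between consecutive zeros of sin (al + t). As al lies in [-pi, pi], the first starts at
   or before 0 and the fourth ends at or after 2 pi. *)
pose P i : set R := `[pi *+ i - pi - al, pi *+ i - al]%classic.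
have mP i : measurable (P i) by exact: measurable_itv.
have sinDn i (x : R) : sin (x + pi *+ i) = (-1) ^+ i * sin x.
  elim: i => [|i IH]; first by rewrite addr0 expr0 mul1r.
  by rewrite mulrSr addrA sinDpi IH exprS mulN1r mulNr.
have piece i : (\int[mu]_(t in P i) (EFin \o g) t <= pi%:E)%E.
  apply: (@integral_peak_piece _ m _ _ ((-1) ^+ i.+1)) => //.
  - by rewrite ltrD2r ltrBlDr ltrDl pi_gt0.
  - by rewrite -exprM mulnC exprM sqrrN expr1n expr1n.
  move=> t /andP[t1 t2].
  have -> : al + t = (al + t - (pi *+ i - pi)) - pi + pi *+ i by ring.
  rewrite sinDn; set x := al + t - _.
  have -> : sin (x - pi) = - sin x by rewrite -[in RHS](subrK pi x) sinDpi opprK.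
  rewrite exprS mulN1r mulNr mulrN mulrN opprK mulrA -expr2 -exprM mulnC exprM sqrrN !expr1n mul1r.
  by apply: sin_ge0_pi; apply/andP; split; rewrite /x; move: (pi *+ i) t1 t2 => z *; lra.
have cover : `[0%R, (pi *+ 2)%R]%classic `<=` P 0%N `|` (P 1%N `|` (P 2%N `|` P 3%N)).
  move=> t; rewrite /P /setU /= !in_itv /= => /andP[t0 t2].
  have [h|h] := leP t (pi *+ 0 - al); [left|right].
    by apply/andP; split; rewrite // mulr0n; lra.
  have [h1|h1] := leP t (pi *+ 1 - al); [left|right].
    by apply/andP; split; rewrite // mulr1n; move: h; rewrite mulr0n; lra.
  have [h2|h2] := leP t (pi *+ 2 - al); [left|right].
    by apply/andP; split; rewrite // mulr2n; move: h1; rewrite mulr1n; lra.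
  by apply/andP; split; move: h2 t2; rewrite -?[pi *+ 3]/(pi + (pi + pi)) mulr2n; lra.
have mU3 : measurable (P 2%N `|` P 3%N) by exact: measurableU.
have mU2 : measurable (P 1%N `|` (P 2%N `|` P 3%N)) by exact: measurableU.
apply: (@le_trans _ _ (\int[mu]_(t in P 0%N `|` (P 1%N `|` (P 2%N `|` P 3%N))) (EFin \o g) t)%E).
  apply: ge0_subset_integral => //.
  - exact: (measurableU _ _ (mP _) mU2).
  - exact: measurable_funTS.
  - by move=> t _; rewrite lee_fin.
have -> : (pi *+ 4)%:E = (pi%:E + (pi%:E + (pi%:E + pi%:E)))%E :> \bar R.
  by rewrite -!EFinD; congr EFin; rewrite !mulrS mulr0n addr0.
apply: le_trans (sub _ _ (mP _) mU2) _; apply: leeD => //.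
apply: le_trans (sub _ _ (mP _) mU3) _; apply: leeD => //.
by apply: le_trans (sub _ _ (mP _) (mP _)) _; apply: leeD.
Qed.
End phase_integrals.

(** * Tonelli's theorem on a product of two measurable sets *)

Section tonelli_rectangle.
Context d1 d2 (T1 : measurableType d1) (T2 : measurableType d2) (R : realType).
Variables (m1 : {sigma_finite_measure set T1 -> \bar R}).
Variables (m2 : {sigma_finite_measure set T2 -> \bar R}).
Variables (D1 : set T1) (D2 : set T2) (g : T1 * T2 -> R).
Hypotheses (mD1 : measurable D1) (mD2 : measurable D2).
Hypotheses (mg : measurable_fun setT g) (g0 : forall x, 0 <= g x).

Let f := (EFin \o g) \_ (D1 `*` D2).

Let mf : measurable_fun setT f.
Proof.
apply/(measurable_restrictT _ (measurableX mD1 mD2)).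
exact/measurable_funTS/measurable_EFinP.
Qed.

Let f0 x : (0 <= f x)%E.
Proof. by rewrite /f patchE; case: ifP => // _; rewrite lee_fin. Qed.

Lemma tonelli_rectangle :
  (\int[m1]_(x in D1) \int[m2]_(y in D2) (g (x, y))%:E =
   \int[m2]_(y in D2) \int[m1]_(x in D1) (g (x, y))%:E)%E.
Proof.
have E1 x : (\int[m2]_y f (x, y) = ((fun x => \int[m2]_(y in D2) (g (x, y))%:E) \_ D1) x)%E.
  rewrite patchE; case: ifPn => xD1.
    rewrite [RHS]integral_mkcond; apply: eq_integral => y _.
    by rewrite /f !patchE in_setX xD1.
  by apply: integral0_eq => y _; rewrite /f patchE in_setX (negPf xD1).
have E2 y : (\int[m1]_x f (x, y) = ((fun y => \int[m1]_(x in D1) (g (x, y))%:E) \_ D2) y)%E.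
  rewrite patchE; case: ifPn => yD2.
    rewrite [RHS]integral_mkcond; apply: eq_integral => x _.
    by rewrite /f !patchE in_setX yD2 andbT.
  by apply: integral0_eq => x _; rewrite /f patchE in_setX (negPf yD2) andbF.
rewrite [LHS]integral_mkcond [RHS]integral_mkcond.
under eq_integral do rewrite -E1.
under [RHS]eq_integral do rewrite -E2.
exact: (@fubini_tonelli _ _ _ _ _ m1 m2 f mf f0).
Qed.

Lemma measurable_section_integral :
  measurable_fun D1 (fun x => \int[m2]_(y in D2) (g (x, y))%:E)%E.
Proof.
have H := @measurable_fun_fubini_tonelli_F _ _ _ _ _ m2 f mf f0.
apply/(measurable_restrictT _ mD1); apply: eq_measurable_fun H => x _.
rewrite /fubini_F patchE; case: ifPn => xD1.
  rewrite [RHS]integral_mkcond; apply: eq_integral => y _.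
  by rewrite /f !patchE in_setX xD1.
by apply: integral0_eq => y _; rewrite /f patchE in_setX (negPf xD1).
Qed.

Lemma measurable_section_integral_r :
  measurable_fun D2 (fun y => \int[m1]_(x in D1) (g (x, y))%:E)%E.
Proof.
have H := @measurable_fun_fubini_tonelli_G _ _ _ _ _ m1 f mf f0.
apply/(measurable_restrictT _ mD2); apply: eq_measurable_fun H => y _.
rewrite /fubini_G patchE; case: ifPn => yD2.
  rewrite [RHS]integral_mkcond; apply: eq_integral => x _.
  by rewrite /f !patchE in_setX yD2 andbT.
by apply: integral0_eq => x _; rewrite /f patchE in_setX (negPf yD2) andbF.
Qed.

End tonelli_rectangle.

Section measurability.
Context {d} {T : measurableType d} {R : realType}.
Implicit Types f g : T -> R.

Lemma measurable_inv_gt0 f : measurable_fun setT f -> (forall x, 0 < f x) ->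
  measurable_fun setT (fun x => (f x)^-1).
Proof.
move=> mf f0; rewrite (_ : (fun x => _) = (fun y => y `^ (-1)) \o f); last first.
  by apply/funext => x /=; rewrite powR_inv1// ltW.
exact: measurableT_comp (measurable_powR _) mf.
Qed.

Lemma measurable_sqrt_ge0 f : measurable_fun setT f -> (forall x, 0 <= f x) ->
  measurable_fun setT (fun x => Num.sqrt (f x)).
Proof.
move=> mf f0; rewrite (_ : (fun x => _) = (fun y => y `^ (2^-1)) \o f); last first.
  by apply/funext => x /=; rewrite powR12_sqrt.
exact: measurableT_comp (measurable_powR _) mf.
Qed.

Lemma measurable_sin_comp f : measurable_fun setT f -> measurable_fun setT (fun x => sin (f x)).
Proof.
move=> mf; apply: (measurableT_comp _ mf).
by apply: continuous_measurable_fun; exact: continuous_sin.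
Qed.

Lemma measurable_cos_comp f : measurable_fun setT f -> measurable_fun setT (fun x => cos (f x)).
Proof.
move=> mf; apply: (measurableT_comp _ mf).
by apply: continuous_measurable_fun; exact: continuous_cos.
Qed.

End measurability.

(** * Volume and curvature densities in the charts *)

Section densities.
Context {R : realType} {k : nat}.
Local Notation m := k.+1.
Local Notation n := m.+2.
Local Notation T := (n.-tuple (measurableTypeR R)).
Implicit Types (u : 'rV[R]_n) (th sg : R).

Definition dens_vol (a N sg th : R) u := lam u ^+ n * Num.sqrt (normal_sq a N th sg u).
Definition dens_curv (a N sg th : R) u := a ^+ n * `|second_det N th sg u|
  / (lam u ^+ n * Num.sqrt (normal_sq a N th sg u) ^+ n.+1).

(** * Measurability jointly in the phase and the point, for the Tonelli exchange *)

Section joint_measurability.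
Variables (a N sg : R).
Hypotheses (a0 : 0 < a) (sg1 : sg ^+ 2 = 1).
Local Notation P := (measurableTypeR R * T)%type.

Let mlam : measurable_fun setT (fun x : P => lam (row_of_tuple x.2)).
Proof.
rewrite /lam; apply: measurable_funM; first exact: measurable_cst.
apply: measurable_inv_gt0; last first.
  by move=> x; rewrite ltr_pwDl//; apply: sumr_ge0 => j _; rewrite -expr2 sqr_ge0.
apply: measurable_funD; first exact: measurable_cst.
exact: (measurableT_comp measurable_sumsq measurable_snd).
Qed.

Let mY : measurable_fun setT (fun x : P => stY sg (row_of_tuple x.2)).
Proof.
apply: measurable_funM; first exact: measurable_cst.
by apply: measurable_funB => //; exact: measurable_cst.
Qed.

Let mX : measurable_fun setT (fun x : P => stX ord0 (row_of_tuple x.2)).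
Proof.
apply: measurable_funM => //.
exact: (measurableT_comp (measurable_row_coord ord0) measurable_snd).
Qed.

Let mphase : measurable_fun setT (fun x : P => N * stX ord0 (row_of_tuple x.2) + x.1).
Proof.
apply: measurable_funD; last exact: measurable_fst.
by apply: measurable_funM => //; exact: measurable_cst.
Qed.

Let mS : measurable_fun setT (fun x : P => osc_sin N x.1 (row_of_tuple x.2)).
Proof. exact: measurable_sin_comp. Qed.

Let mC : measurable_fun setT (fun x : P => osc_cos N x.1 (row_of_tuple x.2)).
Proof. exact: measurable_cos_comp. Qed.

Let cst (r : R) : measurable_fun setT (fun _ : P => r).
Proof. exact: measurable_cst. Qed.

Let mnormal : measurable_fun setT (fun x : P => normal_sq a N x.1 sg (row_of_tuple x.2)).
Proof.
have me : measurable_fun setT (fun x : P => coef_e a N x.1 sg (row_of_tuple x.2)).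
  apply: measurable_funD => //; apply: measurable_funM => //; apply: measurable_funM => //.
  exact: measurable_funX.
have mq : measurable_fun setT (fun x : P => coef_q a N x.1 sg (row_of_tuple x.2)).
  apply: measurable_funM => //; apply: measurable_funM => //; apply: measurable_funM => //.
  exact: measurable_funX.
apply: measurable_funD; last by apply: measurable_funM; exact: measurable_funX.
apply: measurable_funB; last by do 4 (apply: measurable_funM => //).
apply: measurable_funD; first exact: measurable_funX.
apply: measurable_funM; first exact: measurable_funX.
by apply: measurable_funB => //; exact: measurable_funX.
Qed.

Let msqrt : measurable_fun setT (fun x : P => Num.sqrt (normal_sq a N x.1 sg (row_of_tuple x.2))).
Proof. by apply: measurable_sqrt_ge0 => // x; rewrite ltW// normal_sq_gt0. Qed.

Lemma measurable_dens_vol :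
  measurable_fun setT (fun x : P => dens_vol a N sg x.1 (row_of_tuple x.2)).
Proof. by apply: measurable_funM => //; exact: measurable_funX. Qed.

Lemma measurable_dens_curv :
  measurable_fun setT (fun x : P => dens_curv a N sg x.1 (row_of_tuple x.2)).
Proof.
have mL2 : measurable_fun setT (fun x : P => lam (row_of_tuple x.2) ^+ 2) by exact: measurable_funX.
have mY2 : measurable_fun setT (fun x : P => 1 - stY sg (row_of_tuple x.2) ^+ 2).
  by apply: measurable_funB => //; exact: measurable_funX.
have mX2 : measurable_fun setT (fun x : P => 1 - stX ord0 (row_of_tuple x.2) ^+ 2).
  by apply: measurable_funB => //; exact: measurable_funX.
have mal : measurable_fun setT (fun x : P => coef_al N x.1 sg (row_of_tuple x.2)).
  apply: measurable_funM; first exact: measurable_funN.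
  apply: measurable_funD => //; apply: measurable_funM => //; apply: measurable_funM => //.
  exact: measurable_funX.
have mbe : measurable_fun setT (fun x : P => coef_be N x.1 sg (row_of_tuple x.2)).
  by apply: measurable_funM => //; apply: measurable_funM => //; exact: measurable_funX.
have mga : measurable_fun setT (fun x : P => coef_ga N x.1 sg (row_of_tuple x.2)).
  apply: measurable_funM => //; apply: measurable_funM => //; apply: measurable_funM => //.
  exact: measurable_funX.
have mde : measurable_fun setT (fun x : P => coef_de N x.1 sg (row_of_tuple x.2)).
  apply: measurable_funM => //; apply: measurable_funM => //; apply: measurable_funN.
  exact: measurable_funX.
have mG2 : measurable_fun setT (fun x : P => - lam (row_of_tuple x.2) ^+ 2
    * stY sg (row_of_tuple x.2) * stX ord0 (row_of_tuple x.2)).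
  by apply: measurable_funM => //; apply: measurable_funM => //; exact: measurable_funN.
have mD : measurable_fun setT (fun x : P => second_det N x.1 sg (row_of_tuple x.2)).
  apply: measurable_funM; first exact: measurable_funX.
  apply: measurable_funD.
    apply: measurable_funD; first exact: measurable_funX.
    apply: measurable_funM => //; apply: measurable_funD.
      apply: measurable_funD; first by apply: measurable_funM => //; exact: measurable_funM.
      by apply: measurable_funM => //; exact: measurable_funM.
    by apply: measurable_funM => //; exact: measurable_funM.
  apply: measurable_funM.
    by apply: measurable_funB; [exact: measurable_funM|exact: measurable_funX].
  apply: measurable_funB; last exact: measurable_funX.
  by apply: measurable_funM; exact: measurable_funM.
apply: measurable_funM.
  by apply: measurable_funM => //; exact: (measurableT_comp (@normr_measurable R setT) mD).
apply: measurable_inv_gt0; last first.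
  by move=> x; rewrite mulr_gt0 ?exprn_gt0 ?lam_gt0 ?sqrtr_gt0 ?normal_sq_gt0.
by apply: measurable_funM; exact: measurable_funX.
Qed.

End joint_measurability.

Lemma dens_vol_ge0 a N sg th u : 0 <= dens_vol a N sg th u.
Proof. by rewrite mulr_ge0 ?sqrtr_ge0 ?exprn_ge0// ltW// lam_gt0. Qed.

Lemma dens_curv_ge0 a N sg th u : 0 <= a -> 0 <= dens_curv a N sg th u.
Proof.
move=> a0; have L0 := ltW (lam_gt0 u).
by apply: divr_ge0; apply: mulr_ge0 => //; apply: exprn_ge0.
Qed.

Section bounds.
Variables (c N sg : R).
Hypotheses (c0 : 0 < c) (c4 : c <= 4^-1) (Nc : N * c ^+ 9 = 1) (sg1 : sg ^+ 2 = 1).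
Local Notation a := (c ^+ 4).
Local Notation Y u := (stY sg u).
Local Notation X u := (stX ord0 u).
Local Notation S th u := (osc_sin N th u).
Local Notation C th u := (osc_cos N th u).
Local Notation r th u := (Num.sqrt (normal_sq a N th sg u)).

Let a0 : 0 < a. Proof. by rewrite exprn_gt0. Qed.

Let Y1 u : `|Y u| <= 1. Proof. exact: normr_stY_le1. Qed.

Let XY u : X u ^+ 2 <= 1 - Y u ^+ 2.
Proof.
rewrite -(sum_stX sg1) (bigD1 ord0)//= lerDl.
by apply: sumr_ge0 => j _; rewrite sqr_ge0.
Qed.

Let rE th u : r th u ^+ 2 = normal_sq a N th sg u.
Proof. by rewrite sqr_sqrtr// ltW// normal_sq_gt0. Qed.

Let r_ge0 th u : 0 <= r th u. Proof. exact: sqrtr_ge0. Qed.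
Let r_gt0 th u : 0 < r th u. Proof. by rewrite sqrtr_gt0 normal_sq_gt0. Qed.

Let e2 th u := coef_e_ge N th sg1 a0 u.
Let e38 th u := coef_e_le N th sg1 a0 u.
Let S1 th u : `|S th u| <= 1. Proof. exact: normr_osc_sin_le1. Qed.
Let C1 th u : `|C th u| <= 1. Proof. exact: normr_osc_cos_le1. Qed.

(** The single bound 306 serves for both |al| <= 152 and |be| <= 306 in [second_det_factor_le], and
    [al ^+ m] contributes the power. *)
Definition det_const : R := 306 ^+ m * (40 * 306 ^+ 2).
Definition peak_const : R := 3 * 2 ^+ n.+1 + 18 ^+ 2 * 4 + 5.
Definition curv_const : R := det_const * peak_const.

Lemma det_const_gt0 : 0 < det_const.
Proof.
apply: mulr_gt0; first by apply: exprn_gt0; rewrite ltr0n.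
by apply: mulr_gt0; [rewrite ltr0n|apply: exprn_gt0; rewrite ltr0n].
Qed.

Lemma peak_const_gt0 : 0 < peak_const.
Proof.
apply: addr_gt0; last by rewrite ltr0n.
apply: addr_gt0.
  by apply: mulr_gt0; [rewrite ltr0n|apply: exprn_gt0; rewrite ltr0n].
by apply: mulr_gt0; [apply: exprn_gt0; rewrite ltr0n|rewrite ltr0n].
Qed.

Lemma curv_const_gt0 : 0 < curv_const.
Proof. exact: mulr_gt0 det_const_gt0 peak_const_gt0. Qed.

Let YS_le1 th u : `|Y u ^+ 17 * S th u| <= 1.
Proof.
by rewrite normrM normrX mulr_ile1// ?exprn_ge0 ?exprn_ile1.
Qed.

Let al_bounds th u : 1 <= lam u -> 2 <= `|coef_al N th sg u| <= 152.
Proof.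
move=> L1; have L2 := lam_le2 u; have := YS_le1 th u.
rewrite ler_norml /coef_al mulNr normrN -(mulrA 18); move: (_ * S th u) => w /andP[w1 w2].
have LL : 1 <= lam u ^+ 2 <= 4 by rewrite expr2; apply/andP; split; nra.
have w0 : 2 <= 20 + 18 * w <= 38 by apply/andP; split; lra.
have w00 : 0 <= 20 + 18 * w by lra.
move: LL w0 w00; move: (lam u ^+ 2) (20 + 18 * w) => x y /andP[x1 x4] /andP[y2 y38] y0.
have x0 : 0 <= x by lra.
rewrite ger0_norm ?mulr_ge0//; apply/andP; split.
  by rewrite -[leLHS]mul1r ler_pM.
by have -> : 152 = 4 * 38 :> R; [rewrite -natrM|rewrite ler_pM].
Qed.

Let be_bound th u : `|coef_be N th sg u| <= 306.
Proof.
rewrite /coef_be -mulrA normrM (ger0_norm (ler0n _ 306)) -[leRHS]mulr1.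
exact: ler_wpM2l (ler0n _ 306) _ _ (YS_le1 th u).
Qed.

Let lam02 u : 0 <= lam u <= 2.
Proof. by rewrite ltW ?lam_gt0// lam_le2. Qed.

Lemma dens_curv_le th u : 1 <= lam u ->
  dens_curv a N sg th u <= curv_const * c ^- 4 * (1 + peak a N (Y u) (S th u) (C th u)).
Proof.
move=> L1; rewrite /dens_curv.
have L1n : 1 <= lam u ^+ n by rewrite exprn_ege1.
have L0 := lam_gt0 u.
have dp : 0 < lam u ^+ n * r th u ^+ n.+1.
  by apply: mulr_gt0; apply: exprn_gt0; rewrite ?r_gt0.
rewrite (ler_pdivrMr _ _ dp).
set p := peak _ _ _ _ _.
have H := curvature_density_le k c0 c4 Nc (XY u) (S1 th u) (C1 th u)
  (e2 th u) (e38 th u) (r_ge0 th u) (rE th u).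
rewrite -/p in H.
have p0 : 0 <= p.
  apply: peak_ge0; first exact: ltW.
  by rewrite -(pmulr_lge0 _ (exprn_gt0 9 c0)) Nc.
have h : `|coef_al N th sg u| <= 306.
  by have /andP[_ h] := al_bounds th L1; apply: le_trans h _; rewrite ler_nat.
have D : `|second_det N th sg u| <= det_const
    * (1 + coef_ga N th sg u ^+ 2 + `|coef_de N th sg u|).
  rewrite /second_det normrM normrX /det_const -[leRHS]mulrA.
  apply: ler_pM => //.
    by rewrite lerXn2r ?nnegrE ?ler0n.
  apply: second_det_factor_le => //; first by rewrite (ler_nat _ 1).
rewrite -/peak_const in H; have A0 := ltW det_const_gt0; have B0 := ltW peak_const_gt0.
rewrite /curv_const; move: det_const peak_const A0 B0 H D => A B A0 B0 H D.
set G := 1 + _ + _ in D.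
have D1 : a ^+ n * `|second_det N th sg u| <= A * (a ^+ n * G).
  by rewrite mulrCA ler_wpM2l// exprn_ge0// ltW.
apply: le_trans D1 _.
have H1 : a ^+ n * G <= c ^- 4 * (B * (1 + p) * r th u ^+ n.+1).
  by rewrite ler_pdivlMl// mulrA.
apply: le_trans (ler_wpM2l A0 H1) _.
have -> : A * B * c ^- 4 * (1 + p) * (lam u ^+ n * r th u ^+ n.+1)
   = (A * (c ^- 4 * (B * (1 + p) * r th u ^+ n.+1))) * lam u ^+ n.
  by move: (c ^- 4) (r th u ^+ n.+1) (lam u ^+ n) => *; ring.
apply: ler_peMr L1n; apply: mulr_ge0 => //; apply: mulr_ge0.
  by rewrite invr_ge0 ltW.
apply: mulr_ge0; last by rewrite exprn_ge0.
by apply: mulr_ge0 => //; rewrite addr_ge0.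
Qed.

Lemma dens_curv_le_cst th u : 1 <= lam u ->
  dens_curv a N sg th u <= curv_const * c ^- 4 * (1 + a * N).
Proof.
move=> L1; apply: le_trans (dens_curv_le th L1) _.
apply: ler_wpM2l.
  by apply: mulr_ge0; [exact: ltW curv_const_gt0|rewrite invr_ge0 ltW].
by rewrite lerD2l; apply: peak_le.
Qed.

Lemma dens_vol_le th u :
  dens_vol a N sg th u <= 2 ^+ n * (1 + 2 * (38 * a) ^+ 2 + 2 * (a * N) ^+ 2).
Proof.
have L0 := lam_gt0 u.
apply: ler_pM => //; first by rewrite exprn_ge0// ltW.
  by rewrite lerXn2r ?nnegrE ?ler0n ?lam_le2// ltW.
by have := normal_upper c0 (Y1 u) (XY u) (C1 th u) (e2 th u) (e38 th u) (r_ge0 th u) (rE th u).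
Qed.

Lemma dens_vol_pole th u : 1 <= lam u -> 2^-1 <= `|Y u| ->
  2 ^- 20 * (a * N) * C th u ^+ 2 - 38 * a <= dens_vol a N sg th u.
Proof.
move=> L1 Y2.
have H := normal_lower_pole c0 Nc (XY u) (C1 th u) (e2 th u) (e38 th u) (r_ge0 th u) (rE th u) Y2.
apply: le_trans H _; rewrite /dens_vol; apply: ler_peMl => //.
by rewrite exprn_ege1.
Qed.

Definition equator_const : R :=
  a ^+ n / (2 ^+ n * (1 + 2 * (38 * a) ^+ 2 + 2 * (a * N) ^+ 2) ^+ n.+1).

Lemma equator_const_gt0 : 0 < equator_const.
Proof.
rewrite divr_gt0 ?exprn_gt0// mulr_gt0 ?exprn_gt0//.
by rewrite -addrA ltr_pwDl// addr_ge0// mulr_ge0 ?sqr_ge0.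
Qed.

Lemma dens_curv_equator th u : 1 <= lam u -> `|Y u| <= c ^+ 2 ->
  equator_const <= dens_curv a N sg th u.
Proof.
move=> L1 Yc; have L0 := lam_gt0 u.
have [b1 g1 d1] := coef_small_equator c0 c4 Nc (S1 th u) (C1 th u) Yc.
have dd : 0 <= (10 ^- 3 : R) <= 1.
  by rewrite invr_ge0 exprn_ge0//= invf_le1 ?exprn_gt0// -natrX ler1n.
have D1 : 1 <= `|second_det N th sg u|.
  rewrite /second_det normrM; apply: mulr_ege1.
    rewrite normrX exprn_ege1//; have /andP[h _] := al_bounds th L1.
    by apply: le_trans h; rewrite ler1n.
  apply: le_trans (second_det_factor_ge dd (al_bounds th L1) b1 g1 d1 (lam02 u) (XY u)).
  (* The tolerance 10^-3 in [coef_small_equator] is chosen so that the lower bound keeps at least 4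
     - 3 = 1. *)
  have : (16 * 152 + 64) * 10 ^- 3 <= 3 :> R.
    by rewrite ler_pdivrMr ?exprn_gt0// -natrX -!natrM -natrD ler_nat.
  by move: (_ * 10 ^- 3) => x; lra.
rewrite /equator_const /dens_curv.
apply: ler_pM.
- by rewrite exprn_ge0// ltW.
- rewrite invr_ge0 mulr_ge0// ?exprn_ge0//.
  by rewrite -addrA addr_ge0// addr_ge0// mulr_ge0 ?sqr_ge0.
- by apply: ler_peMr => //; rewrite exprn_ge0// ltW.
- have r0 := r_gt0 th u.
  have rle := normal_upper c0 (Y1 u) (XY u) (C1 th u) (e2 th u) (e38 th u) (r_ge0 th u) (rE th u).
  rewrite lef_pV2 ?posrE.
  + apply: ler_pM; rewrite ?exprn_ge0//; first exact: ltW.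
      by rewrite lerXn2r ?nnegrE ?ler0n ?lam_le2// ltW.
    by rewrite lerXn2r ?nnegrE//; apply: le_trans rle.
  + by rewrite mulr_gt0 ?exprn_gt0// (lt_le_trans r0).
  + by rewrite mulr_gt0 ?exprn_gt0.
Qed.

End bounds.
End densities.

(** * Integrals over the hemispheres and the choice of the phase *)

Section total_integrals.
Context {R : realType} {k : nat}.
Local Notation m := k.+1.
Local Notation n := m.+2.
Local Notation Rm := (measurableTypeR R).
Local Notation T := (n.-tuple Rm).
Local Notation lambda := (@lebesgue_measure R : {sigma_finite_measure set Rm -> \bar R}).
Local Notation mu := (@lebesgue_Rn R n).
Local Notation I := (`[0%R, (pi *+ 2)%R]%classic : set Rm).
Local Notation H i := (row_of_tuple @^-1` @hemi R m i : set T).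

Lemma lam_hemi_ge1 i (u : 'rV[R]_n) : hemi i u -> 1 <= lam u.
Proof. by case: i => [|[|//]] /=; rewrite lam_ge1// => /ltW. Qed.

Definition box (x y : nat -> R) : set T :=
  [set t | forall i : 'I_n, tnth t i \in `[x i, y i]].

Lemma measurable_box x y : measurable (box x y).
Proof.
rewrite (_ : box x y = \bigcap_(i in [set: 'I_n]) ((@tnth n Rm)^~ i @^-1` `[x i, y i]%classic)).
  apply: fin_bigcap_measurable => // i _; rewrite -[X in measurable X]setTI.
  by apply: measurable_tnth => //; exact: measurable_itv.
by apply/seteqP; split=> t /= h i; [move=> _|]; apply: h.
Qed.

Lemma lebesgue_box x y : (forall i, x i < y i) ->
  mu (box x y) = (\prod_(i < n) (y i - x i))%:E.
Proof.
move=> xy; have := @lebesgue_Rn_box R n (fun i => `[x i, y i]%classic) (fun=> measurable_itv _).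
rewrite -prodEFin => h; rewrite [LHS]h; apply: eq_bigr => i _.
by rewrite [LHS](lebesgue_measure_itv `[x i, y i]) /= lte_fin xy.
Qed.

Lemma hemi_sub_box i : H i `<=` box (fun=> -1) (fun=> 1).
Proof.
move=> t Ht j; have h : \sum_l row_of_tuple t 0 l * row_of_tuple t 0 l <= 1.
  by case: i Ht => [|[|//]] /=; last move=> /ltW.
have : (tnth t j) ^+ 2 <= 1.
  apply: le_trans h; rewrite (bigD1 j)//= mxE expr2 lerDl.
  by apply: sumr_ge0 => l _; rewrite -expr2 sqr_ge0.
rewrite in_itv /= -ler_norml -[_ ^+ 2]real_normK ?num_real// => h2.
by rewrite -[leRHS]normr1 -ler_sqr ?nnegrE// normr1 expr1n.
Qed.

Lemma lebesgue_hemi_le i : (mu (H i) <= (2 ^+ n)%:E)%E.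
Proof.
apply: (@le_trans _ _ (mu (box (fun=> -1) (fun=> 1)))).
  apply: le_measure; rewrite ?inE; [exact: measurable_hemi|exact: measurable_box|].
  exact: hemi_sub_box.
rewrite lebesgue_box => [|j]; last by rewrite gtrN.
by rewrite prodr_const card_ord opprK.
Qed.

Section parameters.
Variables (c N : R).
Hypotheses (c0 : 0 < c) (c16 : c <= 16^-1) (Nc : N * c ^+ 9 = 1).
Local Notation a := (c ^+ 4).

Let a0 : 0 < a. Proof. by rewrite exprn_gt0. Qed.
Let c4 : c <= 4^-1.
Proof. by apply: le_trans c16 _; rewrite lef_pV2 ?posrE// ler_nat. Qed.
Let N0 : 0 < N. Proof. by rewrite -(pmulr_lgt0 _ (exprn_gt0 9 c0)) Nc. Qed.

Definition hemi_vol i (th : R) : \bar R :=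
  (\int[mu]_(t in H i) (dens_vol a N (hemi_sign i : R) th (row_of_tuple t))%:E)%E.
Definition hemi_curv i (th : R) : \bar R :=
  (\int[mu]_(t in H i) (dens_curv a N (hemi_sign i : R) th (row_of_tuple t))%:E)%E.

Let sg1 i := @sqr_hemi_sign R i.
Let mH i : measurable (H i) := @measurable_hemi R m i.

Let mvol i : measurable_fun setT (fun x : Rm * T => dens_vol a N (hemi_sign i : R) x.1 (row_of_tuple x.2)).
Proof. exact: measurable_dens_vol. Qed.
Let mcurv i : measurable_fun setT (fun x : Rm * T => dens_curv a N (hemi_sign i : R) x.1 (row_of_tuple x.2)).
Proof. exact: measurable_dens_curv. Qed.

Let mpair (th : R) : measurable_fun setT (fun t : T => (th, t) : Rm * T).
Proof. exact: measurable_pair1. Qed.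

Let mvol_t i th : measurable_fun setT (fun t : T => (dens_vol a N (hemi_sign i : R) th (row_of_tuple t))%:E).
Proof. by apply/measurable_EFinP; exact: (measurableT_comp (mvol i) (mpair th)). Qed.
Let mcurv_t i th : measurable_fun setT (fun t : T => (dens_curv a N (hemi_sign i : R) th (row_of_tuple t))%:E).
Proof. by apply/measurable_EFinP; exact: (measurableT_comp (mcurv i) (mpair th)). Qed.

Let integral_le_cst i (f : T -> R) (K : R) : 0 <= K -> measurable_fun setT (EFin \o f) ->
  (forall t, H i t -> 0 <= f t <= K) -> (\int[mu]_(t in H i) (f t)%:E <= (K * 2 ^+ n)%:E)%E.
Proof.
move=> K0 mf fK; apply: (@le_trans _ _ (\int[mu]_(t in H i) (cst K%:E t))%E).
  apply: ge0_le_integral => //.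
  - by move=> t /fK /andP[]; rewrite lee_fin.
  - exact: measurable_funTS.
  - by move=> t /fK /andP[]; rewrite lee_fin.
rewrite integral_cst// EFinM; apply: lee_wpmul2l; first by rewrite lee_fin.
exact: lebesgue_hemi_le.
Qed.

Lemma hemi_vol_fin i th : exists2 v : R, 0 <= v & hemi_vol i th = v%:E.
Proof.
have h : (hemi_vol i th <= (2 ^+ n * (1 + 2 * (38 * a) ^+ 2 + 2 * (a * N) ^+ 2) * 2 ^+ n)%:E)%E.
  apply: integral_le_cst => //.
    have := dens_vol_le N c0 (sg1 0) 0 (0 : 'rV[R]_n).
    by apply: le_trans; exact: dens_vol_ge0.
    exact: mvol_t.
  by move=> t _; rewrite dens_vol_ge0; exact: dens_vol_le.
have h0 : (0 <= hemi_vol i th)%E.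
  by apply: integral_ge0 => t _; rewrite lee_fin dens_vol_ge0.
exists (fine (hemi_vol i th)); first exact: fine_ge0.
by rewrite fineK// ge0_fin_numE// (le_lt_trans h)// ltry.
Qed.

Lemma hemi_curv_fin i th : exists2 v : R, 0 <= v & hemi_curv i th = v%:E.
Proof.
have h : (hemi_curv i th <= (@curv_const R k * c ^- 4 * (1 + a * N) * 2 ^+ n)%:E)%E.
  apply: integral_le_cst => //.
    apply: mulr_ge0; last by rewrite addr_ge0// mulr_ge0// ltW.
    by apply: mulr_ge0; [exact: ltW (@curv_const_gt0 R k)|rewrite invr_ge0 ltW].
    exact: mcurv_t.
  move=> t Ht; rewrite dens_curv_ge0 ?(ltW a0)//=.
  by apply: dens_curv_le_cst => //; exact: lam_hemi_ge1 Ht.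
have h0 : (0 <= hemi_curv i th)%E.
  by apply: integral_ge0 => t _; rewrite lee_fin dens_curv_ge0// ltW.
exists (fine (hemi_curv i th)); first exact: fine_ge0.
by rewrite fineK// ge0_fin_numE// (le_lt_trans h)// ltry.
Qed.

Let integral_box_ge i x y (f : T -> R) (K : R) : (forall j, x j < y j) -> box x y `<=` H i ->
  measurable_fun setT (EFin \o f) ->
  0 <= K -> (forall t, H i t -> 0 <= f t) -> (forall t, box x y t -> K <= f t) ->
  ((K * \prod_(j < n) (y j - x j))%:E <= \int[mu]_(t in H i) (f t)%:E)%E.
Proof.
move=> xy bH mf K0 f0 fK; apply: (@le_trans _ _ (\int[mu]_(t in box x y) (f t)%:E)%E); last first.
  apply: ge0_subset_integral => //; first exact: measurable_box.
    exact: measurable_funTS.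
rewrite EFinM -lebesgue_box// -integral_cst; last exact: measurable_box.
apply: ge0_le_integral => //; first exact: measurable_box.
exact: measurable_funTS.
Qed.

(** It suffices to find a box of positive measure inside the strip |Y| <= c^2. The box chosen is
    thin in the first coordinate and small in the others, so that 1 - c^2 <= |u|^2 <= 1. *)
Lemma hemi_curv_gt0 th : (0 < hemi_curv 0 th)%E.
Proof.
pose x i := if i is 0%N then 1 - c ^+ 2 / 2 else 0.
pose y i := if i is 0%N then 1 - c ^+ 2 / 4 else c / (2 * n%:R).
have c20 : 0 < c ^+ 2 by rewrite exprn_gt0.
have n0 : 0 < n%:R :> R by rewrite ltr0n.
have c2le : c ^+ 2 <= 1 by rewrite exprn_ile1 ?(ltW c0)//; apply: le_trans c4 _; lra.
have xy j : x j < y j.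
  by case: j => [|j] /=; [lra|rewrite divr_gt0// mulr_gt0].
have key t : box x y t -> 1 - c ^+ 2 <= \sum_j row_of_tuple t 0 j * row_of_tuple t 0 j <= 1.
  move=> bt; rewrite (bigD1 ord0)//=.
  have := bt ord0; rewrite in_itv /= mxE => /andP[t1 t2].
  have s1 : 0 <= \sum_(i < n | i != ord0) row_of_tuple t 0 i * row_of_tuple t 0 i <= c ^+ 2 / 4.
    apply/andP; split; first by apply: sumr_ge0 => j _; rewrite -expr2 sqr_ge0.
    apply: (@le_trans _ _ (\sum_(i < n) (c ^+ 2 / (4 * n%:R)))); last first.
      by rewrite sumr_const card_ord -[_ *+ n]mulr_natr invfM mulrA divfK ?gt_eqF.
    rewrite [leRHS](bigD1 ord0)//=; apply: le_trans (_ : \sum_(i < n | i != ord0) (c ^+ 2 / (4 * n%:R)) <= _); last first.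
      by rewrite lerDr divr_ge0 ?(ltW c20)// mulr_ge0// ltW.
    apply: ler_sum => j j0; have := bt j; rewrite in_itv mxE /=.
    case: j j0 => -[|j] //= jn _ /andP[h1 h2].
    apply: (@le_trans _ _ (c / (2 * n%:R) * (c / (2 * n%:R)))); first by rewrite ler_pM.
    rewrite mulrACA -expr2 -invfM ler_wpM2l ?(ltW c20)// lef_pV2 ?posrE ?mulr_gt0//.
    by rewrite -!natrM ler_nat mulnACA leq_mul// leq_pmulr.
  move: s1 => /andP[s1 s3]; move: (\sum_(_ < _ | _) _) s1 s3 => z z0 zc.
  move: (tnth t ord0) t1 t2 => v t1 t2; by apply/andP; split; nra.
have lam1 t : box x y t -> 1 <= lam (row_of_tuple t).
  by move=> /key /andP[_]; rewrite lam_ge1.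
apply: (@lt_le_trans _ _ ((@equator_const R k c N * \prod_(j < n) (y j - x j))%:E)).
  rewrite lte_fin; apply: mulr_gt0; first exact: equator_const_gt0.
  by apply: prodr_gt0 => j _; rewrite subr_gt0.
apply: integral_box_ge => //.
- by move=> t /key /andP[].
- exact: mcurv_t.
- exact/ltW/equator_const_gt0.
- by move=> t _; rewrite dens_curv_ge0// ltW.
move=> t bt; apply: dens_curv_equator => //; first exact: lam1.
have L1 := lam1 _ bt; rewrite /stY mul1r ger0_norm ?subr_ge0//.
have /andP[h _] := key _ bt; have := sumsq_lam (row_of_tuple t).
move=> E; rewrite E in h; move: h.
move=> h; have L0 := lam_gt0 (row_of_tuple t).
have h2 : (2 - c ^+ 2) * lam (row_of_tuple t) <= 2 by rewrite -ler_pdivlMr//; lra.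
have : 0 <= c ^+ 2 * (2 - lam (row_of_tuple t)) by rewrite mulr_ge0 ?subr_ge0 ?lam_le2// ltW.
by move: (lam _) (c ^+ 2) h2 => L d h2; rewrite mulrBl mulrBr in h2 *; lra.
Qed.

Let mI : measurable I. Proof. exact: measurable_itv. Qed.

Let pi2_gt0 : 0 < pi *+ 2 :> R. Proof. by rewrite pmulrn_lgt0// pi_gt0. Qed.

Let muI : lambda I = (pi *+ 2)%:E.
Proof. by rewrite [LHS](lebesgue_measure_itv `[0%R, (pi *+ 2)%R]) /= lte_fin pi2_gt0 sube0. Qed.

Let integral_cstI (r : R) : (\int[lambda]_(th in I) r%:E = (r * (pi *+ 2))%:E)%E.
Proof. by rewrite [LHS](integral_cst lambda mI) EFinM -muI. Qed.

(** The amplitude b vanishes on the equator, which [integral_peak_le] does not cover. *)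
Let integral_peak_phase (ph b : R) : 0 <= b ->
  (\int[lambda]_(th in I)
    (b * `|sin (ph + th)| / (1 + (b * cos (ph + th)) ^+ 2))%:E <= (pi *+ 4)%:E)%E.
Proof.
rewrite le_eqVlt => /predU1P[<-|]; last exact: integral_peak_le.
under eq_integral do rewrite mul0r mul0r.
by rewrite integral0 lee_fin mulrn_wge0// pi_ge0.
Qed.

Let mphase (ph : R) : measurable_fun setT (fun th : Rm => ph + th).
Proof. by apply: measurable_funD; [exact: measurable_cst|exact: measurable_id]. Qed.

Let mpeak (ph b : R) : measurable_fun setT
  (fun th : Rm => b * `|sin (ph + th)| / (1 + (b * cos (ph + th)) ^+ 2)).
Proof.
apply: measurable_funM.
  apply: measurable_funM; first exact: measurable_cst.
  exact: (measurableT_comp (@normr_measurable R setT) (measurable_sin_comp (mphase ph))).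
apply: measurable_inv_gt0; last by move=> x; rewrite ltr_pwDl ?sqr_ge0.
apply: measurable_funD; first exact: measurable_cst.
apply: measurable_funX; apply: measurable_funM; first exact: measurable_cst.
exact: measurable_cos_comp.
Qed.

Let Kc := @curv_const R k * c ^- 4.
Let Kc_ge0 : 0 <= Kc.
Proof. by apply: mulr_ge0; [exact: ltW (@curv_const_gt0 R k)|rewrite invr_ge0 ltW]. Qed.

Let mpair2 (t : T) : measurable_fun setT (fun th : Rm => (th, t) : Rm * T).
Proof. exact: measurable_pair2. Qed.

Let mcurv_th i (t : T) : measurable_fun setT
  (fun th : Rm => (dens_curv a N (hemi_sign i : R) th (row_of_tuple t))%:E).
Proof. by apply/measurable_EFinP; exact: (measurableT_comp (mcurv i) (mpair2 t)). Qed.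
Let mvol_th i (t : T) : measurable_fun setT
  (fun th : Rm => (dens_vol a N (hemi_sign i : R) th (row_of_tuple t))%:E).
Proof. by apply/measurable_EFinP; exact: (measurableT_comp (mvol i) (mpair2 t)). Qed.

(** In 6 pi, the constant 1 accounts for 2 pi and the peak for 4 pi. *)
Let integral_phase_curv i (t : T) : H i t ->
  (\int[lambda]_(th in I) (dens_curv a N (hemi_sign i) th (row_of_tuple t))%:E
   <= (Kc * pi *+ 6)%:E)%E.
Proof.
move=> Ht; set u := row_of_tuple t.
pose b := a * stY (hemi_sign i) u ^+ 18 * N.
pose ph := N * stX ord0 u.
have b0 : 0 <= b.
  by apply: mulr_ge0 (ltW N0); apply: mulr_ge0 (ltW a0) _; rewrite exprn_even_ge0.
pose p th := b * `|sin (ph + th)| / (1 + (b * cos (ph + th)) ^+ 2).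
have p0 th : 0 <= p th.
  apply: divr_ge0; first exact: mulr_ge0.
  by rewrite addr_ge0 ?sqr_ge0.
apply: (@le_trans _ _ (\int[lambda]_(th in I) (Kc%:E * (1%:E + (p th)%:E)))%E).
  apply: ge0_le_integral => //.
  - by move=> th _; rewrite lee_fin dens_curv_ge0// ltW.
  - exact: measurable_funTS (mcurv_th i t).
  - apply: measurable_funTS; apply/measurable_EFinP.
    apply: measurable_funM; first exact: measurable_cst.
    by apply: measurable_funD; [exact: measurable_cst|exact: mpeak].
  - move=> th _; rewrite -EFinD -EFinM lee_fin.
    exact: dens_curv_le c0 c4 Nc (sg1 i) th u (lam_hemi_ge1 Ht).
rewrite ge0_integralZl_EFin//; last 2 first.
- by move=> th _; rewrite -EFinD lee_fin addr_ge0.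
- apply: measurable_funTS; apply/measurable_EFinP.
  by apply: measurable_funD; [exact: measurable_cst|exact: mpeak].
rewrite ge0_integralD//; last 2 first.
- by move=> th _; rewrite lee_fin.
- by apply: measurable_funTS; apply/measurable_EFinP; exact: mpeak.
rewrite [X in (_ * (X + _))%E]integral_cstI mul1r -mulrnAr (EFinM Kc (pi *+ 6)).
apply: lee_wpmul2l; first by rewrite lee_fin.
have -> : pi *+ 6 = pi *+ 2 + pi *+ 4 :> R by rewrite -mulrnDr.
rewrite (EFinD (pi *+ 2)); apply: leeD => //.
exact: integral_peak_phase.
Qed.

(** Exchanging the integrals puts the phase inside, where the bound is uniform in the point. *)
Lemma integral_hemi_curv i :
  (\int[lambda]_(th in I) hemi_curv i th <= (Kc * pi *+ 6 * 2 ^+ n)%:E)%E.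
Proof.
pose g (x : Rm * T) := dens_curv a N (hemi_sign i : R) x.1 (row_of_tuple x.2).
have g0 x : 0 <= g x by rewrite dens_curv_ge0// ltW.
rewrite /hemi_curv (tonelli_rectangle lambda mu mI (mH i) (mcurv i) g0).
apply: (@le_trans _ _ (\int[mu]_(t in H i) cst (Kc * pi *+ 6)%:E t)%E).
  apply: ge0_le_integral => //.
  - by move=> t _; apply: integral_ge0 => th _; rewrite lee_fin; exact: (g0 (th, t)).
  - exact: (measurable_section_integral_r lambda mI (mH i) (mcurv i) g0).
  - by move=> t Ht; exact: integral_phase_curv.
have K0 : 0 <= Kc * pi *+ 6 by rewrite mulrn_wge0// mulr_ge0// pi_ge0.
rewrite integral_cst// EFinM; apply: lee_wpmul2l; first by rewrite lee_fin.
exact: lebesgue_hemi_le.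
Qed.

Let n0 : 0 < n%:R :> R. Proof. by rewrite ltr0n. Qed.
(** A cube of side 1 / n about the pole: on it |u|^2 <= 1 / 4, hence Y >= 3 / 5, and its volume is
    n^-n. *)
Let pb (i : nat) : R := - (2 * n%:R)^-1.
Let qb (i : nat) : R := (2 * n%:R)^-1.

Let pole_box (t : T) : box pb qb t ->
  1 <= lam (row_of_tuple t) /\ 2^-1 <= stY 1 (row_of_tuple t).
Proof.
move=> bt.
have s4 : \sum_j row_of_tuple t 0 j * row_of_tuple t 0 j <= 4^-1.
  apply: (@le_trans _ _ (\sum_(j < n) (4 * n%:R)^-1)); last first.
    by rewrite sumr_const card_ord -[_ *+ n]mulr_natr invfM mulfVK// gt_eqF.
  apply: ler_sum => j _; have := bt j; rewrite in_itv mxE /= -ler_norml => h.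
  rewrite -expr2 -real_normK ?num_real//.
  apply: (@le_trans _ _ ((2 * n%:R)^-1 ^+ 2)).
    by rewrite lerXn2r ?nnegrE// invr_ge0 mulr_ge0// ltW.
  rewrite exprVn lef_pV2 ?posrE ?exprn_gt0 ?mulr_gt0//.
  by rewrite expr2 -!natrM ler_nat mulnACA leq_mul// leq_pmulr.
have := sumsq_lam (row_of_tuple t); have L0 := lam_gt0 (row_of_tuple t) => E.
rewrite E in s4; have h : 2 / lam (row_of_tuple t) <= 5 / 4 by lra.
move: h; rewrite ler_pdivrMr// /stY mul1r => h.
by split; lra.
Qed.

Lemma integral_hemi_vol :
  (((2 ^- 20 * (a * N) * pi - 38 * a * (pi *+ 2)) * n%:R ^- n)%:E
    <= \int[lambda]_(th in I) hemi_vol 0 th)%E.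
Proof.
pose g (x : Rm * T) := dens_vol a N (hemi_sign 0 : R) x.1 (row_of_tuple x.2).
have g0 x : 0 <= g x by rewrite dens_vol_ge0.
rewrite /hemi_vol (tonelli_rectangle lambda mu mI (mH 0) (mvol 0) g0).
have bH : box pb qb `<=` H 0.
  by move=> t /pole_box[]; rewrite lam_ge1.
have mb : measurable (box pb qb) by exact: measurable_box.
have pbqb i : pb i < qb i by rewrite gtrN// invr_gt0 mulr_gt0.
have mub : mu (box pb qb) = (n%:R ^- n)%:E.
  rewrite lebesgue_box// (eq_bigr (fun=> n%:R^-1)) => [|i _].
    by rewrite prodr_const card_ord exprVn.
  by rewrite /pb /qb opprK; have := n0; move: (n%:R : R) => z z0; field; rewrite gt_eqF.
set B := _ - _.
apply: (@le_trans _ _ (\int[mu]_(t in box pb qb) cst B%:E t)%E).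
  by rewrite [leRHS](integral_cst mu mb) EFinM -mub.
have mG := measurable_section_integral_r lambda mI (mH 0) (mvol 0) g0.
have inner t : box pb qb t -> (B%:E <= \int[lambda]_(th in I) (g (th, t))%:E)%E.
  move=> bt; have [L1 Y2] := pole_box bt; set u := row_of_tuple t in L1 Y2.
  (* The subtracted constant changes sides so that only nonnegative functions are integrated. *)
  rewrite EFinB leeBlDr//.
  rewrite -integral_cstI.
  rewrite -ge0_integralD//; last 3 first.
  - by move=> th _; rewrite lee_fin.
  - exact: measurable_funTS (mvol_th 0 t).
  - by move=> th _; rewrite lee_fin mulr_ge0// ltW.
  have -> : (2 ^- 20 * (a * N) * pi)%:E =
      (\int[lambda]_(th in I) ((2 ^- 20 * (a * N))%:E * (cos (N * stX ord0 u + th) ^+ 2)%:E))%E.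
    rewrite ge0_integralZl_EFin//.
    - by rewrite integral_cos_sqr -EFinM.
    - by move=> th _; rewrite lee_fin sqr_ge0.
    - apply: measurable_funTS; apply/measurable_EFinP; apply: measurable_funX.
      exact: measurable_cos_comp.
    - by rewrite mulr_ge0 ?invr_ge0 ?exprn_ge0// mulr_ge0// ltW.
  apply: ge0_le_integral => //.
  - by move=> th _; rewrite -EFinM lee_fin mulr_ge0 ?sqr_ge0// mulr_ge0 ?invr_ge0 ?exprn_ge0// mulr_ge0// ltW.
  - apply: measurable_funTS; apply/measurable_EFinP; apply: measurable_funM; first exact: measurable_cst.
    by apply: measurable_funX; exact: measurable_cos_comp.
  - apply: measurable_funTS; apply: emeasurable_funD; first exact: (mvol_th 0 t).
    exact: measurable_cst.
  - move=> th _; rewrite -EFinM -EFinD lee_fin -lerBlDr.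
    apply: (dens_vol_pole c0 Nc (sg1 0) th L1).
    by rewrite ger0_norm// (le_trans _ Y2)// invr_ge0.
apply: (@le_trans _ _ (\int[mu]_(t in box pb qb) \int[lambda]_(th in I) (g (th, t))%:E)%E); last first.
  apply: ge0_subset_integral => //.
  by move=> t _; apply: integral_ge0 => th _; rewrite lee_fin; exact: (g0 (th, t)).
(* The sign of [B] is not known here; if it is negative, the nonnegative right side settles the
   matter. *)
have [B0|B0] := leP 0 B.
  apply: ge0_le_integral => //.
  - exact: measurable_funS mG.
rewrite [leLHS](integral_cst mu mb); apply: (@le_trans _ _ 0%E).
  by rewrite mule_le0_ge0// lee_fin ltW.
by apply: integral_ge0 => t _; apply: integral_ge0 => th _; rewrite lee_fin; exact: (g0 (th, t)).
Qed.

(** 12 counts two hemispheres with 6 pi each, + 1 makes the final comparison strict, and 2^21 n^n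
    inverts the lower bound on the averaged volume. *)
Definition ratio_const : R :=
  (12 * 2 ^+ n * @curv_const R k + 1) * (2 ^+ 21 * n%:R ^+ n).

Lemma ratio_const_gt0 : 0 < ratio_const.
Proof.
apply: mulr_gt0; last by apply: mulr_gt0; apply: exprn_gt0.
apply: addr_gt0 => //; apply: mulr_gt0; last exact: curv_const_gt0.
by apply: mulr_gt0; [rewrite ltr0n|apply: exprn_gt0].
Qed.

(** Ensures that the loss 38 a * 2 pi in [integral_hemi_vol] is at most half of the main term; c <=
    1 / 16 gives N >= 2^36. *)
Let N_large : 76 <= 2 ^- 21 * N.
Proof.
have h : 16 ^+ 9 <= N.
  have -> : N = c^-1 ^+ 9.
    have c9 : c ^+ 9 != 0 by rewrite expf_neq0// gt_eqF.
    by apply: (mulIf c9); rewrite Nc exprVn mulVf.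
  rewrite lerXn2r ?nnegrE ?invr_ge0 ?(ltW c0)//.
  by rewrite -[leLHS]invrK lef_pV2 ?posrE ?invr_gt0.
rewrite mulrC ler_pdivlMr ?exprn_gt0//; apply: le_trans h.
have -> : 16 = 2 ^+ 4 :> R by rewrite -natrX.
rewrite -exprM -[(4 * 9)%N]/(15 + 21)%N exprD ler_pM2r ?exprn_gt0//.
apply: (@le_trans _ _ (2 ^+ 7)); first by rewrite -natrX ler_nat.
by apply: ler_weXn2l => //; rewrite ler1n.
Qed.

Let measurable_hemi_vol i : measurable_fun I (hemi_vol i).
Proof.
apply: (measurable_section_integral mu mI (mH i) (mvol i)) => x.
exact: dens_vol_ge0.
Qed.

Let measurable_hemi_curv i : measurable_fun I (hemi_curv i).
Proof.
apply: (measurable_section_integral mu mI (mH i) (mcurv i)) => x.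
by rewrite dens_curv_ge0// ltW.
Qed.

(* Some phase does at least as well as the average over all phases. *)
Lemma exists_good_phase : exists th v t : R,
  [/\ (\sum_(i < 2) hemi_vol i th = v%:E)%E, (\sum_(i < 2) hemi_curv i th = t%:E)%E,
      0 < t & t <= ratio_const * c * v].
Proof.
pose rho := ratio_const * c.
have K1 := @curv_const_gt0 R k.
have nn0 : 0 < n%:R ^+ n :> R by exact: exprn_gt0.
have rho0 : 0 < rho := mulr_gt0 ratio_const_gt0 c0.
apply: contrapT => none.
(* If no phase worked, this would hold for all of them, with the volume of one hemisphere already on
   the left; integrating in th contradicts the two averaged bounds. *)
have bad th : (rho%:E * hemi_vol 0 th <= hemi_curv 0 th + hemi_curv 1 th)%E.
  have [v0 v00 E0] := hemi_vol_fin 0 th; have [v1 v10 E1] := hemi_vol_fin 1 th.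
  have [t0 t00 F0] := hemi_curv_fin 0 th; have [t1 t10 F1] := hemi_curv_fin 1 th.
  have tpos : 0 < t0 by rewrite -lte_fin -F0; exact: hemi_curv_gt0.
  rewrite E0 F0 F1 -EFinM -EFinD lee_fin leNgt; apply/negP => h; apply: none.
  exists th, (v0 + v1), (t0 + t1); rewrite !big_ord_recl !big_ord0 /= !adde0.
  rewrite E0 E1 F0 F1; split=> //; first by rewrite ltr_wpDr.
  by apply: le_trans (ltW h) _; rewrite -/rho ler_pM2l// lerDl.
have vol0 th : (0 <= hemi_vol 0 th)%E.
  by apply: integral_ge0 => t _; rewrite lee_fin dens_vol_ge0.
have curv0 i th : (0 <= hemi_curv i th)%E.
  by apply: integral_ge0 => t _; rewrite lee_fin dens_curv_ge0// ltW.
have : (\int[lambda]_(th in I) (rho%:E * hemi_vol 0 th) <=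
        \int[lambda]_(th in I) (hemi_curv 0 th + hemi_curv 1 th))%E.
  apply: ge0_le_integral => //.
  - by move=> th _; rewrite mule_ge0// lee_fin ltW.
  - apply: emeasurable_funM => //; exact: measurable_cst.
  - exact: emeasurable_funD.
rewrite (ge0_integralZl_EFin lambda mI (fun th _ => vol0 th) (measurable_hemi_vol 0) (ltW rho0)).
rewrite (ge0_integralD lambda mI (fun th _ => curv0 0%N th) (measurable_hemi_curv 0)
  (fun th _ => curv0 1%N th) (measurable_hemi_curv 1)) leNgt => /negP; apply.
apply: (@le_lt_trans _ _ ((Kc * pi *+ 6 * 2 ^+ n)%:E + (Kc * pi *+ 6 * 2 ^+ n)%:E)%E).
  by apply: leeD; exact: integral_hemi_curv.
apply: (@lt_le_trans _ _ (rho%:E * ((2 ^- 20 * (a * N) * pi - 38 * a * (pi *+ 2)) * n%:R ^- n)%:E)%E); last first.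
  by apply: lee_wpmul2l; [rewrite lee_fin ltW|exact: integral_hemi_vol].
rewrite -EFinD -EFinM lte_fin.
have pi0 := pi_gt0 R.
(* The scales match: the curvature bound c^-4 is c times the volume scale a N = c^-5. This is the
   gain of one factor c. *)
have aN : c ^+ 4 * (c * (a * N)) = 1 by rewrite -Nc; ring.
have c4n0 : c ^+ 4 != 0 by rewrite gt_eqF.
have caN : c * (a * N) = c ^- 4 by apply: (mulfI c4n0); rewrite aN mulfV.
have lower : 2 ^- 21 * (a * N) * pi <= 2 ^- 20 * (a * N) * pi - 38 * a * (pi *+ 2).
  have -> : 2 ^- 20 * (a * N) * pi - 38 * a * (pi *+ 2) = (2 ^- 20 * N - 76) * (a * pi).
    by rewrite mulr2n; ring.
  have -> : 2 ^- 21 * (a * N) * pi = (2 ^- 21 * N) * (a * pi) by ring.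
  rewrite ler_pM2r ?mulr_gt0//.
  have -> : 2 ^- 20 = 2 * 2 ^- 21 :> R.
    have -> : (2 ^+ 21 : R) = 2 * 2 ^+ 20 by rewrite (exprS _ 20).
    by move: (2 ^+ 20) => z; rewrite [(2 * z)^-1]invfM mulrA divff ?mul1r// pnatr_eq0.
  by move: (2 ^- 21) N_large => z h; rewrite -mulrA; lra.
apply: (@lt_le_trans _ _ (rho * (2 ^- 21 * (a * N) * pi * n%:R ^- n))); last first.
  by rewrite ler_pM2l// ler_pM2r// invr_gt0.
have -> : rho * (2 ^- 21 * (a * N) * pi * n%:R ^- n)
    = (12 * 2 ^+ n * @curv_const R k + 1) * (c ^- 4 * pi).
  rewrite /rho /ratio_const -caN.
  have : (2 ^+ 21 : R) != 0 by rewrite expf_neq0.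
  move: (2 ^+ 21) (n%:R ^+ n) (a * N) (lt0r_neq0 nn0) => x y z y0 x0.
  by field; rewrite x0 y0.
have -> : Kc * pi *+ 6 * 2 ^+ n + Kc * pi *+ 6 * 2 ^+ n
    = (12 * 2 ^+ n * @curv_const R k) * (c ^- 4 * pi).
  by rewrite /Kc; move: (@curv_const R k) (c ^- 4) (2 ^+ n) pi => x y z t; ring.
by rewrite ltr_pM2r ?ltrDl// mulr_gt0// invr_gt0.
Qed.

End parameters.
End total_integrals.

(** * The family of hypersurfaces and the limit *)

Section thin_sphere.
Context {R : realType} {k : nat}.
Local Notation m := k.+1.
Local Notation n := m.+2.
Implicit Types (c : R).

(** As c^4 <= 1, the bound 42 c^4 + 2 on coordinate differences becomes 44, independent of c; the
    rest collects the geometry for the good phase. *)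
Lemma thin_twisted_sphere c : 0 < c -> c <= 16^-1 ->
  exists (M : set 'rV[R]_n.+1) (v t : R),
    [/\ [/\ compact M, embedded_hypersurface M & diffeomorphic (sphere R n) M],
        (ediameter M <= (Num.sqrt (44 ^+ 2 *+ n.+1))%:E)%E,
        is_volume M v%:E, is_total_curvature M t%:E
      & 0 < t /\ t <= @ratio_const R k * c * v].
Proof.
move=> c0 c16; have a0 : 0 < c ^+ 4 by exact: exprn_gt0.
have Nc : c ^- 9 * c ^+ 9 = 1 by rewrite mulVf// expf_neq0// gt_eqF.
have [th [v [t [vE tE t0 tv]]]] := @exists_good_phase R k c _ c0 c16 Nc.
exists (@twisted_sphere R m (c ^+ 4) (c ^- 9) th), v, t; split=> //.
- split; [exact: compact_twisted_sphere|exact: embedded_twisted_sphere|].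
  exact: diffeomorphic_twisted_sphere.
- apply: le_trans (@ediameter_twisted_sphere R m _ (c ^- 9) th a0) _.
  rewrite lee_fin ler_wsqrtr// lerMn2r /=.
  have a1 : c ^+ 4 <= 1.
    by rewrite exprn_ile1 ?(ltW c0)//; apply: le_trans c16 _; rewrite invf_le1// ler1n.
  have b0 : 0 <= 42 * c ^+ 4 + 2 by rewrite addr_ge0// mulr_ge0// ltW.
  rewrite lerXn2r ?nnegrE ?ler0n//.
  by have -> : 44 = 42 * 1 + 2 :> R; [rewrite mulr1 -natrD|rewrite lerD2r ler_wpM2l].
- rewrite -vE; apply: (is_surface_integral_charts (f := cst 1)
    (g := fun i => dens_vol (c ^+ 4) (c ^- 9) (hemi_sign i) th) a0) => i u hu.
  by rewrite dens_vol_ge0 mul1r chart_volume_density// sqr_hemi_sign.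
- exists (curvature (c ^+ 4) (c ^- 9) th); split; first exact: Gauss_Kronecker_curvature.
  rewrite -tE; apply: (is_surface_integral_charts
    (g := fun i => dens_curv (c ^+ 4) (c ^- 9) (hemi_sign i) th) a0) => i u hu.
  rewrite dens_curv_ge0 ?(ltW a0)// curvature_chart//.
  by rewrite chart_curvature_density// sqr_hemi_sign.
Qed.

End thin_sphere.

Theorem mainTheorem3 (R : realType) (n : nat) (hn : (3 <= n)%N) :
  exists (M : nat -> set 'rV[R]_n.+1) (vol T : nat -> R),
    [/\ forall k, [/\ compact (M k), embedded_hypersurface (M k)
                    & diffeomorphic (sphere R n) (M k)],
        exists D : R, forall k, (ediameter (M k) <= D%:E)%E,
        forall k, is_volume (M k) (vol k)%:E,
        forall k, is_total_curvature (M k) (T k)%:E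
      & (fun k => vol k / T k) @ \oo --> +oo].
Proof.
case: n hn => [|[|[|n]]] // _.
(* Tends to 0 and stays at most 1 / 16 from j = 0 on. *)
pose c (j : nat) : R := (16 + j%:R)^-1.
have d0 j : 0 < 16 + j%:R :> R by rewrite ltr_pwDl.
have c0 j : 0 < c j by rewrite invr_gt0.
have c16 j : c j <= 16^-1 by rewrite lef_pV2 ?posrE// lerDl.
have /boolp.choice[M /boolp.choice[vol /boolp.choice[T HT]]] :=
  fun j => @thin_twisted_sphere R n (c j) (c0 j) (c16 j).
exists M, vol, T; split.
- by move=> j; have [] := HT j.
- by exists (Num.sqrt (44 ^+ 2 *+ n.+4)) => j; have [] := HT j.
- by move=> j; have [] := HT j.
- by move=> j; have [] := HT j.
apply/cvgryPge => A; near=> j.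
have [_ _ _ _ [T0 TV]] := HT j.
have K0 := @ratio_const_gt0 R n.
rewrite ler_pdivlMr//.
(* The quotient is at least (16 + j) / [ratio_const], so this inequality is all that is asked of
   j. *)
have Aj : A * @ratio_const R n <= 16 + j%:R.
  apply: (@le_trans _ _ j%:R); last by rewrite lerDr.
  by near: j; exact: nbhs_infty_ger.
have TV' : T j * (16 + j%:R) <= @ratio_const R n * vol j.
  by rewrite -ler_pdivlMr// mulrAC.
rewrite -(ler_pM2l K0); apply: le_trans TV'.
by rewrite mulrA [T j * _]mulrC ler_pM2r// mulrC.
Unshelve. all: by end_near. Qed.
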